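(* Let $f\in\mathbb{R}[z_1,\dots,z_n]$ be homogeneous of degree $d\ge 1$. Then the number of distinct hyperbolicity cones of $f$, and hence the number of connected components of $\mathbb{R}^n\setminus\mathcal{I}(f)$, is at most $$\begin{cases}2^d & \text{if } d\le n,\\ 2\sum_{k=0}^{n-1}\binom{d-1}{k} & \text{if } d>n.\end{cases}$$ This maximum is attained if and only if $f=c\,\ell_1\cdots\ell_d$ with $c\in\mathbb{R}\setminus\{0\}$ and real linear forms $\ell_1,\dots,\ell_d$ that are independent in the sense that any $\min(n,d)$ of them are linearly independent.
   Context: For $f\in\mathbb{C}[z_1,\dots,z_n]$, $\mathcal{V}(f)\subseteq\mathbb{C}^n$ denotes its complex zero set and the imaginary projection of $f$ is $\mathcal{I}(f)=\{\Im(\mathbf z):\mathbf z\in\mathcal V(f)\}\subseteq\mathbb{R}^n$, where $\Im$ is taken componentwise. A homogeneous polynomial $f$ is hyperbolic in direction $\mathbf e\in\mathbb{R}^n$ if $f(\mathbf e)\neq 0$ and for every $\mathbf x\in\mathbb{R}^n$ the univariate polynomial $t\mapsto f(\mathbf x+t\mathbf e)$ has only real roots. In that case the hyperbolicity cone of $f$ with respect to $\mathbf e$ is $C(\mathbf e)=\{\mathbf x\in\mathbb{R}^n: f(\mathbf x+t\mathbf e)=0\Rightarrow t<0\}$. The hyperbolicity cones of $f$ are the sets $C(\mathbf e)$ for all directions $\mathbf e$ in which $f$ is hyperbolic. *)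

(* Defs.v *)
From Stdlib Require Import Reals List.
From mathcomp Require Import all_boot.
Set Implicit Arguments. Unset Strict Implicit. Unset Printing Implicit Defensive.

Local Open Scope R_scope.

Definition vec (n : nat) := 'I_n -> R.

Definition sumR (T : finType) (F : T -> R) : R :=
  fold_right Rplus 0 (map F (enum T)).
Definition prodR (T : finType) (F : T -> R) : R :=
  fold_right Rmult 1 (map F (enum T)).

(* A polynomial in R[z_1,...,z_n]: a finite list of monomials c * z^a. *)
Definition mpoly (n : nat) := list (R * ('I_n -> nat)).

Definition peval (n : nat) (f : mpoly n) (x : vec n) : R :=
  fold_right Rplus 0
    (map (fun m => fst m * prodR (fun i => x i ^ (snd m i))) f).

Definition C := (R * R)%type.
Definition Cadd (z w : C) : C := (fst z + fst w, snd z + snd w).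
Definition Cmul (z w : C) : C :=
  (fst z * fst w - snd z * snd w, fst z * snd w + snd z * fst w).
Definition Cof (r : R) : C := (r, 0).
Fixpoint Cpow (z : C) (k : nat) : C :=
  match k with O => (1, 0) | S k' => Cmul z (Cpow z k') end.

Definition pevalC (n : nat) (f : mpoly n) (z : 'I_n -> C) : C :=
  fold_right Cadd (0, 0)
    (map (fun m => Cmul (Cof (fst m))
                        (fold_right Cmul (1, 0)
                           (map (fun i => Cpow (z i) (snd m i)) (enum 'I_n)))) f).

(* f is homogeneous of degree d: every monomial has total degree d, and
   f is not the zero polynomial (over R, a polynomial is zero iff its
   polynomial function is zero). *)
Definition homogeneous (n : nat) (f : mpoly n) (d : nat) : Prop :=
  (forall m, In m f -> (\sum_(i < n) snd m i)%N = d) /\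
  exists x : vec n, peval f x <> 0.

Definition hyperbolic (n : nat) (f : mpoly n) (e : vec n) : Prop :=
  peval f e <> 0 /\
  forall (x : vec n) (t : C),
    pevalC f (fun i => Cadd (Cof (x i)) (Cmul t (Cof (e i)))) = (0, 0) ->
    snd t = 0.

Definition hcone (n : nat) (f : mpoly n) (e : vec n) (x : vec n) : Prop :=
  forall t : R, peval f (fun i => x i + t * e i) = 0 -> t < 0.

Definition is_hcone (n : nat) (f : mpoly n) (K : vec n -> Prop) : Prop :=
  exists e, hyperbolic f e /\ forall x, K x <-> hcone f e x.

Definition same_set (X : Type) (A B : X -> Prop) : Prop := forall x, A x <-> B x.

Definition family_at_most (X : Type) (F : (X -> Prop) -> Prop) (N : nat) : Prop :=
  exists Ks : list (X -> Prop), (length Ks <= N)%N /\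
    forall K, F K -> exists K', In K' Ks /\ same_set K K'.

Definition family_at_least (X : Type) (F : (X -> Prop) -> Prop) (N : nat) : Prop :=
  exists Ks : list (X -> Prop), length Ks = N /\
    (forall K, In K Ks -> F K) /\
    forall i j, (i < j < N)%N ->
      ~ same_set (nth (fun _ => False) Ks i) (nth (fun _ => False) Ks j).

Definition imag_proj (n : nat) (f : mpoly n) (y : vec n) : Prop :=
  exists x : vec n, pevalC f (fun i => (x i, y i)) = (0, 0).

(* Euclidean topology on R^n (via the equivalent sup-norm balls). *)
Definition open_set (n : nat) (U : vec n -> Prop) : Prop :=
  forall x, U x -> exists eps, 0 < eps /\
    forall y : vec n, (forall i, Rabs (y i - x i) < eps) -> U y.

Definition connected_set (n : nat) (A : vec n -> Prop) : Prop :=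
  forall U V : vec n -> Prop, open_set U -> open_set V ->
    (forall x, A x -> U x \/ V x) ->
    (exists x, A x /\ U x) -> (exists x, A x /\ V x) ->
    exists x, A x /\ U x /\ V x.

(* S has at most N connected components: among any N+1 points of S, two
   lie in a common connected subset of S (i.e. in the same component). *)
Definition components_at_most (n : nat) (Sset : vec n -> Prop) (N : nat) : Prop :=
  forall pts : list (vec n), length pts = N.+1 ->
    (forall p, In p pts -> Sset p) ->
    exists i j, (i < j < N.+1)%N /\
      exists A : vec n -> Prop, connected_set A /\ (forall x, A x -> Sset x) /\
        A (nth (fun _ => 0) pts i) /\ A (nth (fun _ => 0) pts j).

Definition cone_bound (n d : nat) : nat :=
  if (d <= n)%N then (2 ^ d)%N else (2 * \sum_(k < n) 'C(d.-1, k))%N.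

Definition linform (n : nat) (a : vec n) (x : vec n) : R := sumR (fun i => a i * x i).

Definition forms_independent (n d : nat) (l : 'I_d -> vec n) : Prop :=
  forall (s : 'I_(minn n d) -> 'I_d), injective s ->
    forall lam : 'I_(minn n d) -> R,
      (forall i : 'I_n, sumR (fun j => lam j * l (s j) i) = 0) ->
      forall j, lam j = 0.

(* Main.v *)
(** The complement of the imaginary projection is the set of hyperbolic
directions, and Garding's convexity theory makes the hyperbolicity cones its
components.

If f is hyperbolic in directions e0 and e, and e lies neither in C(e0) nor in
-C(e0), then f is a product of two forms of positive degree.  Indeed, for u in
the upper half plane no root s of f(e + u x + s e0) lies on the real line
spanned by u, so these roots split into two groups of constant sizes a and b.
The product of one group, as a function of u, is holomorphic in the upper half
plane, real on the boundary, has real Taylor coefficients at 0 (computed by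
Hensel lifting, the coefficient of u^k being a form of degree k in x), and grows
at most like |u|^a.  By a Liouville argument it is a polynomial of degree at
most a in u, and its leading coefficient in u is a factor of f(x).

Hence f is a product of m <= d atoms, forms whose only hyperbolicity cones are
C(e0) and -C(e0).  For an atom the linear coefficient of t in f(e0 + t x) is a
linear form in x that separates the two cones, so a hyperbolicity cone of f is
determined by its sign vector for m linear forms.  Deletion and restriction
bound the number of sign vectors by the stated quantity, with equality exactly
in general position; the bound is strictly increasing in m when n >= 2, which
forces every atom of an extremal f to be linear. *)

Require Import Defs.
From Stdlib Require Import Reals List.
From mathcomp Require Import all_boot all_order all_algebra.
From mathcomp Require Import complex.
From mathcomp Require Import boolp classical_sets reals.
From mathcomp Require topology normedtype derive Rstruct.
From mathcomp Require Import ring lra zify.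
Set Implicit Arguments. Unset Strict Implicit. Unset Printing Implicit Defensive.
Import Order.TTheory GRing.Theory Num.Theory.
Local Open Scope ring_scope.
Local Open Scope complex_scope.

Local Notation Re := complex.Re.
Local Notation Im := complex.Im.

(** * Continuity of roots *)

(** Each direction has its own task: hyperbolicity along [e] keeps the roots off the line spanned by
    u in the upper half plane, hyperbolicity along [e0] makes them real when u is real. At a real u
    other than 0 roots of different groups may collide, so the limit of the product of a group is
    not under control; the product is only known to be close to one of finitely many real
    subproducts, and the maximum principle asks for no more. At u = 0 nothing collides: f(e) <> 0
    keeps 0 from being a root, so the sign of the real part separates the groups, and both are
    non-empty because e lies outside both cones. Hence 0 is the base point of the Hensel lift, which
    is real, and homogeneous in x because x enters only as u x. Setting s = 0 turns the two factors
    into polynomials in u with product f(e + u x), whose coefficient at u^d is f(x). Holomorphy is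
    replaced by one estimate, [jets], that compares the true factors with the lifted ones: to order
    3 at interior points, to every order at 0. *)

Section ComplexNorm.
Variable R : rcfType.
Local Notation C := R[i].
Implicit Types z w : C.

(** The modulus with values in [R] itself; the norm carried by [R[i]] takes its values in [R[i]]. *)
Definition cn z : R := Normc.normc z.

Lemma cnE z : cn z = Num.sqrt (Re z ^+ 2 + Im z ^+ 2).
Proof. by case: z. Qed.

Lemma cn_ge0 z : 0 <= cn z.
Proof. by rewrite cnE sqrtr_ge0. Qed.

Lemma cn0 : cn 0 = 0.
Proof. exact: Normc.normc0. Qed.

Lemma cn1 : cn 1 = 1.
Proof. exact: Normc.normc1. Qed.

Lemma cnM z w : cn (z * w) = cn z * cn w.
Proof. exact: Normc.normcM. Qed.

Lemma cnD z w : cn (z + w) <= cn z + cn w.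
Proof. exact: (@le_normcD R). Qed.

Lemma cnN z : cn (- z) = cn z.
Proof. exact: (@normcN R). Qed.

Lemma cnB z w : cn (z - w) <= cn z + cn w.
Proof. by rewrite -(cnN w) cnD. Qed.

Lemma cnC z w : cn (z - w) = cn (w - z).
Proof. by rewrite -cnN opprB. Qed.

Lemma cn_eq0 z : (cn z == 0) = (z == 0).
Proof. by apply/eqP/eqP => [/Normc.eq0_normc //|->]; exact: cn0. Qed.

Lemma cn_gt0 z : (0 < cn z) = (z != 0).
Proof. by rewrite lt_def cn_ge0 andbT cn_eq0. Qed.

Lemma cnV z : cn z^-1 = (cn z)^-1.
Proof. exact: (@Normc.normcV R). Qed.

Lemma cnX z k : cn (z ^+ k) = cn z ^+ k.
Proof. by elim: k => [|k IH]; rewrite ?expr0 ?cn1 // !exprS cnM IH. Qed.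

Lemma cn_real (r : R) : cn r%:C = `|r|.
Proof. by rewrite cnE /= expr0n /= addr0 sqrtr_sqr. Qed.

Lemma cn_i : cn 'i = 1.
Proof. by rewrite cnE /= expr0n add0r expr1n sqrtr1. Qed.

Lemma sqr_cn z : cn z ^+ 2 = Re z ^+ 2 + Im z ^+ 2.
Proof. by rewrite cnE sqr_sqrtr // addr_ge0 ?sqr_ge0. Qed.

Lemma Re_le_cn z : `|Re z| <= cn z.
Proof. by rewrite cnE -sqrtr_sqr ler_wsqrtr // lerDl sqr_ge0. Qed.

Lemma Im_le_cn z : `|Im z| <= cn z.
Proof. by rewrite cnE -sqrtr_sqr ler_wsqrtr // lerDr sqr_ge0. Qed.

Lemma cn_le_ReIm z : cn z <= `|Re z| + `|Im z|.
Proof.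
rewrite -(ler_pXn2r (n := 2)) ?nnegrE ?cn_ge0 ?addr_ge0 //.
rewrite sqr_cn sqrrD !real_normK ?num_real // lerD2r lerDl mulrn_wge0 //.
by rewrite mulr_ge0.
Qed.

Lemma cn_sum (I : Type) (r : seq I) (P : pred I) (F : I -> C) :
  cn (\sum_(i <- r | P i) F i) <= \sum_(i <- r | P i) cn (F i).
Proof.
elim/big_rec2: _ => [|i x y _ le_yx]; first by rewrite cn0.
by rewrite (le_trans (cnD _ _)) // lerD2l.
Qed.

Lemma cn_prod (I : Type) (r : seq I) (P : pred I) (F : I -> C) :
  cn (\prod_(i <- r | P i) F i) = \prod_(i <- r | P i) cn (F i).
Proof. by elim/big_rec2: _ => [|i x y _ <-]; rewrite ?cn1 ?cnM. Qed.

Lemma ReD z w : Re (z + w) = Re z + Re w. Proof. by case: z; case: w. Qed.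
Lemma ImD z w : Im (z + w) = Im z + Im w. Proof. by case: z; case: w. Qed.
Lemma ReN z : Re (- z) = - Re z. Proof. by case: z. Qed.
Lemma ImN z : Im (- z) = - Im z. Proof. by case: z. Qed.
Lemma ReM z w : Re (z * w) = Re z * Re w - Im z * Im w.
Proof. by case: z; case: w. Qed.
Lemma ImM z w : Im (z * w) = Re z * Im w + Im z * Re w.
Proof. by case: z; case: w. Qed.

Lemma Im_eq0_real z : Im z = 0 -> z = (Re z)%:C.
Proof. by case: z => a b /= ->. Qed.

Lemma complex_ext z w : Re z = Re w -> Im z = Im w -> z = w.
Proof. by case: z => a b; case: w => a' b' /= -> ->. Qed.

End ComplexNorm.

(** * A coefficient norm on polynomials *)

Section PolyNorm.
Variables (R : rcfType) (D : nat).
Local Notation C := R[i].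
Implicit Types p q : {poly C}.

(* The truncation at the fixed degree D makes the norm a sum over a fixed
   range; it stays submultiplicative. *)
Definition pn p : R := \sum_(i < D) cn p`_i.

Lemma pn_ge0 p : 0 <= pn p.
Proof. by apply: sumr_ge0 => i _; exact: cn_ge0. Qed.

Lemma pn0 : pn 0 = 0.
Proof. by apply: big1 => i _; rewrite coef0 cn0. Qed.

Lemma pnN p : pn (- p) = pn p.
Proof. by apply: eq_bigr => i _; rewrite coefN cnN. Qed.

Lemma pnD p q : pn (p + q) <= pn p + pn q.
Proof. by rewrite -big_split /=; apply: ler_sum => i _; rewrite coefD cnD. Qed.

Lemma pnB p q : pn (p - q) <= pn p + pn q.
Proof. by rewrite -(pnN q) pnD. Qed.

Lemma pnZ c p : pn (c *: p) = cn c * pn p.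
Proof. by rewrite mulr_sumr; apply: eq_bigr => i _; rewrite coefZ cnM. Qed.

Lemma pn_sum (I : Type) (r : seq I) (P : pred I) (F : I -> {poly C}) :
  pn (\sum_(i <- r | P i) F i) <= \sum_(i <- r | P i) pn (F i).
Proof.
elim/big_rec2: _ => [|i x y _ le_yx]; first by rewrite pn0.
by rewrite (le_trans (pnD _ _)) // lerD2l.
Qed.

Lemma cn_coef_le p i : (i < D)%N -> cn p`_i <= pn p.
Proof.
move=> ltiD; rewrite /pn (bigD1 (Ordinal ltiD)) //= lerDl.
by apply: sumr_ge0 => j _; exact: cn_ge0.
Qed.

Lemma pnM p q : pn (p * q) <= pn p * pn q.
Proof.
have le1 : pn (p * q) <= \sum_(i < D) \sum_(j < D | (j <= i)%N) cn p`_j * cn q`_(i - j).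
  apply: ler_sum => i _; rewrite coefM (le_trans (cn_sum _ _ _)) //.
  rewrite (big_ord_widen_cond D xpredT (fun j => cn (p`_j * q`_(i - j)))) //.
  by apply: ler_sum => j _; rewrite cnM.
rewrite (le_trans le1) // (exchange_big_dep xpredT) //= mulr_suml.
apply: ler_sum => j _; rewrite -mulr_sumr ler_wpM2l ?cn_ge0 //.
have -> : \sum_(i < D | (j <= i)%N) cn q`_(i - j) = \sum_(k < D - j) cn q`_k.
  rewrite -(big_mkord xpredT (fun k => cn q`_k)).
  rewrite -(big_mkord (fun i => j <= i)%N (fun i => cn q`_(i - j))).
  rewrite (@big_cat_nat _ _ _ j) /= ?(ltnW (ltn_ord j)) //.
  rewrite big_nat_cond big_pred0; last by move=> i; case: ltnP => //=; rewrite ?andbF.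
  rewrite add0r -{1}(add0n j) big_addn.
  rewrite big_nat_cond [RHS]big_nat_cond.
  apply: eq_big => i; first by rewrite leq_addl andbT.
  by rewrite addnK.
rewrite /pn (big_ord_widen D (fun k => cn q`_k)) ?leq_subr // big_mkcond /=.
by apply: ler_sum => i _; case: ifP => // _; exact: cn_ge0.
Qed.

Lemma cn_horner_le p z (B : R) : (size p <= D)%N -> 1 <= B -> cn z <= B ->
  cn p.[z] <= pn p * B ^+ D.
Proof.
move=> szp B1 zB; rewrite (horner_coef_wide _ szp) (le_trans (cn_sum _ _ _)) //.
rewrite mulr_suml; apply: ler_sum => i _; rewrite cnM cnX ler_wpM2l ?cn_ge0 //.
apply: (@le_trans _ _ (B ^+ i)); first by rewrite lerXn2r ?nnegrE ?cn_ge0 // (le_trans _ B1).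
by rewrite ler_weXn2l // ltnW.
Qed.

(** Division by ['X - c%:P] is continuous, uniformly for c in a disc: Y and the product have the
    same top coefficient, and subtracting that term from Y lowers the size. [root_matching] uses
    this to split off a root. *)
Lemma pn_div_bound (M : R) (m : nat) : 0 <= M -> (m < D)%N ->
  exists2 K : R, 0 <= K & forall (c : C) (Y : {poly C}), cn c <= M ->
    (size Y <= m)%N -> pn Y <= K * pn (('X - c%:P) * Y).
Proof.
move=> M0; elim: m => [|m IH] ltmD.
  exists 0 => // c Y _; rewrite leqn0 size_poly_eq0 => /eqP->.
  by rewrite pn0 mul0r.
have [K K0 HK] := IH (ltnW ltmD).
exists (K * (1 + pn 'X^m * (pn 'X + M * pn 1)) + pn 'X^m).
  have M1 : 0 <= M * pn 1 by rewrite mulr_ge0 ?pn_ge0.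
  have := pn_ge0 'X; have := pn_ge0 'X^m => h1 h2.
  by apply: addr_ge0 => //; apply: mulr_ge0 => //; rewrite addr_ge0 // mulr_ge0 // addr_ge0.
move=> c Y cM szY.
set W := ('X - c%:P) * Y; set y := Y`_m.
have Wy : W`_m.+1 = y.
  rewrite /W mulrBl coefB coefXM coefCM /=.
  by rewrite [Y`_m.+1]nth_default ?mulr0 ?subr0.
have ley : cn y <= pn W by rewrite -Wy cn_coef_le.
set Y' := Y - y *: 'X^m.
have szY' : (size Y' <= m)%N.
  apply/leq_sizeP => j; rewrite leq_eqVlt => /predU1P[<-|ltmj].
    by rewrite coefB coefZ coefXn eqxx mulr1 subrr.
  rewrite coefB coefZ coefXn gtn_eqF // mulr0 subr0.
  by rewrite nth_default // (leq_trans szY).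
have eW' : ('X - c%:P) * Y' = W - y *: ('X^m * ('X - c%:P)).
  by rewrite /Y' mulrBr -/W -scalerAr ['X^m * _]mulrC.
have := HK c Y' cM szY'; rewrite eW' => HY'.
have leXc : pn ('X - c%:P) <= pn 'X + M * pn 1.
  rewrite (le_trans (pnB _ _)) // lerD2l -alg_polyC pnZ ler_wpM2r ?pn_ge0 //.
have leW' : pn (W - y *: ('X^m * ('X - c%:P))) <=
            pn W * (1 + pn 'X^m * (pn 'X + M * pn 1)).
  rewrite (le_trans (pnB _ _)) // [pn W * _]mulrDr mulr1 lerD2l pnZ.
  by apply: ler_pM; rewrite ?cn_ge0 ?pn_ge0 // (le_trans (pnM _ _)) // ler_wpM2l ?pn_ge0.
have eY : pn Y = pn (Y' + y *: 'X^m) by rewrite /Y' subrK.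
rewrite eY (le_trans (pnD _ _)) // mulrDl lerD //; last by rewrite pnZ mulrC ler_wpM2l ?pn_ge0.
by rewrite (le_trans HY') // -mulrA ler_wpM2l // [_ * pn W]mulrC.
Qed.

End PolyNorm.

(** * Continuity of the roots of a monic polynomial *)

Section RootMatching.
Variable R : rcfType.
Local Notation C := R[i].

Definition rprod (s : seq C) : {poly C} := \prod_(z <- s) ('X - z%:P).

Lemma size_rprod s : size (rprod s) = (size s).+1.
Proof. by rewrite /rprod size_prod_XsubC. Qed.

Lemma rprod_cons z s : rprod (z :: s) = ('X - z%:P) * rprod s.
Proof. by rewrite /rprod big_cons. Qed.

Lemma horner_rprod s z : (rprod s).[z] = \prod_(w <- s) (z - w).
Proof. by rewrite /rprod horner_prod; apply: eq_bigr => w _; rewrite hornerXsubC. Qed.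

Lemma perm_rprod s t : perm_eq s t -> rprod s = rprod t.
Proof. by move=> st; rewrite /rprod (perm_big t). Qed.

Lemma rprod_root s z : root (rprod s) z = (z \in s).
Proof. by rewrite /rprod root_prod_XsubC. Qed.

Lemma expr_lt_id (x : R) m : 0 <= x -> x < 1 -> (0 < m)%N -> x ^+ m <= x.
Proof.
by move=> x0 x1; case: m => // m _; rewrite exprS ler_piMr // exprn_ile1 // ltW.
Qed.

(** The value of [rprod s] at r0 is small and is, in modulus, the product of the distances from r0
    to the roots, so some root z is near r0. Dividing both polynomials by these linear factors
    leaves close quotients, and induction matches the remaining roots. *)
Lemma root_matching (D : nat) (r : seq C) (eps : R) :
  (size r < D)%N -> 0 < eps -> exists2 delta : R, 0 < delta &
  forall s : seq C, size s = size r -> pn D (rprod s - rprod r) < delta ->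
  exists2 s', perm_eq s' s & all2 (fun z w => cn (z - w) < eps) s' r.
Proof.
elim: r eps => [|r0 r IH] eps szr eps0.
  exists 1 => // s /size0nil-> _; by exists [::].
have [del1 del10 Hdel1] := IH eps (ltnW szr) eps0.
set M := cn r0 + 1.
have M0 : 0 <= M by rewrite addr_ge0 ?cn_ge0.
have M1 : 1 <= M by rewrite lerDr cn_ge0.
have szr1 : ((size r).+1 < D)%N by exact: szr.
have [K K0 HK] := @pn_div_bound R D M (size r).+1 M0 szr1.
set P := pn D (rprod (r0 :: r)).
have P0 : 0 <= P by exact: pn_ge0.
set L := K * (P + 1).
have L0 : 0 <= L by rewrite mulr_ge0 // addr_ge0.
pose J := @pn R D 1.
have J0 : 0 <= J by exact: pn_ge0.
set KLJ := K * (1 + L * J) + 1.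
have KLJ0 : 0 < KLJ.
  by apply: ltr_wpDl => //; rewrite mulr_ge0 // addr_ge0 // mulr_ge0.
(* [e1 <= 1] keeps the root z in the disc of radius [M]; [e1 <= del1 / KLJ] brings the quotients
   within [del1] of each other, as the induction hypothesis requires. *)
have [e1 [e10 e1eps e11 e1del]] :
    exists e1, [/\ 0 < e1, e1 <= eps, e1 <= 1 & e1 <= del1 / KLJ].
  exists (Num.min (Num.min eps 1) (del1 / KLJ)); split.
  - by rewrite !lt_min eps0 ltr01 divr_gt0.
  - by rewrite !ge_min lexx.
  - by rewrite !ge_min lexx orbT.
  - by rewrite !ge_min lexx orbT.
have MD0 : 0 < M ^+ D by rewrite exprn_gt0 // (lt_le_trans ltr01).
(* The first bound forces a root within [e1] of r0, the second enters the comparison of the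
   quotients, the third bounds the norm of [rprod s] by [P + 1]. *)
exists (Num.min (e1 ^+ (size r).+1 / M ^+ D) (Num.min e1 1)).
  by rewrite !lt_min ltr01 e10 divr_gt0 // exprn_gt0.
move=> s szs; rewrite !lt_min => /andP[lt1 /andP[lt2 lt3]].
have szs1 : size s = (size r).+1 by rewrite szs.
have [z zs zr0] : exists2 z, z \in s & cn (z - r0) < e1.
  apply/hasP; apply: contraT; rewrite -all_predC => /allP far.
  have : e1 ^+ size s <= cn (rprod s).[r0].
    rewrite horner_rprod cn_prod -(big_map (fun w => cn (r0 - w)) xpredT id).
    have: all (fun x => e1 <= x) [seq cn (r0 - w) | w <- s].
      apply/allP => _ /mapP[w ws ->]; rewrite leNgt cnC.
      by have := far _ ws.
    rewrite -[size s](size_map (fun w => cn (r0 - w))).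
    elim: [seq cn (r0 - w) | w <- s] => [|y l IHl] /=; first by rewrite big_nil expr0.
    case/andP => h1 h2; rewrite big_cons exprS ler_pM ?exprn_ge0 ?IHl //; exact: ltW.
  have : cn (rprod s).[r0] < e1 ^+ (size r).+1.
    have -> : (rprod s).[r0] = (rprod s - rprod (r0 :: r)).[r0].
      by rewrite hornerD hornerN rprod_cons hornerM hornerXsubC subrr mul0r subr0.
    apply: (@le_lt_trans _ _ (pn D (rprod s - rprod (r0 :: r)) * M ^+ D)); last first.
      by rewrite -ltr_pdivlMr.
    apply: cn_horner_le => //; last by rewrite lerDl.
    by rewrite (leq_trans (size_polyD _ _)) // size_polyN !size_rprod szs maxnn.
  by rewrite szs1 => h1 h2; have := lt_le_trans h1 h2; rewrite ltxx.
have ps := perm_to_rem zs.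
set s1 := rem z s in ps *.
have szs1' : size s1 = size r by rewrite /s1 size_rem // szs1.
have zM : cn z <= M.
  rewrite -(subrK r0 z) (le_trans (cnD _ _)) // addrC lerD2l.
  by apply: le_trans e11; exact: ltW.
have eqs : rprod s = ('X - z%:P) * rprod s1 by rewrite (perm_rprod ps) rprod_cons.
have les1 : pn D (rprod s1) <= L.
  have := HK z (rprod s1) zM; rewrite size_rprod szs1' => /(_ (leqnn _)) h.
  rewrite (le_trans h) // ler_wpM2l // -eqs -(subrK (rprod (r0 :: r)) (rprod s)).
  by rewrite (le_trans (pnD _ _ _)) // addrC lerD2l ltW.
have r0M : cn r0 <= M by rewrite lerDl.
(* The quotients are compared after multiplication by one common factor; trading z for r0 costs the
   last term. *)
have eqd : ('X - r0%:P) * (rprod s1 - rprod r) =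
   (rprod s - rprod (r0 :: r)) + (z - r0)%:P * rprod s1.
  rewrite eqs rprod_cons polyCB; ring.
have : pn D (rprod s1 - rprod r) < del1.
  have := HK r0 (rprod s1 - rprod r) r0M.
  rewrite (leq_trans (size_polyD _ _)) ?size_polyN ?size_rprod ?szs1' ?maxnn //.
  move=> /(_ isT) h; apply: (le_lt_trans h); rewrite eqd.
  apply: (@le_lt_trans _ _ (K * (e1 * (1 + L * J)))).
    rewrite ler_wpM2l // (le_trans (pnD _ _ _)) // mulrDr mulr1 lerD //; first exact: ltW.
    rewrite (le_trans (pnM _ _ _)) // -alg_polyC pnZ -mulrA.
    apply: ler_pM; rewrite ?cn_ge0 ?mulr_ge0 ?pn_ge0 ?(ltW zr0) //.
    by rewrite mulrC ler_pM ?pn_ge0.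
  rewrite mulrCA; apply: (@lt_le_trans _ _ (e1 * KLJ)).
    by rewrite ltr_pM2l // /KLJ ltrDl.
  by rewrite -ler_pdivlMr.
case/(Hdel1 s1 szs1') => s' ps' al.
exists (z :: s'); last by rewrite /= al andbT (lt_le_trans zr0).
by rewrite perm_sym (perm_trans ps) // perm_cons perm_sym.
Qed.

End RootMatching.

(** * Connectedness of the unit interval *)

Section UnitInterval.
Variable R : realType.

(** Supremum argument. It serves all connectedness arguments below: root counts along segments, and
    open covers in [cone_connected]. *)
Lemma locally_const_seg (T : Type) (h : R -> T) :
  (forall t, 0 <= t <= 1 -> exists2 e : R, 0 < e &
    forall t', 0 <= t' <= 1 -> `|t' - t| < e -> h t' = h t) ->
  h 0 = h 1.
Proof.
move=> loc.
pose S : set R := fun t => 0 <= t <= 1 /\ forall t', 0 <= t' <= t -> h t' = h 0.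
have S0 : S 0.
  split; first by rewrite lexx ler01.
  by move=> t' /andP[h1 h2]; congr h; apply/le_anti; rewrite h1 h2.
have hsS : has_sup S.
  by split; [exists 0 | exists 1 => t [/andP[_ ->]]].
have sup0 : 0 <= sup S by apply: (ub_le_sup hsS.2).
have sup1 : sup S <= 1 by apply: (ge_sup hsS.1) => t [/andP[_ ->]].
have sup01 : 0 <= sup S <= 1 by rewrite sup0.
have [e e0 He] := loc _ sup01.
have [s [Ss1 Ss2] lts] : exists2 s, S s & sup S - e < s by apply: sup_adherent.
have les : s <= sup S by apply: (ub_le_sup hsS.2); split.
have hs : h s = h (sup S).
  apply: He => //; rewrite ltr_norml; apply/andP; split; lra.
have hs0 : h s = h 0.
  by apply: Ss2; rewrite lexx andbT; case/andP: Ss1.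
have Sok t : 0 <= t <= 1 -> t < sup S + e -> S t.
  move=> /andP[t0 t1] lt; split; first by rewrite t0.
  move=> t' /andP[t'0 t't]; have [le|gt] := leP t' s.
    by apply: Ss2; rewrite t'0.
  rewrite -hs0 hs; apply: He; first lra.
  rewrite ltr_norml; apply/andP; split; lra.
have [lt1|ge1] := ltP 1 (sup S + e).
  have [|_ /(_ 1)->//] := Sok 1 _ lt1; by rewrite lexx ler01.
have : S (sup S + e / 2) by apply: Sok; lra.
move/(ub_le_sup hsS.2) => hh; exfalso; lra.
Qed.

End UnitInterval.

(** * Families of polynomials depending on a parameter *)

Section BivariateContinuity.
Variables (R : rcfType) (D : nat).
Local Notation C := R[i].
Implicit Type Q : {poly {poly C}}.

(** In a family the outer variable of [Q] is the parameter and the inner one the root variable, so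
    [Q.[c%:P]] is the member at c. *)
Lemma pn_horner_bounded Q (M : R) : 0 <= M ->
  exists2 K : R, 0 <= K & forall c : C, cn c <= M -> pn D Q.[c%:P] <= K.
Proof.
move=> M0; elim/poly_ind: Q => [|Q b [K K0 HK]].
  by exists 0 => // c _; rewrite horner0 pn0.
exists (K * (M * @pn R D 1) + pn D b).
  by rewrite addr_ge0 ?mulr_ge0 ?pn_ge0.
move=> c cM; rewrite hornerMXaddC (le_trans (pnD _ _ _)) // lerD2r.
rewrite (le_trans (pnM _ _ _)) // ler_pM ?pn_ge0 // ?HK //.
by rewrite -alg_polyC pnZ ler_wpM2r ?pn_ge0.
Qed.

Lemma pn_horner_lip Q (M : R) : 0 <= M ->
  exists2 K : R, 0 <= K & forall c c' : C, cn c <= M -> cn c' <= M ->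
    pn D (Q.[c'%:P] - Q.[c%:P]) <= K * cn (c' - c).
Proof.
move=> M0; elim/poly_ind: Q => [|Q b [K K0 HK]].
  by exists 0 => // c c' _ _; rewrite !horner0 subr0 pn0 mul0r.
have [B B0 HB] := pn_horner_bounded Q M0.
exists (K * (M * @pn R D 1) + B * @pn R D 1).
  by rewrite addr_ge0 ?mulr_ge0 ?pn_ge0.
move=> c c' cM c'M; rewrite !hornerMXaddC.
have -> : Q.[c'%:P] * c'%:P + b - (Q.[c%:P] * c%:P + b) =
  (Q.[c'%:P] - Q.[c%:P]) * c'%:P + Q.[c%:P] * (c' - c)%:P.
  rewrite polyCB; ring.
rewrite (le_trans (pnD _ _ _)) // [_ * cn _]mulrDl lerD //.
  rewrite (le_trans (pnM _ _ _)) // [K * _ * _]mulrAC; apply: ler_pM; rewrite ?pn_ge0 ?HK //.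
  by rewrite -alg_polyC pnZ ler_wpM2r ?pn_ge0.
rewrite (le_trans (pnM _ _ _)) // -mulrA; apply: ler_pM; rewrite ?pn_ge0 ?HB //.
by rewrite -alg_polyC pnZ mulrC.
Qed.

Lemma pn_horner_cont Q (c0 : C) (eps : R) : 0 < eps ->
  exists2 del : R, 0 < del & forall c : C, cn (c - c0) < del ->
    pn D (Q.[c%:P] - Q.[c0%:P]) < eps.
Proof.
move=> eps0; have M0 : 0 <= cn c0 + 1 by rewrite addr_ge0 ?cn_ge0.
have [K K0 HK] := pn_horner_lip Q M0.
have K1 : 0 < K + 1 by rewrite ltr_wpDl.
exists (Num.min 1 (eps / (K + 1))); first by rewrite lt_min ltr01 divr_gt0.
move=> c; rewrite lt_min => /andP[h1 h2].
have cM : cn c <= cn c0 + 1.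
  by rewrite -(subrK c0 c) (le_trans (cnD _ _)) // addrC lerD2l ltW.
have c0M : cn c0 <= cn c0 + 1 by rewrite lerDl.
apply: (le_lt_trans (HK c0 c c0M cM)); rewrite ltr_pdivlMr // in h2.
apply: le_lt_trans h2; rewrite mulrC ler_wpM2l ?cn_ge0 //; lra.
Qed.

End BivariateContinuity.

(** * Products over selections of nearby roots *)

Section ListCloseness.
Variable R : rcfType.
Local Notation C := R[i].

Definition close (e : R) (z w : C) := cn (z - w) < e.

Lemma all2_impl (A B : Type) (r1 r2 : A -> B -> bool) s t :
  (forall x y, r1 x y -> r2 x y) -> all2 r1 s t -> all2 r2 s t.
Proof.
move=> H; elim: s t => [|x s IH] [|y t] //= /andP[h1 h2].
by rewrite H //= IH.
Qed.

Lemma all2_size (A B : Type) (r : A -> B -> bool) s t : all2 r s t -> size s = size t.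
Proof. by elim: s t => [|x s IH] [|y t] //= /andP[_ /IH->]. Qed.

Lemma all2_filter (A B : Type) (r : A -> B -> bool) (a : pred A) (b : pred B) s t :
  all2 (fun x y => r x y && (a x == b y)) s t ->
  all2 r (filter a s) (filter b t).
Proof.
elim: s t => [|x s IH] [|y t] //= /andP[/andP[h1 /eqP h2] h3].
by rewrite h2; case: (b y) => /=; rewrite ?h1 IH.
Qed.

Lemma pn_rprod_mask_bounded D (r : seq C) :
  exists2 K : R, 0 <= K & forall m, pn D (rprod (mask m r)) <= K.
Proof.
elim: r => [|z r [K K0 HK]].
  by exists (pn D (rprod [::] : {poly C})) => [|m]; rewrite ?pn_ge0 // mask0.
exists (K + pn D ('X - z%:P) * K); first by rewrite addr_ge0 ?mulr_ge0 ?pn_ge0.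
case=> [|c m]; first by rewrite mask0s (le_trans (HK [::])) ?lerDl ?mulr_ge0 ?pn_ge0.
case: c => /=; last by rewrite (le_trans (HK m)) // lerDl mulr_ge0 ?pn_ge0.
rewrite rprod_cons (le_trans (pnM _ _ _)) // (@le_trans _ _ (pn D ('X - z%:P) * K)) //.
  by rewrite ler_wpM2l ?pn_ge0.
by rewrite lerDr.
Qed.

Lemma half_bound (x y e : R) : 0 <= x -> x * (2 * y + 1) < e -> x * y <= e / 2.
Proof. move=> x0; rewrite mulrDr mulr1 mulrCA; lra. Qed.

(** The radius is the same for all masks. In [fil_boundary] the selection varies with u in an
    uncontrolled way, so all subproducts must be close at once. *)
Lemma rprod_mask_close D (r : seq C) (eps : R) : 0 < eps ->
  exists2 del : R, 0 < del & forall s m, all2 (close del) s r ->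
    pn D (rprod (mask m s) - rprod (mask m r)) < eps.
Proof.
elim: r eps => [|z r IH] eps eps0.
  exists 1 => // -[|//] m _; by rewrite mask0 subrr pn0.
have [K K0 HK] := pn_rprod_mask_bounded D r.
pose N := pn D ('X - z%:P) + @pn R D 1 + 1.
have X0 := pn_ge0 D ('X - z%:P); have One0 := @pn_ge0 R D 1.
have N0 : 0 < N by rewrite /N; lra.
have e0 : 0 < Num.min eps (eps / (2 * N)) by rewrite lt_min eps0 divr_gt0 // mulr_gt0.
have [del del0 Hdel] := IH _ e0.
pose N' := 2 * (@pn R D 1 * K) + 1.
have J0 : 0 <= @pn R D 1 * K by rewrite mulr_ge0.
have N'0 : 0 < N' by rewrite /N'; lra.
exists (Num.min 1 (Num.min del (eps / N'))).
  by rewrite !lt_min ltr01 del0 divr_gt0.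
case=> // w s m /= /andP[]; rewrite {1}/close !lt_min => /andP[w1 /andP[w2 w3]] al.
have al' : all2 (close del) s r.
  by apply: all2_impl al => x y; rewrite /close !lt_min => /andP[_ /andP[->]].
case: m => [|c m]; first by rewrite !mask0s subrr pn0.
have := Hdel s m al'; rewrite lt_min => /andP[h1 h2].
case: c => //=; rewrite !rprod_cons.
set A := rprod (mask m s); set B := rprod (mask m r).
have -> : ('X - w%:P) * A - ('X - z%:P) * B =
   (('X - z%:P) - (w - z)%:P) * (A - B) - (w - z)%:P * B.
  rewrite polyCB; ring.
have leC : pn D (w - z)%:P <= cn (w - z) * @pn R D 1 by rewrite -alg_polyC pnZ.
have le1 : pn D (('X - z%:P) - (w - z)%:P) <= N.
  rewrite (le_trans (pnB _ _ _)) // /N -addrA lerD2l (le_trans leC) //.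
  by rewrite (@le_trans _ _ (@pn R D 1)) ?lerDl // ler_piMl // ltW.
have le2 : pn D ((('X - z%:P) - (w - z)%:P) * (A - B)) < eps / 2.
  apply: (le_lt_trans (pnM _ _ _)).
  apply: (@le_lt_trans _ _ (N * pn D (A - B))); first by rewrite ler_wpM2r ?pn_ge0.
  rewrite -ltr_pdivlMl // ; apply: (lt_le_trans h2).
  by rewrite invfM mulrA [N^-1 * _]mulrC mulrAC.
have le3 : pn D ((w - z)%:P * B) <= eps / 2.
  rewrite (le_trans (pnM _ _ _)) //.
  apply: (@le_trans _ _ (cn (w - z) * (@pn R D 1 * K))).
    by rewrite mulrA ler_pM ?pn_ge0 // HK.
  by rewrite half_bound ?cn_ge0 // -ltr_pdivlMr.
by apply: (le_lt_trans (pnB _ _ _)); rewrite [eps]splitr ltr_leD.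
Qed.

Lemma rprod_close D (r : seq C) (eps : R) : 0 < eps ->
  exists2 del : R, 0 < del & forall s, all2 (close del) s r ->
    pn D (rprod s - rprod r) < eps.
Proof.
move=> /(rprod_mask_close D r)[del del0 H]; exists del => // s al.
have := H s (nseq (size s) true) al.
by rewrite (all2_size al) !mask_true // (all2_size al).
Qed.

End ListCloseness.

(** * Root counts in families *)

Section RootFamilies.
Variables (R : realType).
Local Notation C := R[i].

Definition rts (p : {poly C}) : seq C := sval (closed_field_poly_normal p).

Lemma rtsE p : p = lead_coef p *: rprod (rts p).
Proof. by rewrite /rts; case: closed_field_poly_normal. Qed.

Lemma mem_rts p z : p != 0 -> (z \in rts p) = root p z.
Proof.
move=> p0; rewrite {2}(rtsE p) rootZ ?rprod_root //.
by rewrite lead_coef_eq0.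
Qed.

Section Family.
Variables (Q : {poly {poly C}}) (lam : C) (d : nat).
Hypothesis lam0 : lam != 0.
Hypothesis szQ : forall c : C, (size Q.[c%:P] <= d.+1)%N.
Hypothesis ldQ : forall c : C, Q.[c%:P]`_d = lam.

(** Roots with multiplicity. Since the coefficient [lam] of degree d does not vary, no root escapes
    to infinity and every fibre has d elements. *)
Definition fib (c : C) : seq C := rts Q.[c%:P].

Lemma size_fam c : size Q.[c%:P] = d.+1.
Proof.
apply/eqP; rewrite eqn_leq szQ /= ltnNge; apply/negP => le.
by have := ldQ c; rewrite nth_default // => /eqP; rewrite eq_sym (negPf lam0).
Qed.

Lemma fam_neq0 c : Q.[c%:P] != 0.
Proof. by rewrite -size_poly_gt0 size_fam. Qed.

Lemma famE c : Q.[c%:P] = lam *: rprod (fib c).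
Proof. by rewrite {1}(rtsE Q.[c%:P]) lead_coefE size_fam ldQ. Qed.

Lemma size_fib c : size (fib c) = d.
Proof.
have := size_fam c; rewrite famE size_scale // size_rprod.
by case.
Qed.

Lemma mem_fib c z : (z \in fib c) = root Q.[c%:P] z.
Proof. by rewrite mem_rts ?fam_neq0. Qed.

Lemma fib_close c0 (eps : R) : 0 < eps -> exists2 del : R, 0 < del &
  forall c, cn (c - c0) < del ->
  exists2 s, perm_eq s (fib c) & all2 (close eps) s (fib c0).
Proof.
move=> eps0; have szr : (size (fib c0) < d.+2)%N by rewrite size_fib.
have [del1 del10 H1] := root_matching szr eps0.
have laminv : 0 < cn lam by rewrite cn_gt0.
have [del del0 H] := pn_horner_cont d.+2 Q c0 (mulr_gt0 laminv del10).
exists del => // c /H; rewrite !famE -scalerBr pnZ ltr_pM2l // => lt1.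
by apply: H1 => //; rewrite !size_fib.
Qed.

(** Local constancy jointly in parameter and root: the predicate may move with the parameter, as
    [sel] does. *)
Definition stable_at (P : C -> C -> bool) (c0 z : C) :=
  exists2 e : R, 0 < e & forall c' z', cn (c' - c0) < e -> cn (z' - z) < e ->
    P c' z' = P c0 z.

Lemma stable_common (P : C -> C -> bool) c0 (r : seq C) :
  (forall z, z \in r -> stable_at P c0 z) ->
  exists2 e : R, 0 < e & forall z, z \in r -> forall c' z',
    cn (c' - c0) < e -> cn (z' - z) < e -> P c' z' = P c0 z.
Proof.
elim: r => [|z r IH] H; first by exists 1.
have [e1 e10 H1] := H z (mem_head _ _).
have [|e2 e20 H2] := IH; first by move=> w wr; apply: H; rewrite in_cons wr orbT.
exists (Num.min e1 e2); first by rewrite lt_min e10.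
move=> w; rewrite in_cons => wr c' z'; rewrite !lt_min => /andP[a1 a2] /andP[b1 b2].
case/orP: wr => [/eqP wz|wr]; last by apply: H2.
by rewrite wz in b1 b2 *; apply: H1.
Qed.

Lemma fib_close_stable (P : C -> C -> bool) c0 (eps : R) : 0 < eps ->
  (forall z, z \in fib c0 -> stable_at P c0 z) ->
  exists2 del : R, 0 < del & forall c, cn (c - c0) < del ->
  exists2 s, perm_eq s (fib c) &
    all2 (fun z w => close eps z w && (P c z == P c0 w)) s (fib c0).
Proof.
move=> eps0 /stable_common[e e0 He].
have m0 : 0 < Num.min eps e by rewrite lt_min eps0.
have [del del0 H] := fib_close c0 m0.
exists (Num.min del e); first by rewrite lt_min del0.
move=> c; rewrite lt_min => /andP[/H[s ps al] ce]; exists s => //.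
move: He al; elim: s (fib c0) {ps} => [|z s IH] [|w r] //= He /andP[zw al].
move: zw; rewrite /close lt_min => /andP[-> zw] /=.
rewrite (He w (mem_head _ _)) // eqxx /=; apply: IH => // w' w'r.
by apply: He; rewrite in_cons w'r orbT.
Qed.

Lemma fib_filter_close (P : C -> C -> bool) c0 (eps : R) : 0 < eps ->
  (forall z, z \in fib c0 -> stable_at P c0 z) ->
  exists2 del : R, 0 < del & forall c, cn (c - c0) < del ->
  exists2 s, perm_eq s (filter (P c) (fib c)) &
    all2 (close eps) s (filter (P c0) (fib c0)).
Proof.
move=> eps0 st; have [del del0 H] := fib_close_stable eps0 st.
exists del => // c /H[s ps al]; exists (filter (P c) s); first by apply: perm_filter.
exact: all2_filter al.
Qed.

(** Roots move continuously and keep their truth values under small moves, so the count is locally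
    constant along the segment. *)
Lemma count_fib_const (P : C -> C -> bool) (c0 c1 : C) :
  (forall t : R, 0 <= t <= 1 ->
    forall z, z \in fib (c0 + t%:C * (c1 - c0)) ->
    stable_at P (c0 + t%:C * (c1 - c0)) z) ->
  count (P c0) (fib c0) = count (P c1) (fib c1).
Proof.
move=> st; pose h (t : R) := let c := c0 + t%:C * (c1 - c0) in count (P c) (fib c).
have -> : count (P c0) (fib c0) = h 0 by rewrite /h rmorph0 mul0r addr0.
have -> : count (P c1) (fib c1) = h 1 by rewrite /h rmorph1 mul1r addrC subrK.
apply: locally_const_seg => t t01.
have [del del0 H] := fib_filter_close ltr01 (st t t01).
have N0 : 0 < cn (c1 - c0) + 1 by rewrite ltr_wpDl ?cn_ge0.
exists (del / (cn (c1 - c0) + 1)); first by rewrite divr_gt0.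
move=> t' _; rewrite ltr_pdivlMr // => lt.
have lt' : cn (c0 + t'%:C * (c1 - c0) - (c0 + t%:C * (c1 - c0))) < del.
  have -> : c0 + t'%:C * (c1 - c0) - (c0 + t%:C * (c1 - c0)) =
            (t' - t)%:C * (c1 - c0) by rewrite rmorphB; ring.
  rewrite cnM cn_real; apply: le_lt_trans lt; rewrite ler_wpM2l //; lra.
have [s ps al] := H _ lt'.
by rewrite /h -!size_filter -(perm_size ps) (all2_size al).
Qed.

End Family.
End RootFamilies.

(** * Maximum principle in the upper half plane *)

Section MaximumPrinciple.
Import topology normedtype derive numFieldNormedType.Exports.
Variable R : realType.
Local Open Scope classical_set_scope.
Local Open Scope ring_scope.
Local Notation C := R[i].

(** Compactness of a rectangle, phrased with explicit radii so that the argument around it stays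
    elementary. *)
Lemma EVT_rect (a b c d : R) (f : R -> R -> R) : a <= b -> c <= d ->
  (forall x y, a <= x <= b -> c <= y <= d -> forall eps, 0 < eps ->
    exists2 del : R, 0 < del & forall x' y', a <= x' <= b -> c <= y' <= d ->
      `|x' - x| < del -> `|y' - y| < del -> `|f x' y' - f x y| < eps) ->
  exists x0 y0, [/\ a <= x0 <= b, c <= y0 <= d &
    forall x y, a <= x <= b -> c <= y <= d -> f x y <= f x0 y0].
Proof.
move=> ab cd cont.
pose A : set (R * R) := (`[a, b]%classic `*` `[c, d]%classic)%classic.
have A0 : (A !=set0)%classic by exists (a, c); split; rewrite /= in_itv /= lexx ?ab ?cd.
have cA : compact A by apply: compact_setX; exact: segment_compact.
have cf : {within A, continuous (fun p : R * R => f p.1 p.2)}.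
  apply/subspace_continuousP => -[x y] [/= xab ycd].
  rewrite in_itv /= in xab; rewrite in_itv /= in ycd.
  apply/cvgrPdist_lt => eps eps0.
  have [del del0 H] := cont x y xab ycd eps eps0.
  rewrite /within /=; exists (ball x del, ball y del).
    by split; apply/nbhs_ballP; exists del.
  move=> [x' y'] [/= hx hy] [/= x'ab y'cd].
  rewrite in_itv /= in x'ab; rewrite in_itv /= in y'cd.
  rewrite distrC; apply: H => //; rewrite distrC; [exact: hx | exact: hy].
have [[x0 y0] c0 H] := compact_EVT_max A0 cA cf.
move: c0; rewrite inE => -[/= h1 h2]; rewrite in_itv /= in h1; rewrite in_itv /= in h2.
exists x0, y0; split => // x y hx hy.
by apply: (H (x, y)); rewrite inE; split; rewrite /= in_itv.
Qed.

(* The only trace of holomorphy that is used: it suffices for the four-point mean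
   value property, up to a cubic error. *)
Definition exp3 (phi : C -> C) (u0 : C) :=
  exists c0 c1 c2 : C, exists K del : R, 0 < del /\ forall h, cn h < del ->
    cn (phi (u0 + h) - (c0 + c1 * h + c2 * h ^+ 2)) <= K * cn h ^+ 3.

(** The four steps are h times the fourth roots of unity, whose sum and whose sum of squares vanish,
    so the linear and quadratic terms cancel. *)
Lemma exp3_mean (phi : C -> C) u0 : exp3 phi u0 ->
  exists2 K : R, 0 <= K & exists2 del : R, 0 < del & forall h : R, 0 < h < del ->
    cn (phi (u0 + h%:C) + phi (u0 - h%:C) + phi (u0 + h%:C * 'i) + phi (u0 - h%:C * 'i)
        - 4%:R * phi u0) <= K * h ^+ 3.
Proof.
case=> c0 [c1 [c2 [K [del [del0 H]]]]].
have K'0 : 0 <= `|K| by [].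
exists (4%:R * `|K|); first by rewrite mulr_ge0 // ler0n.
exists del => // h /andP[h0 hdel].
(* At h = 0 the error bound is 0, which identifies the constant term. *)
have e0 : phi u0 = c0.
  have := H 0; rewrite cn0 !expr0n /= !mulr0 !addr0 => /(_ del0) le0.
  by apply/eqP; rewrite -subr_eq0 -cn_eq0 eq_le cn_ge0 le0.
have nh : cn h%:C = h by rewrite cn_real gtr0_norm.
have nhi : cn (h%:C * 'i) = h by rewrite cnM cn_i mulr1.
have bnd k : cn k = h -> cn (phi (u0 + k) - (c0 + c1 * k + c2 * k ^+ 2)) <= `|K| * h ^+ 3.
  move=> kh; have := H k; rewrite kh => /(_ hdel) le1; apply: (le_trans le1).
  by rewrite ler_wpM2r ?ler_norm // exprn_ge0 // ltW.
have b1 := bnd _ nh; have b2 := bnd (- h%:C) _; rewrite cnN in b2; have {}b2 := b2 nh.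
have b3 := bnd _ nhi; have b4 := bnd (- (h%:C * 'i)) _; rewrite cnN in b4.
have {}b4 := b4 nhi.
rewrite e0.
set A1 := phi _ - _ in b1; set A2 := phi _ - _ in b2.
set A3 := phi _ - _ in b3; set A4 := phi _ - _ in b4.
have -> : phi (u0 + h%:C) + phi (u0 - h%:C) + phi (u0 + h%:C * 'i) +
   phi (u0 - h%:C * 'i) - 4%:R * c0 = A1 + A2 + A3 + A4.
  rewrite /A1 /A2 /A3 /A4; have i2 : 'i ^+ 2 = -1 :> C by rewrite sqr_i.
  have ei : (h%:C * 'i) ^+ 2 = - (h%:C ^+ 2) by rewrite exprMn i2 mulrN1.
  rewrite !sqrrN ei; ring.
have := cnD (A1 + A2 + A3) A4; have := cnD (A1 + A2) A3; have := cnD A1 A2.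
move: (cn (A1 + A2 + A3 + A4)) (cn (A1 + A2 + A3)) (cn (A1 + A2)) b1 b2 b3 b4.
move: (cn A1) (cn A2) (cn A3) (cn A4) (`|K| * h ^+ 3) (mulrA 4%:R `|K| (h ^+ 3)).
move=> x1 x2 x3 x4 y <- *; lra.
Qed.

Lemma exp3_cont (phi : C -> C) u0 (eps : R) : exp3 phi u0 -> 0 < eps ->
  exists2 del : R, 0 < del & forall u, cn (u - u0) < del -> cn (phi u - phi u0) < eps.
Proof.
case=> c0 [c1 [c2 [K [del [del0 H]]]]] eps0.
have e0 : phi u0 = c0.
  have := H 0; rewrite cn0 !expr0n /= !mulr0 !addr0 => /(_ del0) le0.
  by apply/eqP; rewrite -subr_eq0 -cn_eq0 eq_le cn_ge0 le0.
pose B := `|K| + cn c1 + cn c2 + 1.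
have B0 : 0 < B by rewrite ltr_wpDl // !addr_ge0 ?cn_ge0.
exists (Num.min del (Num.min 1 (eps / B))); first by rewrite !lt_min del0 ltr01 divr_gt0.
move=> u; rewrite !lt_min => /andP[h1 /andP[h2 h3]].
have := H _ h1; rewrite [u0 + _]addrC subrK e0 => le1.
set h := u - u0 in h1 h2 h3 le1 *.
have hh0 := cn_ge0 h.
have -> : phi u - c0 = (phi u - (c0 + c1 * h + c2 * h ^+ 2)) + (c1 * h + c2 * h ^+ 2) by ring.
apply: (le_lt_trans (cnD _ _)).
apply: (@le_lt_trans _ _ (B * cn h)); last by rewrite mulrC -ltr_pdivlMr.
apply: (@le_trans _ _ (`|K| * cn h + (cn c1 * cn h + cn c2 * cn h))); last first.
  rewrite -!mulrDl ler_wpM2r // /B; set a := `|K|; lra.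
apply: lerD.
  apply: (le_trans le1); apply: (@le_trans _ _ (`|K| * cn h ^+ 3)).
    by rewrite ler_wpM2r ?exprn_ge0 // ler_norm.
  by rewrite ler_wpM2l // expr_lt_id.
apply: (le_trans (cnD _ _)); rewrite cnM [cn (c2 * _)]cnM cnX lerD2l.
by rewrite ler_wpM2l ?cn_ge0 // expr_lt_id.
Qed.

Definition upper (u : C) := 0 < Im u.

(* A positive value of Im psi would give, after adding a small multiple of |u|^2,
   an interior maximum that contradicts exp3_mean. *)
Lemma max_principle (psi : C -> C) :
  (forall u, upper u -> exp3 psi u) ->
  (forall r eps : R, 0 < eps -> exists2 del : R, 0 < del &
     forall u, upper u -> cn (u - r%:C) < del -> `|Im (psi u)| < eps) ->
  (forall eps : R, 0 < eps -> exists M : R,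
     forall u, upper u -> M < cn u -> cn (psi u) < eps) ->
  forall u, upper u -> Im (psi u) <= 0.
Proof.
move=> Hexp Hbd Hinf u1 u1H; rewrite leNgt; apply/negP => mu0.
set mu := Im (psi u1) in mu0.
have mu20 : 0 < mu / 2 by lra.
have [M0 HM0] := Hinf _ mu20.
pose M := Num.max M0 0.
have HM u : upper u -> M < cn u -> cn (psi u) < mu / 2.
  by move=> uH; rewrite gt_max => /andP[h _]; exact: HM0.
have Mge0 : 0 <= M by rewrite le_max lexx orbT.
pose rho := M + cn u1 + 1.
have cu1 := cn_ge0 u1.
have rho1 : 1 <= rho by rewrite /rho; lra.
have rhoM : M + 1 <= rho by rewrite /rho; lra.
have rhou1 : cn u1 <= rho by rewrite /rho; lra.
clearbody M rho.
have rho0 : 0 < rho by lra.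
have rho2 : 0 < rho ^+ 2 by rewrite exprn_gt0.
(* With this constant the perturbation [del] |u|^2 is at most mu / 4 on the rectangle, too little to
   outweigh the value mu at u1. *)
pose del := mu / (8 * rho ^+ 2).
have del0 : 0 < del by rewrite divr_gt0 // mulr_gt0.
have delrho : del * rho ^+ 2 = mu / 8 by rewrite /del; field; rewrite gt_eqF.
clearbody del.
(* Extension by 0 to the real axis; the boundary hypothesis makes it continuous there. *)
pose v (x y : R) : R := if 0 < y then Im (psi (x +i* y)) else 0.
pose g (x y : R) := v x y + del * (x ^+ 2 + y ^+ 2).
have leab : - rho <= rho by lra.
have diffn (x y x' y' : R) : cn ((x' +i* y') - (x +i* y)) <= `|x' - x| + `|y' - y|.
  exact: cn_le_ReIm.
have vcont (x y eps : R) : 0 <= y -> 0 < eps -> exists2 dl : R, 0 < dl & forall x' y' : R,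
    0 <= y' -> `|x' - x| < dl -> `|y' - y| < dl -> `|v x' y' - v x y| < eps.
  rewrite le_eqVlt => /predU1P[<-|y0] eps0.
    have [dl dl0 Hdl] := Hbd x eps eps0.
    exists (dl / 2); first by lra.
    move=> x' y' y'0 hx hy; rewrite /v ltxx subr0.
    case: ifP => [y'p|_]; last by rewrite normr0.
    apply: Hdl; first exact: y'p.
    have le1 : cn (x' +i* y' - x%:C) <= _ := diffn x 0 x' y'.
    apply: (le_lt_trans le1); rewrite subr0; rewrite subr0 in hy; lra.
  have [dl dl0 Hdl] := @exp3_cont psi (x +i* y) eps (Hexp (x +i* y) y0) eps0.
  exists (Num.min (dl / 2) y); first by rewrite lt_min y0 divr_gt0.
  move=> x' y' y'0; rewrite !lt_min => /andP[hx _] /andP[hy hy'].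
  have y'p : 0 < y' by move: hy'; rewrite ltr_norml => /andP[]; lra.
  rewrite /v y0 y'p -ImN -ImD; apply: (le_lt_trans (Im_le_cn _)); apply: Hdl.
  apply: (le_lt_trans (diffn x y x' y')); lra.
have gcont (x y : R) : - rho <= x <= rho -> 0 <= y <= rho -> forall eps, 0 < eps ->
    exists2 dl : R, 0 < dl & forall x' y', - rho <= x' <= rho -> 0 <= y' <= rho ->
      `|x' - x| < dl -> `|y' - y| < dl -> `|g x' y' - g x y| < eps.
  move=> /andP[x1 x2] /andP[y1 y2] eps eps0.
  have eps20 : 0 < eps / 2 by lra.
  have [dl dl0 Hdl] := vcont x y _ y1 eps20.
  pose L := del * (4 * rho) + 1.
  have drho : 0 <= del * (4 * rho) by apply: mulr_ge0; [exact: ltW | lra].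
  have L0 : 0 < L by rewrite /L; lra.
  exists (Num.min dl (eps / 2 / L)); first by rewrite lt_min dl0 divr_gt0.
  move=> x' y' /andP[x'1 x'2] /andP[y'1 y'2]; rewrite !lt_min.
  move=> /andP[hx hx'] /andP[hy hy'].
  have := Hdl x' y' y'1 hx hy => hv.
  have -> : g x' y' - g x y = (v x' y' - v x y) +
     del * ((x' - x) * (x' + x) + (y' - y) * (y' + y)) by rewrite /g; ring.
  apply: (le_lt_trans (ler_normD _ _)).
  have nx : `|(x' - x) * (x' + x)| <= (eps / 2 / L) * (2 * rho).
    by rewrite normrM ler_pM ?(ltW hx') // ler_norml; apply/andP; split; lra.
  have ny : `|(y' - y) * (y' + y)| <= (eps / 2 / L) * (2 * rho).
    by rewrite normrM ler_pM ?(ltW hy') // ler_norml; apply/andP; split; lra.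
  have nn : `|del * ((x' - x) * (x' + x) + (y' - y) * (y' + y))| <= eps / 2.
    rewrite normrM (gtr0_norm del0).
    apply: (@le_trans _ _ (del * ((eps / 2 / L) * (4 * rho)))).
      rewrite ler_wpM2l ?(ltW del0) // (le_trans (ler_normD _ _)) //.
      apply: (le_trans (lerD nx ny)); rewrite -mulrDr; set q := eps / 2 / L.
      by rewrite ler_wpM2l ?divr_ge0 ?(ltW eps20) ?(ltW L0) //; lra.
    have -> : del * (eps / 2 / L * (4 * rho)) = eps / 2 * (del * (4 * rho) / L) by ring.
    by rewrite ler_piMr ?(ltW eps20) // ler_pdivrMr // mul1r /L lerDl.
  lra.
have [x0 [y0 [/andP[hx1 hx2] /andP[hy1 hy2] Hmax]]] := EVT_rect leab (ltW rho0) gcont.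
have sqb (z : R) : - rho <= z <= rho -> del * z ^+ 2 <= mu / 8.
  move=> /andP[z1 z2]; rewrite -delrho ler_pM2l // -[z ^+ 2]real_normK ?num_real //.
  by rewrite lerXn2r ?nnegrE ?(ltW rho0) // ler_norml z1.
have gu1 : mu <= g x0 y0.
  have rb := Re_le_cn u1; have ib := Im_le_cn u1.
  have le2 : g (Re u1) (Im u1) <= g x0 y0.
    apply: Hmax; move: rb ib; rewrite !ler_norml => /andP[? ?] /andP[? ?].
      by apply/andP; split; lra.
    by apply/andP; split; [exact: ltW | lra].
  apply: le_trans le2; have u1H' : 0 < Im u1 := u1H; rewrite /g /v u1H'.
  have -> : Re u1 +i* Im u1 = u1 by case: (u1).
  by rewrite lerDl mulr_ge0 ?(ltW del0) // addr_ge0 // sqr_ge0.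
have bx : del * x0 ^+ 2 <= mu / 8 by apply: sqb; rewrite hx1.
have by0 : del * y0 ^+ 2 <= mu / 8 by apply: sqb; apply/andP; split; lra.
have y0p : 0 < y0.
  rewrite ltNge; apply/negP => y0le; have yz : y0 = 0 by apply/le_anti; rewrite y0le.
  move: gu1 by0; rewrite /g /v yz ltxx mulrDr; lra.
pose us : C := x0 +i* y0.
(* At the maximum v is at least 3 mu / 4, whereas |psi| < mu / 2 beyond [M]. Since [rho >= M + 1],
   the maximum stays at distance at least 1 from the outer sides of the rectangle. *)
have usM : cn us <= M.
  rewrite leNgt; apply/negP => /(HM us y0p) lt1.
  have := le_lt_trans (Im_le_cn _) lt1; rewrite ltr_norml => /andP[_ lt2].
  move: gu1; rewrite /g /v y0p mulrDr -/us; lra.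
have x0M : `|x0| <= M by apply: le_trans usM; exact: (Re_le_cn us).
have y0M : `|y0| <= M by apply: le_trans usM; exact: (Im_le_cn us).
have [K K0 [dl dl0 HK]] := exp3_mean (Hexp us y0p).
(* The mean estimate holds, the four points stay in the rectangle, and the last bound makes 4 del
   h^2, the gain from the quadratic term, exceed the error K h^3. *)
pose h := Num.min (Num.min (dl / 2) (y0 / 2)) (Num.min 1 (del / (K + 1))).
have K1 : 0 < K + 1 by lra.
have hd0 : 0 < del / (K + 1) by rewrite divr_gt0.
have h0 : 0 < h by rewrite !lt_min ltr01 hd0 !andbT; apply/andP; split; lra.
have hdl : h <= dl / 2 by rewrite !ge_min lexx.
have hy0 : h <= y0 / 2 by rewrite !ge_min lexx !orbT.
have h1 : h <= 1 by rewrite !ge_min lexx !orbT.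
have hK : h * (K + 1) <= del by rewrite -ler_pdivlMr // !ge_min lexx !orbT.
clearbody h.
have hlt : 0 < h < dl by rewrite h0 /=; lra.
have := HK h hlt; set S := _ - _ => Sle.
have ImSle : `|Im S| <= K * h ^+ 3 by apply: le_trans Sle; exact: Im_le_cn.
have ImS : Im S = v (x0 + h) y0 + v (x0 - h) y0 + v x0 (y0 + h) + v x0 (y0 - h) - 4 * v x0 y0.
  have yp : 0 < y0 + h by lra.
  have ym : 0 < y0 - h by lra.
  have Im4 (z : C) : Im (4%:R * z) = 4 * Im z.
    by rewrite -(rmorph_nat (real_complex R)) ImM /= mul0r addr0.
  rewrite /v y0p yp ym /S !ImD ImN Im4.
  have -> : us + h%:C = (x0 + h) +i* y0.
    by apply: complex_ext; rewrite ?ReD ?ImD /= ?addr0.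
  have -> : us - h%:C = (x0 - h) +i* y0.
    by apply: complex_ext; rewrite ?ReD ?ImD /= ?oppr0 ?addr0.
  have -> : us + h%:C * 'i = x0 +i* (y0 + h).
    by apply: complex_ext; rewrite ?ReD ?ImD ?ReM ?ImM /=; ring.
  have -> : us - h%:C * 'i = x0 +i* (y0 - h).
    by apply: complex_ext; rewrite ?ReD ?ImD ?ReN ?ImN ?ReM ?ImM /=; ring.
  by [].
clear HK Sle vcont gcont bx by0 gu1 sqb usM HM Hexp Hbd Hinf.
have gsum : g (x0 + h) y0 + g (x0 - h) y0 + g x0 (y0 + h) + g x0 (y0 - h) <= 4 * g x0 y0.
  move: x0M y0M; rewrite !ler_norml => /andP[? ?] /andP[? ?].
  have q1 : g (x0 + h) y0 <= g x0 y0 by apply: Hmax; apply/andP; split; lra.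
  have q2 : g (x0 - h) y0 <= g x0 y0 by apply: Hmax; apply/andP; split; lra.
  have q3 : g x0 (y0 + h) <= g x0 y0 by apply: Hmax; apply/andP; split; lra.
  have q4 : g x0 (y0 - h) <= g x0 y0 by apply: Hmax; apply/andP; split; lra.
  lra.
have gS : g (x0 + h) y0 + g (x0 - h) y0 + g x0 (y0 + h) + g x0 (y0 - h) - 4 * g x0 y0
   = Im S + 4 * del * h ^+ 2 by rewrite ImS /g; ring.
move: ImSle; rewrite ler_norml => /andP[lo _].
have key : 4 * del * h ^+ 2 <= K * h ^+ 3.
  by move: gsum gS lo; move: (Im S) => t; lra.
have h20 : 0 < h ^+ 2 by rewrite exprn_gt0.
have : 4 * del <= K * h by rewrite -(ler_pM2r h20) -[K * h * _]mulrA -exprS.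
move: hK; rewrite mulrDr mulr1 [K * h]mulrC; lra.
Qed.

(** The maximum principle for psi and for its opposite. *)
Lemma real_valued_principle (psi : C -> C) :
  (forall u, upper u -> exp3 psi u) ->
  (forall r eps : R, 0 < eps -> exists2 del : R, 0 < del &
     forall u, upper u -> cn (u - r%:C) < del -> `|Im (psi u)| < eps) ->
  (forall eps : R, 0 < eps -> exists M : R,
     forall u, upper u -> M < cn u -> cn (psi u) < eps) ->
  forall u, upper u -> Im (psi u) = 0.
Proof.
move=> H1 H2 H3 u uH; apply/le_anti; rewrite max_principle //= -oppr_le0 -ImN.
apply: (@max_principle (fun u => - psi u)) => //.
- move=> w wH; have [c0 [c1 [c2 [K [del [del0 H]]]]]] := H1 w wH.
  exists (- c0), (- c1), (- c2), K, del; split=> // h /H.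
  have -> : - psi (w + h) - (- c0 + - c1 * h + - c2 * h ^+ 2) =
    - (psi (w + h) - (c0 + c1 * h + c2 * h ^+ 2)) by ring.
  by rewrite cnN.
- move=> r eps /(H2 r)[del del0 H]; exists del => // w wH /(H w wH).
  by rewrite ImN normrN.
- move=> eps /H3[M H]; exists M => w wH /(H w wH); by rewrite cnN.
Qed.

End MaximumPrinciple.

(** * Hyperbolic forms and their cones *)

Section Evaluation.
Variables (R : nzRingType) (n : nat).

Definition pol := seq (R * ('I_n -> nat)).

Definition homog (d : nat) (f : pol) := all (fun m => \sum_i m.2 i == d)%N f.

(** The ring of values is free, so that one definition covers real and complex points, lines (values
    in polynomials) and two-variable families; [ev_morph] passes between them. *)
Definition ev (A : comNzRingType) (j : R -> A) (f : pol) (v : 'I_n -> A) : A :=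
  \sum_(m <- f) j m.1 * \prod_i v i ^+ m.2 i.

Definition line (A : comNzRingType) (x v : 'I_n -> A) (t : A) : 'I_n -> A :=
  fun i => x i + t * v i.

Lemma eq_ev (A : comNzRingType) (j : R -> A) f v v' :
  v =1 v' -> ev j f v = ev j f v'.
Proof.
by move=> e; apply: eq_bigr => m _; congr (_ * _); apply: eq_bigr => i _; rewrite e.
Qed.

Lemma ev_morph (A B : comNzRingType) (phi : {rmorphism A -> B}) (j : R -> A) f v :
  phi (ev j f v) = ev (phi \o j) f (phi \o v).
Proof.
rewrite /ev rmorph_sum; apply: eq_bigr => m _; rewrite rmorphM rmorph_prod.
by congr (_ * _); apply: eq_bigr => i _; rewrite rmorphXn.
Qed.

Lemma ev_scale (A : comNzRingType) (j : R -> A) d f (c : A) v : homog d f ->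
  ev j f (fun i => c * v i) = c ^+ d * ev j f v.
Proof.
move=> hf; rewrite /ev mulr_sumr.
elim: f hf => [|m f IH] /=; first by rewrite !big_nil.
case/andP=> /eqP dm /IH e; rewrite !big_cons e; congr (_ + _).
rewrite mulrCA -dm; congr (_ * _); rewrite -prodrXr -big_split /=.
by apply: eq_bigr => i _; rewrite exprMn.
Qed.

(** A bound instead of an exact degree: c may be 0, and the notion is multiplicative over every
    commutative ring. *)
Definition has_top (A : comNzRingType) (d : nat) (p : {poly A}) (c : A) :=
  (size p <= d.+1)%N /\ p`_d = c.

Lemma has_topM (A : comNzRingType) d d' (p p' : {poly A}) c c' :
  has_top d p c -> has_top d' p' c' -> has_top (d + d') (p * p') (c * c').
Proof.
move=> [s1 <-] [s2 <-]; split.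
  apply: (leq_trans (size_polyMleq _ _)); lia.
rewrite coefM (bigD1 (inord d)) //= inordK ?ltnS ?leq_addr // addKn big1 ?addr0 //.
move=> i; rewrite -val_eqE /= inordK ?ltnS ?leq_addr // => ne.
have [lt|ge] := ltnP i d.
  rewrite [p'`__]nth_default ?mulr0 // (leq_trans s2) //.
  rewrite ltn_subRL; lia.
rewrite [p`_i]nth_default ?mul0r // (leq_trans s1) //; lia.
Qed.

Lemma has_topX (A : comNzRingType) k (p : {poly A}) c :
  has_top 1 p c -> has_top k (p ^+ k) (c ^+ k).
Proof.
move=> h; elim: k => [|k IH]; last by rewrite !exprS -[k.+1]add1n; apply: has_topM.
by rewrite !expr0; split; rewrite ?size_poly1 // coef1.
Qed.

Lemma has_top_line (A : comNzRingType) (z v : A) : has_top 1 (z%:P + 'X * v%:P) v.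
Proof.
split; last by rewrite coefD coefC mulrC coefMX /= add0r coefC.
apply: (leq_trans (size_polyD _ _)); rewrite geq_max size_polyC.
case: eqP => _ /=; rewrite (leq_trans (size_polyMleq _ _)) // size_polyX size_polyC;
  by case: eqP.
Qed.

(** Degree d in t is reached only by taking v, not z, in each of the d linear factors of every
    monomial. *)
Lemma has_top_ev (A : comNzRingType) (j : R -> A) d f (z v : 'I_n -> A) : homog d f ->
  has_top d (ev (polyC \o j) f (line (polyC \o z) (polyC \o v) 'X)) (ev j f v).
Proof.
elim: f => [|m f IH] /=.
  by rewrite /ev !big_nil; split; rewrite ?size_poly0 ?coef0.
case/andP=> /eqP dm /IH[s1 e1]; rewrite /ev !big_cons.
have [s2 e2] : has_top d ((j m.1)%:P * \prod_i line (polyC \o z) (polyC \o v) 'X i ^+ m.2 i)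
    (j m.1 * \prod_i v i ^+ m.2 i).
  rewrite -[d]add0n; apply: has_topM.
    by split; rewrite ?coefC // (leq_trans (size_polyC_leq1 _)).
  rewrite -dm; elim/big_ind3: _ => [|p1 p2 p3 q1 q2 q3|i _].
  - by split; rewrite ?size_poly1 ?coef1.
  - exact: has_topM.
  - exact/has_topX/has_top_line.
split; first by rewrite (leq_trans (size_polyD _ _)) // geq_max s2 s1.
by rewrite coefD e2 e1.
Qed.

End Evaluation.

(** * Garding's theory of hyperbolicity cones *)

Section Hyperbolicity.
Variables (R : realType) (n : nat).
Local Notation C := R[i].
Local Notation vec := ('I_n -> R).
Implicit Types (f : pol R n) (x y e a : vec) (z v : 'I_n -> C).

Definition evR f x : R := ev id f x.
Definition evC f (z : 'I_n -> C) : C := ev (real_complex R) f z.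
Definition vC x : 'I_n -> C := fun i => (x i)%:C.

Lemma eq_evC f (z v : 'I_n -> C) : z =1 v -> evC f z = evC f v.
Proof. exact: eq_ev. Qed.

Lemma eq_evR f x y : x =1 y -> evR f x = evR f y.
Proof. exact: eq_ev. Qed.

Lemma evC_real f x : evC f (vC x) = (evR f x)%:C.
Proof. by rewrite /evR (ev_morph (real_complex R)). Qed.

Lemma evC_conj f (z : 'I_n -> C) : evC f (fun i => (z i)^*) = (evC f z)^*.
Proof.
rewrite /evC (ev_morph (@conjc R)) /ev; apply: eq_bigr => m _; congr (_ * _).
exact: (esym (conjc_real _)).
Qed.

Lemma line_real x y (t : R) : line (vC x) (vC y) t%:C =1 vC (line x y t).
Proof. by move=> i; rewrite /line /vC rmorphD rmorphM. Qed.

Lemma evC_line_real f x y (t : R) :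
  evC f (line (vC x) (vC y) t%:C) = (evR f (line x y t))%:C.
Proof. by rewrite (eq_evC _ (line_real x y t)) evC_real. Qed.

Lemma realC_eq0 (r : R) : (r%:C == 0 :> C) = (r == 0).
Proof. by rewrite eq_complex /= eqxx andbT. Qed.

Lemma evC_scale d f (c : C) (z : 'I_n -> C) : homog d f ->
  evC f (fun i => c * z i) = c ^+ d * evC f z.
Proof. exact: ev_scale. Qed.

Lemma evR_scale d f (c : R) x : homog d f ->
  evR f (fun i => c * x i) = c ^+ d * evR f x.
Proof. exact: ev_scale. Qed.

(* f(z0 + c z1 + s v), with c the outer variable and s the inner one. *)
Definition fam f z0 z1 v : {poly {poly C}} :=
  ev (fun r => (r%:C)%:P%:P) f
     (fun i => (z0 i)%:P%:P + 'X * (z1 i)%:P%:P + 'X%:P * (v i)%:P%:P).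

Lemma fam_horner f z0 z1 v (c : C) : (fam f z0 z1 v).[c%:P] =
  ev (polyC \o real_complex R) f (line (polyC \o line z0 z1 c) (polyC \o v) 'X).
Proof.
rewrite /fam -[_.[_]]/(horner_eval c%:P _) ev_morph /ev.
apply: eq_bigr => m _; rewrite /= horner_evalE hornerC; congr (_ * _).
apply: eq_bigr => i _; congr (_ ^+ _).
rewrite /= horner_evalE /line /= polyCD polyCM.
by rewrite !(hornerD, hornerM, hornerX, hornerC).
Qed.

Lemma fam_eval f z0 z1 v (c t : C) :
  (fam f z0 z1 v).[c%:P].[t] = evC f (line (line z0 z1 c) v t).
Proof.
rewrite fam_horner -[_.[_]]/(horner_eval t _) ev_morph /evC /ev.
apply: eq_bigr => m _; rewrite /= horner_evalE hornerC; congr (_ * _).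
apply: eq_bigr => i _; congr (_ ^+ _).
by rewrite /= horner_evalE /line /= !(hornerD, hornerM, hornerX, hornerC).
Qed.

Lemma fam_size d f z0 z1 v (c : C) : homog d f ->
  (size (fam f z0 z1 v).[c%:P] <= d.+1)%N.
Proof. by move=> hf; rewrite fam_horner; case: (has_top_ev (real_complex R) (line z0 z1 c) v hf). Qed.

Lemma fam_lead d f z0 z1 v (c : C) : homog d f ->
  (fam f z0 z1 v).[c%:P]`_d = evC f v.
Proof. by move=> hf; rewrite fam_horner; case: (has_top_ev (real_complex R) (line z0 z1 c) v hf). Qed.

Definition fibf f z0 z1 v (c : C) := fib (fam f z0 z1 v) c.

Lemma mem_fibf d f z0 z1 v (c t : C) : homog d f -> evC f v != 0 ->
  (t \in fibf f z0 z1 v c) = (evC f (line (line z0 z1 c) v t) == 0).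
Proof.
move=> hf v0; rewrite (mem_fib v0 (fun c => fam_size z0 z1 v c hf)) ?rootE ?fam_eval //.
by move=> c'; rewrite (fam_lead _ _ _ _ hf).
Qed.

Lemma fibf_close d f z0 z1 v (c0 : C) (eps : R) : homog d f -> evC f v != 0 -> 0 < eps ->
  exists2 del : R, 0 < del & forall c, cn (c - c0) < del ->
  exists2 s, perm_eq s (fibf f z0 z1 v c) & all2 (close eps) s (fibf f z0 z1 v c0).
Proof.
move=> hf v0 eps0; apply: (fib_close v0 (fun c => fam_size z0 z1 v c hf)) => // c.
by rewrite (fam_lead _ _ _ _ hf).
Qed.

Lemma count_fibf d f z0 z1 v (P : C -> C -> bool) (c0 c1 : C) :
  homog d f -> evC f v != 0 ->
  (forall t : R, 0 <= t <= 1 ->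
    forall z : C, evC f (line (line z0 z1 (c0 + t%:C * (c1 - c0))) v z) = 0 ->
    stable_at P (c0 + t%:C * (c1 - c0)) z) ->
  count (P c0) (fibf f z0 z1 v c0) = count (P c1) (fibf f z0 z1 v c1).
Proof.
move=> hf v0 st; apply: (count_fib_const v0 (fun c => fam_size z0 z1 v c hf)).
  by move=> c; rewrite (fam_lead _ _ _ _ hf).
move=> t t01 z; rewrite -/(fibf f z0 z1 v _) (mem_fibf _ _ _ _ hf v0) => /eqP; exact: st.
Qed.

Lemma stable_Im (c z : C) : Im z != 0 -> stable_at (fun _ z : C => 0 < Im z) c z.
Proof.
move=> Iz; exists `|Im z|; first by rewrite normr_gt0.
move=> _ z' _ zz'; have := le_lt_trans (Im_le_cn _) zz'.
rewrite ImD ImN ltr_norml => /andP[].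
have [I0|I0|I0] := ltgtP (Im z) 0; rewrite ?(ltr0_norm I0) ?(gtr0_norm I0).
- by move=> h1 h2; apply/negbTE; rewrite -leNgt; lra.
- by move=> h1 h2; lra.
- by rewrite I0 eqxx in Iz.
Qed.

Lemma stable_Re (c z : C) : Re z != 0 -> stable_at (fun _ z : C => 0 < Re z) c z.
Proof.
move=> Iz; exists `|Re z|; first by rewrite normr_gt0.
move=> _ z' _ zz'; have := le_lt_trans (Re_le_cn _) zz'.
rewrite ReD ReN ltr_norml => /andP[].
have [I0|I0|I0] := ltgtP (Re z) 0; rewrite ?(ltr0_norm I0) ?(gtr0_norm I0).
- by move=> h1 h2; apply/negbTE; rewrite -leNgt; lra.
- by move=> h1 h2; lra.
- by rewrite I0 eqxx in Iz.
Qed.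

Definition hyp f e := evR f e != 0 /\
  forall x (t : C), evC f (line (vC x) (vC e) t) = 0 -> Im t = 0.

Definition cone f e x := forall t : R, evR f (line x e t) = 0 -> t < 0.

Lemma line0 (A : comNzRingType) (x v : 'I_n -> A) : line x v 0 =1 x.
Proof. by move=> i; rewrite /line mul0r addr0. Qed.

Lemma cone_neq0 f e x : cone f e x -> evR f x != 0.
Proof.
move=> cx; apply/eqP => x0; have : 0 < 0 :> R.
  by apply: cx; rewrite (eq_evR _ (line0 _ _)).
by rewrite ltxx.
Qed.

Lemma cone_self d f e : homog d f -> hyp f e -> cone f e e.
Proof.
move=> hf [e0 _] t.
rewrite (@eq_evR _ _ (fun i => (1 + t) * e i)); last by move=> i; rewrite /line mulrDl mul1r.
rewrite (evR_scale _ _ hf) => /eqP; rewrite mulf_eq0 (negPf e0) orbF expf_eq0.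
by case/andP=> _ /eqP; lra.
Qed.

Lemma evC_swap d f (z v : 'I_n -> C) (t : C) : homog d f -> t != 0 ->
  evC f (line z v t) = 0 -> evC f (line v z t^-1) = 0.
Proof.
move=> hf t0 E; have : t ^+ d * evC f (line v z t^-1) = 0.
  rewrite -(evC_scale _ _ hf) -E; apply: eq_evC => i.
  by rewrite /line mulrDr mulrA divff // mul1r addrC.
by move/eqP; rewrite mulf_eq0 expf_eq0 (negPf t0) andbF /= => /eqP.
Qed.

Lemma cone_root d f e x (t : C) : homog d f -> hyp f e -> cone f e x ->
  evC f (line (vC x) (vC e) t) = 0 -> exists2 r : R, t = r%:C & r < 0.
Proof.
move=> hf [_ he] cx E; have tr := Im_eq0_real (he _ _ E).
exists (Re t) => //; apply: cx; apply: (@complexI R).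
by rewrite rmorph0 -E {2}tr evC_line_real.
Qed.

(** For alpha > 0 a root t of f(i alpha e + b x + t a) is never real, since i alpha would then be a
    non-real root along e. So the number of roots in the upper half plane is the same at b = 1 as at
    b = 0, where a in the cone makes it 0. Afterwards alpha tends to 0. *)
Lemma cone_hyp d f e a : homog d f -> hyp f e -> cone f e a -> hyp f a.
Proof.
move=> hf he ca; have a0 := cone_neq0 ca; split=> // x.
have vCa : evC f (vC a) != 0 by rewrite evC_real realC_eq0.
have step (al : R) (t : C) : 0 < al ->
    evC f (line (line (fun i => (al *i) * (e i)%:C) (vC x) 1) (vC a) t) = 0 -> 0 < Im t -> False.
  move=> al0 E tp; pose z0 : 'I_n -> C := fun i => (al *i) * (e i)%:C.
  have swp b w : line (line z0 (vC x) b) (vC a) w =1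
                 line (line (fun i => b * (x i)%:C) (vC a) w) (vC e) (al *i).
    by move=> i; rewrite /line /z0 /vC; ring.
  have cnt : count (fun z : C => 0 < Im z) (fibf f z0 (vC x) (vC a) 0) =
             count (fun z : C => 0 < Im z) (fibf f z0 (vC x) (vC a) 1).
    apply: (@count_fibf d f z0 (vC x) (vC a) (fun _ z : C => 0 < Im z)) => // b b01 z Ez.
    apply: stable_Im; apply/negP => /eqP /Im_eq0_real zr.
    move: Ez; rewrite add0r subr0 mulr1 zr (eq_evC _ (swp _ _)) => Ez.
    have [_ he'] := he.
    have I0 : Im (al *i) = 0.
      apply: (he' (line (fun i => b * x i) a (Re z))); rewrite -Ez; apply: eq_evC => i.
      by rewrite /line /vC !rmorphD !rmorphM.
    by move: al0; rewrite -[al]/(Im (al *i)) I0 ltxx.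
  (* At b = 0 a root w makes i alpha / w a negative real, so w lies in the lower half plane. *)
  have c0 : count (fun z : C => 0 < Im z) (fibf f z0 (vC x) (vC a) 0) = 0%N.
    apply/eqP; rewrite -leqn0 leqNgt -has_count; apply/hasP => -[w].
    rewrite (mem_fibf _ _ _ _ hf vCa) => /eqP Ew wp.
    have w0 : w != 0 by apply: contraTN wp => /eqP->; rewrite /= ltxx.
    have E2 : evC f (line (vC a) (vC e) ((al *i) / w)) = 0.
      have := evC_swap hf w0 Ew => <-; apply: eq_evC => i.
      by rewrite /line /z0 /vC mul0r addr0; ring.
    have [r Er r0] := cone_root hf he ca E2.
    have rw : al *i = r%:C * w by rewrite -Er divfK.
    move: (congr1 (@complex.Im R) rw); rewrite ImM /= mul0r addr0 => alr.
    by move: al0; rewrite alr pmulr_lgt0 // ltNge (ltW r0).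
  have : has (fun z : C => 0 < Im z) (fibf f z0 (vC x) (vC a) 1).
    by apply/hasP; exists t => //; rewrite (mem_fibf _ _ _ _ hf vCa) E eqxx.
  by rewrite has_count -cnt c0.
(* A root in the open upper half plane at alpha = 0 would persist for the small value alpha =
   [del / 2]. *)
have up (t : C) : evC f (line (vC x) (vC a) t) = 0 -> 0 < Im t -> False.
  move=> E tp; pose z1 : 'I_n -> C := fun i => 'i * (e i)%:C.
  have [del del0 H] := @fibf_close d f (vC x) z1 (vC a) 0 (Im t) hf vCa tp.
  have ltd : cn ((del / 2)%:C - 0) < del.
    by rewrite subr0 cn_real gtr0_norm ?divr_gt0 //; lra.
  have [s ps al] := H _ ltd.
  have tin : t \in fibf f (vC x) z1 (vC a) 0.
    rewrite (mem_fibf _ _ _ _ hf vCa); apply/eqP; rewrite -[RHS]E; apply: eq_evC => i.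
    by rewrite /line mul0r addr0.
  have [w ws wt] : exists2 w, w \in s & cn (w - t) < Im t.
    elim: s (fibf f (vC x) z1 (vC a) 0) al tin {ps} => [|w s IH] [|w' r] //= /andP[h1 h2].
    rewrite in_cons => /predU1P[tw|tr].
      by exists w; [exact: mem_head | move: h1; rewrite -tw].
    by have [w0 ws0 h] := IH _ h2 tr; exists w0 => //; rewrite in_cons ws0 orbT.
  have wp : 0 < Im w.
    have := le_lt_trans (Im_le_cn _) wt; rewrite ImD ImN ltr_norml => /andP[]; lra.
  move: ws; rewrite (perm_mem ps) (mem_fibf _ _ _ _ hf vCa) => /eqP Ew.
  have d20 : 0 < del / 2 by lra.
  apply: (step (del / 2) w d20 _ wp); rewrite -Ew; apply: eq_evC => i.
  rewrite /line /z1 mul1r addrC [in RHS]addrC; congr (_ + _).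
  rewrite addrC; congr (_ + _); rewrite mulrA; congr (_ * _).
  by apply: complex_ext; rewrite ?ReM ?ImM /=; ring.
move=> t E; apply/eqP; rewrite eq_le !leNgt; apply/andP; split; apply/negP => h.
  exact: (up t).
(* Roots along real lines come in conjugate pairs. *)
apply: (up t^*); last by case: (t) h => r s /=; lra.
have -> : evC f (line (vC x) (vC a) t^*) = (evC f (line (vC x) (vC a) t))^*.
  rewrite -evC_conj; apply: eq_evC => i; rewrite /line /vC.
  by rewrite rmorphD rmorphM; congr (_ + _ * _); exact: (esym (conjc_real _)).
by rewrite E rmorph0.
Qed.

(** The path e + b w from e to y + t e avoids the zeros of f, so no root s of f(e + b w + s x), all
    of them real by [cone_hyp], crosses 0. At b = 0 none is positive, hence s = 1 is no root at b =
    1. Convexity and independence of the base direction both follow from this. *)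
Lemma cone_add d f e x y (t : R) : homog d f -> hyp f e -> cone f e x -> cone f e y ->
  0 <= t -> evR f (fun i => x i + y i + t * e i) != 0.
Proof.
move=> hf he cx cy t0; have [x0 hx] := cone_hyp hf he cx.
have vCx : evC f (vC x) != 0 by rewrite evC_real realC_eq0.
pose w : vec := fun i => y i + t * e i - e i.
have fw (b : R) : 0 <= b <= 1 -> evR f (line e w b) != 0.
  case/andP=> b0 b1; have [b00|bn0] := eqVneq b 0.
    by rewrite b00 (eq_evR _ (line0 e w)); case: he.
  have bp : 0 < b by rewrite lt_def bn0.
  (* For b > 0 the point is b times the sum of y and a non-negative multiple of e. *)
  rewrite (@eq_evR _ _ (fun i => b * (line y e ((1 - b) / b + t) i))); last first.
    by move=> i; rewrite /line /w; field.
  rewrite (evR_scale _ _ hf) mulf_neq0 ?expf_neq0 //; apply/eqP => /cy.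
  by rewrite ltNge addr_ge0 // divr_ge0 // subr_ge0.
have cnt : count (fun z : C => 0 < Re z) (fibf f (vC e) (vC w) (vC x) 0) =
           count (fun z : C => 0 < Re z) (fibf f (vC e) (vC w) (vC x) 1).
  apply: (@count_fibf d f (vC e) (vC w) (vC x) (fun _ z : C => 0 < Re z)) => // b b01 z Ez.
  apply: stable_Re; apply/eqP => rz.
  move: Ez; rewrite add0r subr0 mulr1 => Ez.
  have Ez' : evC f (line (vC (line e w b)) (vC x) z) = 0.
    rewrite -Ez; apply: eq_evC => i; rewrite /line; congr (_ + _).
    by rewrite /vC rmorphD rmorphM.
  have z0 : z = 0 by apply: complex_ext; rewrite // (hx _ _ Ez').
  move: Ez'; rewrite z0 (eq_evC _ (line0 _ _)) evC_real => /eqP.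
  by rewrite realC_eq0 (negPf (fw b b01)).
have c0 : count (fun z : C => 0 < Re z) (fibf f (vC e) (vC w) (vC x) 0) = 0%N.
  apply/eqP; rewrite -leqn0 leqNgt -has_count; apply/hasP => -[s].
  rewrite (mem_fibf _ _ _ _ hf vCx) => /eqP Es sp.
  have s0 : s != 0 by apply: contraTN sp => /eqP->; rewrite /= ltxx.
  have E2 : evC f (line (vC x) (vC e) s^-1) = 0.
    rewrite -(evC_swap hf s0 Es); apply: eq_evC => i.
    by rewrite /line mul0r addr0.
  have [r Er r0] := cone_root hf he cx E2.
  have sE : s = (r^-1)%:C by rewrite -[LHS]invrK Er rmorphV //= unitfE lt_eqF.
  by move: sp; rewrite sE /= invr_gt0 ltNge (ltW r0).
apply/negP => /eqP E.
have : has (fun z : C => 0 < Re z) (fibf f (vC e) (vC w) (vC x) 1).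
  apply/hasP; exists 1; last by rewrite /= ltr01.
  rewrite (mem_fibf _ _ _ _ hf vCx); apply/eqP.
  have EC : evC f (vC (fun i => x i + y i + t * e i)) = 0 by rewrite evC_real E rmorph0.
  rewrite -[RHS]EC; apply: eq_evC => i.
  rewrite /line /vC /w !mul1r -!rmorphD; congr (_%:C); ring.
by rewrite has_count -cnt c0.
Qed.

Lemma cone_sym d f e e' : homog d f -> hyp f e -> cone f e e' -> cone f e' e.
Proof.
move=> hf he ce' t E.
have t0 : t != 0.
  by apply/eqP => t0; move: E; rewrite t0 (eq_evR _ (line0 _ _)) => /eqP; case: he => /negPf->.
have tC0 : t%:C != 0 :> C by rewrite realC_eq0.
have E2 : evC f (line (vC e) (vC e') t%:C) = 0 by rewrite evC_line_real E rmorph0.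
have [r Er r0] := cone_root hf he ce' (evC_swap hf tC0 E2).
have tr : t^-1 = r by apply: (@complexI R); rewrite -Er fmorphV.
by rewrite -invr_lt0 tr.
Qed.

(** For t > 0 the point x + t e' is a sum of two points of the cone, where [cone_add] excludes
    zeros. *)
Lemma cone_sub d f e e' x : homog d f -> hyp f e -> cone f e e' -> cone f e x -> cone f e' x.
Proof.
move=> hf he ce' cx t E; rewrite ltNge; apply/negP => t0; move/eqP: E; apply/negP.
have [->|tn0] := eqVneq t 0; first by rewrite (eq_evR _ (line0 _ _)) (cone_neq0 cx).
have tp : 0 < t by rewrite lt_def tn0.
have cte : cone f e (fun i => t * e' i).
  move=> s E; have : t ^+ d * evR f (line e' e (s / t)) = 0.
    rewrite -(evR_scale _ _ hf) -E; apply: eq_evR => i; rewrite /line; field.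
    by rewrite tn0.
  move/eqP; rewrite mulf_eq0 expf_eq0 (negPf tn0) andbF /= => /eqP /ce'.
  by rewrite pmulr_llt0 ?invr_gt0.
have := cone_add hf he cx cte (lexx 0).
by rewrite (@eq_evR _ _ (line x e' t)) // => i; rewrite /line mul0r addr0.
Qed.

Lemma cone_eq d f e e' : homog d f -> hyp f e -> cone f e e' ->
  forall x, cone f e x <-> cone f e' x.
Proof.
move=> hf he ce' x; split; first exact: (cone_sub hf he).
by apply: (cone_sub hf (cone_hyp hf he ce')); exact: (cone_sym hf).
Qed.

Lemma cone_segment d f e x y (s : R) : homog d f -> hyp f e -> cone f e x -> cone f e y ->
  0 <= s <= 1 -> cone f e (fun i => (1 - s) * x i + s * y i).
Proof.
move=> hf he cx cy /andP[s0 s1] t E.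
have [s00|sn0] := eqVneq s 0.
  apply: cx; rewrite -E; apply: eq_evR => i; rewrite /line s00; ring.
have [s11|sn1] := eqVneq s 1.
  apply: cy; rewrite -E; apply: eq_evR => i; rewrite /line s11; ring.
have sp : 0 < s by rewrite lt_def sn0.
have sp1 : 0 < 1 - s by rewrite subr_gt0 lt_neqAle sn1.
have scl (r : R) (z : vec) : 0 < r -> cone f e z -> cone f e (fun i => r * z i).
  move=> r0 cz u Eu; have rn0 : r != 0 by rewrite gt_eqF.
  have : r ^+ d * evR f (line z e (u / r)) = 0.
    rewrite -(evR_scale _ _ hf) -Eu; apply: eq_evR => i; rewrite /line; field.
    by rewrite rn0.
  move/eqP; rewrite mulf_eq0 expf_eq0 (negPf rn0) andbF /= => /eqP /cz.
  by rewrite pmulr_llt0 ?invr_gt0.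
rewrite ltNge; apply/negP => t0; move/eqP: E; apply/negP.
exact: (cone_add hf he (scl _ _ sp1 cx) (scl _ _ sp cy) t0).
Qed.

Lemma evR_opp d f x : homog d f -> evR f (fun i => - x i) = (-1) ^+ d * evR f x.
Proof. by move=> hf; rewrite -(evR_scale _ _ hf); apply: eq_evR => i; rewrite mulN1r. Qed.

Lemma hyp_opp d f e : homog d f -> hyp f e -> hyp f (fun i => - e i).
Proof.
move=> hf [e0 he]; split; first by rewrite (evR_opp _ hf) mulf_neq0 // signr_eq0.
move=> x t E; have : Im (- t) = 0.
  apply: (he x); rewrite -E; apply: eq_evC => i.
  by rewrite /line /vC rmorphN mulNr mulrN.
by rewrite ImN => /eqP; rewrite oppr_eq0 => /eqP.
Qed.

Lemma cone_opp d f e x : homog d f -> cone f e x <-> cone f (fun i => - e i) (fun i => - x i).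
Proof.
move=> hf.
have E t : evR f (line (fun i => - x i) (fun i => - e i) t) = (-1) ^+ d * evR f (line x e t).
  by rewrite -(evR_opp _ hf); apply: eq_evR => i; rewrite /line; ring.
split=> h t; first by rewrite E => /eqP; rewrite mulf_eq0 signr_eq0 => /eqP /h.
by move=> E0; apply: h; rewrite E E0 mulr0.
Qed.

(* The imaginary projection is the complement of the set of hyperbolic directions. *)
Lemma hypP d f y : homog d f ->
  hyp f y <-> forall x, evC f (line (vC x) (vC y) 'i) != 0.
Proof.
move=> hf; split=> [[y0 hy] x|H].
  by apply/eqP => /hy /eqP; rewrite oner_eq0.
split.
  have := H (fun=> 0); apply: contraNN => /eqP y0.
  have -> : evC f (line (vC (fun=> 0)) (vC y) 'i) = 'i ^+ d * evC f (vC y).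
    by rewrite -(evC_scale _ _ hf); apply: eq_evC => i; rewrite /line /vC rmorph0 add0r.
  by rewrite evC_real y0 rmorph0 mulr0.
move=> x t E; apply/eqP; apply/negP => /negP It.
have ItC : (Im t)%:C != 0 :> C by rewrite realC_eq0.
(* By homogeneity f(x + t y) is (Im t)^d times the value of f at this point plus i y. *)
have /eqP := H (fun i => (Im t)^-1 * (x i + Re t * y i)); apply.
have : (Im t)%:C ^+ d * evC f (line (vC (fun i => (Im t)^-1 * (x i + Re t * y i))) (vC y) 'i) = 0.
  rewrite -(evC_scale _ _ hf) -E; apply: eq_evC => i; rewrite /line /vC.
  by apply: complex_ext; rewrite ?(ReD, ImD, ReM, ImM) /=; field.
by move/eqP; rewrite mulf_eq0 expf_eq0 (negPf ItC) andbF /= => /eqP.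
Qed.

End Hyperbolicity.

(** * Liouville argument and Hensel lifting *)

Section Liouville.
Variable R : realType.
Local Notation C := R[i].
Implicit Types (phi psi : C -> C) (u h : C).

Lemma exp3_cst (c : C) u : exp3 (fun=> c) u.
Proof.
exists c, 0, 0, 0, 1; split=> // h _.
by rewrite !mul0r !addr0 subrr cn0.
Qed.

Lemma exp3_id u : exp3 id u.
Proof.
exists u, 1, 0, 0, 1; split=> // h _.
by rewrite mul1r !mul0r !addr0 subrr cn0.
Qed.

Lemma exp3_add phi psi u : exp3 phi u -> exp3 psi u -> exp3 (fun u => phi u + psi u) u.
Proof.
move=> [c0 [c1 [c2 [K [d [d0 H]]]]]] [c0' [c1' [c2' [K' [d' [d'0 H']]]]]].
exists (c0 + c0'), (c1 + c1'), (c2 + c2'), (K + K'), (Num.min d d'); split.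
  by rewrite lt_min d0.
move=> h; rewrite lt_min => /andP[/H le1 /H' le2].
rewrite [_ * cn h ^+ 3]mulrDl; apply: le_trans (lerD le1 le2); apply: le_trans (cnD _ _).
rewrite le_eqVlt; apply/orP; left; apply/eqP; congr cn; ring.
Qed.

Lemma exp3_mul phi psi u : exp3 phi u -> exp3 psi u -> exp3 (fun u => phi u * psi u) u.
Proof.
move=> [c0 [c1 [c2 [K [d [d0 H]]]]]] [e0 [e1 [e2 [K' [d' [d'0 H']]]]]].
pose M := cn c0 + cn c1 + cn c2; pose M' := cn e0 + cn e1 + cn e2 + `|K'|.
exists (c0 * e0), (c0 * e1 + c1 * e0), (c0 * e2 + c1 * e1 + c2 * e0).
exists (`|K| * M' + M * `|K'| + (cn (c1 * e2 + c2 * e1) + cn (c2 * e2))).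
exists (Num.min (Num.min d d') 1); split; first by rewrite !lt_min d0 d'0 ltr01.
move=> h; rewrite !lt_min => /andP[/andP[/H le1 /H' le2] h1].
have hn0 := cn_ge0 h; have h3 : 0 <= cn h ^+ 3 by rewrite exprn_ge0.
set p := c0 + c1 * h + c2 * h ^+ 2 in le1; set q := e0 + e1 * h + e2 * h ^+ 2 in le2.
have {}le1 : cn (phi (u + h) - p) <= `|K| * cn h ^+ 3.
  by rewrite (le_trans le1) // ler_wpM2r // ler_norm.
have {}le2 : cn (psi (u + h) - q) <= `|K'| * cn h ^+ 3.
  by rewrite (le_trans le2) // ler_wpM2r // ler_norm.
have quad (x0 x1 x2 : C) : cn (x0 + x1 * h + x2 * h ^+ 2) <= cn x0 + cn x1 + cn x2.
  apply: (le_trans (cnD _ _)); apply: lerD; last first.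
    by rewrite cnM ler_piMr ?cn_ge0 // cnX exprn_ile1 // ltW.
  by apply: (le_trans (cnD _ _)); rewrite lerD2l cnM ler_piMr ?cn_ge0 // ltW.
have lepsi : cn (psi (u + h)) <= M'.
  rewrite -(subrK q (psi (u + h))) (le_trans (cnD _ _)) // addrC lerD ?quad //.
  by rewrite (le_trans le2) // ler_piMr // exprn_ile1 // ltW.
have lep : cn p <= M by exact: quad.
have -> : phi (u + h) * psi (u + h) - (c0 * e0 + (c0 * e1 + c1 * e0) * h +
    (c0 * e2 + c1 * e1 + c2 * e0) * h ^+ 2) =
  (phi (u + h) - p) * psi (u + h) + p * (psi (u + h) - q)
   + h ^+ 3 * ((c1 * e2 + c2 * e1) + (c2 * e2) * h) by rewrite /p /q; ring.
rewrite [_ * cn h ^+ 3]mulrDl; apply: (le_trans (cnD _ _)); apply: lerD.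
  apply: (le_trans (cnD _ _)); rewrite [_ * cn h ^+ 3]mulrDl; apply: lerD.
    by rewrite cnM mulrAC ler_pM ?cn_ge0.
  by rewrite cnM -mulrA ler_pM ?cn_ge0.
rewrite cnM cnX mulrC ler_wpM2r // (le_trans (cnD _ _)) // lerD2l.
by rewrite cnM ler_piMr ?cn_ge0 // ltW.
Qed.

Lemma exp3_exp phi u k : exp3 phi u -> exp3 (fun u => phi u ^+ k) u.
Proof.
move=> H; elim: k => [|k IH]; first exact: exp3_cst.
have -> : (fun u => phi u ^+ k.+1) = (fun u => phi u * phi u ^+ k).
  by apply: funext => v; rewrite exprS.
exact: exp3_mul.
Qed.

Lemma exp3_inv u : u != 0 -> exp3 (fun u => u^-1) u.
Proof.
(* The remainder is exactly - h^3 / (u^3 (u + h)), and |u + h| > |u| / 2 yields the constant. *)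
move=> u0; exists u^-1, (- u ^- 2), (u ^- 3), (2 / cn u ^+ 4), (cn u / 2).
have nu0 : 0 < cn u by rewrite cn_gt0.
split; first by rewrite divr_gt0.
move=> h hlt; have luh : cn u / 2 < cn (u + h).
  have := cnB (u + h) h; rewrite addrK; lra.
have uh0 : u + h != 0 by rewrite -cn_gt0; apply: lt_trans luh; rewrite divr_gt0.
have -> : (u + h)^-1 - (u^-1 + - u ^- 2 * h + u ^- 3 * h ^+ 2) =
   - (h ^+ 3 / (u ^+ 3 * (u + h))) by field; rewrite u0 uh0.
rewrite cnN cnM cnX cnV cnM cnX [_ * cn h ^+ 3]mulrC ler_wpM2l ?exprn_ge0 ?cn_ge0 //.
have c3 : 0 < cn u ^+ 3 by rewrite exprn_gt0.
have -> : 2 / cn u ^+ 4 = (cn u ^+ 3 * (cn u / 2))^-1 by field; rewrite gt_eqF.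
have u20 : 0 < cn u / 2 by rewrite divr_gt0.
have p1 : 0 < cn u ^+ 3 * (cn u / 2) by exact: mulr_gt0.
have p2 : 0 < cn u ^+ 3 * cn (u + h) by apply: mulr_gt0 => //; exact: lt_trans luh.
rewrite lef_pV2 ?posrE //.
by rewrite ler_wpM2l ?exprn_ge0 ?cn_ge0 // ltW.
Qed.

Lemma exp3_sum (I : Type) (r : seq I) (F : I -> C -> C) u :
  (forall i, exp3 (F i) u) -> exp3 (fun u => \sum_(i <- r) F i u) u.
Proof.
move=> H; elim: r => [|i r IH].
  have -> : (fun u => \sum_(i <- [::]) F i u) = (fun=> 0).
    by apply: funext => v; rewrite big_nil.
  exact: exp3_cst.
have -> : (fun u => \sum_(j <- i :: r) F j u) = (fun u => F i u + \sum_(j <- r) F j u).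
  by apply: funext => v; rewrite big_cons.
exact: exp3_add.
Qed.

Lemma norm_lt_thirds (x y z e : R) :
  `|x| < e / 3 -> `|y| < e / 3 -> `|z| < e / 3 -> `|x + y - z| < e.
Proof.
rewrite !ltr_norml => /andP[? ?] /andP[? ?] /andP[? ?]; apply/andP; split; lra.
Qed.

Lemma upper_neq0 u : upper u -> u != 0.
Proof. by apply: contraTneq => ->; rewrite /upper /= ltxx. Qed.

Variables (phi : C -> C) (gam : nat -> R) (a : nat).

Definition jetsum N u : C := \sum_(k < N) (gam k)%:C * u ^+ k.

Hypothesis phi_exp3 : forall u, upper u -> exp3 phi u.
(** Weaker than continuity up to the boundary: near r the values are close to bounded reals that may
    jump with u. This is the form in which [fil_boundary] supplies it. *)
Hypothesis phi_bd : forall r : R, exists B : R, forall eps : R, 0 < eps ->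
  exists2 del : R, 0 < del & forall u, upper u -> cn (u - r%:C) < del ->
  exists rho : R, cn (phi u - rho%:C) < eps /\ `|rho| <= B.
Hypothesis phi_jet : forall N, exists K del : R, 0 < del /\ forall u, upper u ->
  cn u < del -> cn (phi u - jetsum N.+1 u) <= K * cn u ^+ N.+1.
Hypothesis phi_inf : exists B : R, forall u, upper u -> 1 <= cn u ->
  cn (phi u) <= B * cn u ^+ a.

(** Removing the jet and dividing by u^N gives a function that is nearly real near 0, by the next
    jet, and that decays at infinity once N > a. *)
Let psi N u : C := (phi u - jetsum N u) * (u^-1) ^+ N.

Let jetsumS N u : jetsum N.+1 u = jetsum N u + (gam N)%:C * u ^+ N.
Proof. by rewrite /jetsum big_ord_recr. Qed.

Let psi_exp3 N u : upper u -> exp3 (psi N) u.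
Proof.
move=> uH; apply: exp3_mul; last exact/exp3_exp/exp3_inv/upper_neq0.
apply: exp3_add; first exact: phi_exp3.
have -> : (fun u => - jetsum N u) = (fun u => \sum_(k < N) (- (gam k)%:C) * u ^+ k).
  by apply: funext => v; rewrite /jetsum -sumrN; apply: eq_bigr => k _; rewrite mulNr.
apply: exp3_sum => k; apply: exp3_mul; first exact: exp3_cst.
by apply: exp3_exp; exact: exp3_id.
Qed.

Let realC (r : R) : Im r%:C = 0. Proof. by []. Qed.

Let psi_bd N (r eps : R) : 0 < eps -> exists2 del : R, 0 < del &
  forall u, upper u -> cn (u - r%:C) < del -> `|Im (psi N u)| < eps.
Proof.
move=> eps0; have [->|r0] := eqVneq r 0.
  (* Near 0 the function psi is the real number [gam N] plus an error of order |u|. *)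
  have [K [del [del0 H]]] := phi_jet N.
  have K1 : 0 < `|K| + 1 by rewrite ltr_wpDl.
  exists (Num.min del (eps / (`|K| + 1))); first by rewrite lt_min del0 divr_gt0.
  move=> u uH; rewrite rmorph0 subr0 lt_min => /andP[/(H u uH) le1 lt1].
  have u0 := upper_neq0 uH; have nu0 : 0 < cn u by rewrite cn_gt0.
  have -> : psi N u = (phi u - jetsum N.+1 u) * u^-1 ^+ N + (gam N)%:C.
    have E : (gam N)%:C * u ^+ N * u^-1 ^+ N = (gam N)%:C.
      by rewrite -mulrA -exprMn divff // expr1n mulr1.
    by rewrite /psi jetsumS opprD addrA [in RHS]mulrBl E subrK.
  rewrite ImD realC addr0; apply: (le_lt_trans (Im_le_cn _)).
  rewrite cnM cnX cnV; apply: (@le_lt_trans _ _ (`|K| * cn u)).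
    apply: (@le_trans _ _ (K * cn u ^+ N.+1 * (cn u)^-1 ^+ N)).
      by rewrite ler_wpM2r // exprn_ge0 // invr_ge0 ltW.
    rewrite exprS -!mulrA -exprMn divff ?gt_eqF // expr1n mulr1.
    by rewrite ler_wpM2r ?(ltW nu0) // ler_norm.
  rewrite ltr_pdivlMr // in lt1; apply: le_lt_trans lt1.
  by rewrite mulrC ler_wpM2l ?(ltW nu0) // lerDl.
have rC0 : r%:C != 0 :> C by rewrite eq_complex /= eqxx andbT.
pose chi u : C := (u^-1) ^+ N; pose kap u : C := jetsum N u * chi u.
have chi_e : exp3 chi r%:C by exact/exp3_exp/exp3_inv.
have kap_e : exp3 kap r%:C.
  apply: exp3_mul => //; apply: exp3_sum => k; apply: exp3_mul; first exact: exp3_cst.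
  by apply: exp3_exp; exact: exp3_id.
have chi_r : Im (chi r%:C) = 0 by rewrite /chi -fmorphV -rmorphXn.
have kap_r : Im (kap r%:C) = 0.
  rewrite /kap /jetsum ImM chi_r mulr0 add0r.
  have -> : \sum_(k < N) (gam k)%:C * r%:C ^+ k = (\sum_(k < N) gam k * r ^+ k)%:C.
    by rewrite rmorph_sum; apply: eq_bigr => k _; rewrite rmorphM rmorphXn.
  by rewrite mul0r.
have [B HB] := phi_bd r.
pose X := cn (chi r%:C) + 1.
have X0 : 0 < X by rewrite ltr_wpDl ?cn_ge0.
have B10 : 0 < `|B| + 1 by rewrite ltr_wpDl.
have e1 : 0 < eps / 3 / X by rewrite !divr_gt0.
have e2 : 0 < Num.min 1 (eps / 3 / (`|B| + 1)) by rewrite lt_min ltr01 !divr_gt0.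
have e3 : 0 < eps / 3 by rewrite divr_gt0.
have [d1 d10 H1] := HB _ e1.
have [d2 d20 H2] := exp3_cont chi_e e2.
have [d3 d30 H3] := exp3_cont kap_e e3.
exists (Num.min d1 (Num.min d2 d3)); first by rewrite !lt_min d10 d20 d30.
move=> u uH; rewrite !lt_min => /andP[/(H1 u uH)[rho [lt1 rB]] /andP[/H2 lt2 /H3 lt3]].
move: lt2; rewrite lt_min => /andP[lt2 lt2'].
(* The first term is small because phi is near rho, the other two because chi and kap are continuous
   at r; the rest of psi is real. *)
have -> : Im (psi N u) = Im ((phi u - rho%:C) * chi u) +
    Im (rho%:C * (chi u - chi r%:C)) - Im (kap u - kap r%:C).
  have -> : psi N u = (phi u - rho%:C) * chi u + rho%:C * (chi u - chi r%:C)
     + rho%:C * chi r%:C - (kap u - kap r%:C) - kap r%:C.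
    by rewrite /psi /kap /chi; ring.
  rewrite ImD ImN kap_r oppr0 addr0 ImD ImN ImD ImD.
  by rewrite [Im (rho%:C * chi r%:C)]ImM chi_r /= mulr0 mul0r !addr0.
have n1 : `|Im ((phi u - rho%:C) * chi u)| < eps / 3.
  apply: (le_lt_trans (Im_le_cn _)); rewrite cnM.
  have chiX : cn (chi u) <= X.
    rewrite -(subrK (chi r%:C) (chi u)) (le_trans (cnD _ _)) // addrC lerD2l.
    exact: ltW.
  apply: (@le_lt_trans _ _ (cn (phi u - rho%:C) * X)); first by rewrite ler_wpM2l ?cn_ge0.
  by rewrite -ltr_pdivlMr.
have n2 : `|Im (rho%:C * (chi u - chi r%:C))| < eps / 3.
  apply: (le_lt_trans (Im_le_cn _)); rewrite cnM cn_real.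
  apply: (@le_lt_trans _ _ ((`|B| + 1) * cn (chi u - chi r%:C))).
    rewrite ler_wpM2r ?cn_ge0 // (le_trans rB) // (le_trans (ler_norm _)) //.
    by rewrite lerDl.
  by rewrite mulrC -ltr_pdivlMr.
have n3 : `|Im (kap u - kap r%:C)| < eps / 3.
  by apply: le_lt_trans lt3; exact: Im_le_cn.
exact: norm_lt_thirds n1 n2 n3.
Qed.

Let psi_decay N : (a < N)%N -> exists B : R, forall u, upper u -> 1 <= cn u ->
  cn (psi N u) <= B / cn u.
Proof.
move=> aN; have [B HB] := phi_inf.
exists (`|B| + \sum_(k < N) `|gam k|) => u uH u1.
have nu0 : 0 < cn u by rewrite (lt_le_trans ltr01).
have leX k : (k < N)%N -> cn u ^+ k <= cn u ^+ N / cn u.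
  move=> kN; rewrite ler_pdivlMr // -exprSr ler_weXn2l //.
rewrite /psi cnM cnX cnV exprVn ler_pdivrMr ?exprn_gt0 // mulrAC -mulrA mulrDl.
apply: (le_trans (cnB _ _)); apply: lerD.
  apply: (le_trans (HB u uH u1)); apply: (@le_trans _ _ (`|B| * cn u ^+ a)).
    by rewrite ler_wpM2r ?exprn_ge0 ?(ltW nu0) ?ler_norm.
  by rewrite ler_wpM2l // leX.
rewrite mulr_suml; apply: (le_trans (cn_sum _ _ _)); apply: ler_sum => k _.
by rewrite cnM cn_real cnX ler_wpM2l // leX.
Qed.

Let psi_inf N : (a < N)%N -> forall eps : R, 0 < eps -> exists M : R,
  forall u, upper u -> M < cn u -> cn (psi N u) < eps.
Proof.
move=> aN eps eps0; have [B HB] := psi_decay aN.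
exists (Num.max 1 (B / eps)) => u uH; rewrite gt_max => /andP[u1 lt].
apply: (le_lt_trans (HB u uH (ltW u1))).
have nu0 : 0 < cn u by rewrite (lt_trans ltr01).
by rewrite ltr_pdivrMr // mulrC -ltr_pdivrMr.
Qed.

Let psi_real N u : (a < N)%N -> upper u -> Im (psi N u) = 0.
Proof.
move=> aN; apply: real_valued_principle => //.
- exact: psi_exp3.
- exact: psi_bd.
- exact: psi_inf.
Qed.

Let psi_const N u : (a < N)%N -> upper u -> psi N u = (gam N)%:C.
Proof.
move=> aN uH; have u0 := upper_neq0 uH.
have E : psi N.+1 u * u = psi N u - (gam N)%:C.
  have E : (gam N)%:C * u ^+ N * u^-1 ^+ N = (gam N)%:C.
    by rewrite -mulrA -exprMn divff // expr1n mulr1.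
  by rewrite /psi jetsumS exprSr mulrA mulfVK // opprD addrA mulrBl E.
have := congr1 (@complex.Im R) E.
rewrite ImM (psi_real (ltnW aN : (a < N.+1)%N)) // mul0r addr0 ImD ImN psi_real // subrr.
move/eqP; rewrite mulf_eq0 => /orP[/eqP R0|]; last by rewrite gt_eqF.
have P0 : psi N.+1 u = 0 by apply: complex_ext => //; rewrite psi_real // ltnW.
by move: E; rewrite P0 mul0r => /esym /eqP; rewrite subr_eq0 => /eqP.
Qed.

(* For N > a both psi N and psi N.+1 = (psi N - gam N) / u are real-valued, which
   forces psi N = gam N, and then 0 by letting u tend to infinity. *)
Lemma liouville u : upper u -> phi u = jetsum a.+1 u.
Proof.
have ga0 : gam a.+1 = 0.
  apply/eqP; apply/negP => /negP g0.
  have ng : 0 < `|gam a.+1| by rewrite normr_gt0.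
  have [M HM] := psi_inf (ltnSn a) ng.
  pose v : C := 0 +i* (`|M| + 1).
  have vH : upper v by rewrite /upper /= ltr_wpDl.
  have Mv : M < cn v.
    apply: lt_le_trans (Im_le_cn v); rewrite /= ger0_norm ?addr_ge0 //.
    by rewrite (le_lt_trans (ler_norm M)) // ltrDl.
  by have := HM v vH Mv; rewrite psi_const // cn_real ltxx.
move=> uH; have u0 := upper_neq0 uH.
have := psi_const (ltnSn a) uH; rewrite ga0 rmorph0 /psi => /eqP.
by rewrite mulf_eq0 expf_eq0 invr_eq0 (negPf u0) andbF orbF subr_eq0 => /eqP.
Qed.

End Liouville.

(** * Hensel lifting of a coprime factorization *)

Section Hensel.
Variables (F : fieldType) (g0 h0 U V : {poly F}) (a b : nat) (f : nat -> {poly F}).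
Hypothesis mg0 : g0 \is monic.
Hypothesis mh0 : h0 \is monic.
Hypothesis sg0 : size g0 = a.+1.
Hypothesis sh0 : size h0 = b.+1.
Hypothesis bez : U * g0 + V * h0 = 1.

(** V inverts h0 modulo g0 and U inverts g0 modulo h0; the size bounds make X and Y their own
    remainders. In [jets] the explicit solution turns a bound on p into bounds on X and Y. *)
Lemma split_unique (X Y p : {poly F}) : (size X <= a)%N -> (size Y <= b)%N ->
  X * h0 + g0 * Y = p -> X = (V * p) %% g0 /\ Y = (U * p) %% h0.
Proof.
move=> sX sY <-; split.
  have -> : V * (X * h0 + g0 * Y) = X + (V * Y - X * U) * g0.
    rewrite -{2}[X]mulr1 -bez; ring.
  by rewrite modpD modp_mull addr0 modp_small // sg0.
have -> : U * (X * h0 + g0 * Y) = Y + (U * X - Y * V) * h0.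
  rewrite -{2}[Y]mulr1 -bez; ring.
by rewrite modpD modp_mull addr0 modp_small // sh0.
Qed.

Lemma split_exists (p : {poly F}) : (size p <= a + b)%N ->
  ((V * p) %% g0) * h0 + g0 * ((U * p) %% h0) = p.
Proof.
move=> sp; set X := (V * p) %% g0.
have g00 : g0 != 0 by rewrite monic_neq0.
have h00 : h0 != 0 by rewrite monic_neq0.
have sX : (size X <= a)%N by rewrite -ltnS -sg0 ltn_modp.
set Y := U * p + (V * p) %/ g0 * h0.
have E : X * h0 + g0 * Y = p.
  have e1 : V * p = (V * p) %/ g0 * g0 + X by rewrite -divp_eq.
  have -> : X * h0 + g0 * Y = (X + (V * p) %/ g0 * g0) * h0 + U * g0 * p.
    rewrite /Y; ring.
  by rewrite [X + _]addrC -e1 mulrAC -mulrDl addrC bez mul1r.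
have sY : (size Y <= b)%N.
  have [->|Y0] := eqVneq Y 0; first by rewrite size_poly0.
  have : (size (g0 * Y)%R <= a + b)%N.
    have -> : g0 * Y = p - X * h0 by rewrite -[in RHS]E; ring.
    rewrite (leq_trans (size_polyD _ _)) // size_polyN geq_max sp.
    by rewrite (leq_trans (size_polyMleq _ _)) // sh0 addnS /= leq_add2r.
  by rewrite size_monicM // sg0 addSn /= leq_add2l.
by have [_ <-] := split_unique sX sY E.
Qed.

(* One step of Hensel lifting: the list holds the coefficients of u^0, ..., u^(k-1)
   of the two factors of \sum_k f k u^k. *)
Definition hstep (s : seq ({poly F} * {poly F})) : {poly F} * {poly F} :=
  let k := size s in
  let r := f k - \sum_(1 <= i < k) (nth (0, 0) s i).1 * (nth (0, 0) s (k - i)).2 in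
  ((V * r) %% g0, (U * r) %% h0).

Fixpoint hlist (k : nat) : seq ({poly F} * {poly F}) :=
  if k is k'.+1 then rcons (hlist k') (hstep (hlist k')) else [:: (g0, h0)].

Definition hgam k := (nth (0, 0) (hlist k) k).1.
Definition heta k := (nth (0, 0) (hlist k) k).2.

Lemma size_hlist k : size (hlist k) = k.+1.
Proof. by elim: k => //= k IH; rewrite size_rcons IH. Qed.

Lemma nth_hlist k m : (k <= m)%N -> nth (0, 0) (hlist m) k = (hgam k, heta k).
Proof.
elim: m => [|m IH]; first by rewrite leqn0 => /eqP->.
rewrite leq_eqVlt => /predU1P[->|]; first by rewrite /hgam /heta -surjective_pairing.
by rewrite ltnS => le; rewrite /= nth_rcons size_hlist ltnS le IH.
Qed.

(** What the products of earlier coefficients leave for the two new terms [hgam k * h0] and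
    [g0 * heta k]. *)
Definition hres k := f k - \sum_(1 <= i < k) hgam i * heta (k - i).

Lemma hgamE k : (0 < k)%N -> hgam k = (V * hres k) %% g0.
Proof.
case: k => // k _; rewrite /hgam /= nth_rcons size_hlist ltnn eqxx /hstep size_hlist /=.
congr ((V * (_ - _)) %% _); apply: eq_big_nat => i /andP[i0 ik].
by rewrite !nth_hlist //; lia.
Qed.

Lemma hetaE k : (0 < k)%N -> heta k = (U * hres k) %% h0.
Proof.
case: k => // k _; rewrite /heta /= nth_rcons size_hlist ltnn eqxx /hstep size_hlist /=.
congr ((U * (_ - _)) %% _); apply: eq_big_nat => i /andP[i0 ik].
by rewrite !nth_hlist //; lia.
Qed.

Lemma hgam0 : hgam 0 = g0. Proof. by []. Qed.
Lemma heta0 : heta 0 = h0. Proof. by []. Qed.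

Hypothesis f0 : f 0 = g0 * h0.
Hypothesis sf : forall k, (0 < k)%N -> (size (f k) <= a + b)%N.

Lemma size_hgam k : (0 < k)%N -> (size (hgam k) <= a)%N.
Proof. by move=> k0; rewrite hgamE // -ltnS -sg0 ltn_modp monic_neq0. Qed.

Lemma size_heta k : (0 < k)%N -> (size (heta k) <= b)%N.
Proof. by move=> k0; rewrite hetaE // -ltnS -sh0 ltn_modp monic_neq0. Qed.

Lemma size_hres k : (0 < k)%N -> (size (hres k) <= a + b)%N.
Proof.
move=> k0; rewrite (leq_trans (size_polyD _ _)) // size_polyN geq_max sf //=.
rewrite (leq_trans (size_sum _ _ _)) //; apply/bigmax_leqP_seq => i.
rewrite mem_index_iota => /andP[i0 ik] _; rewrite (leq_trans (size_polyMleq _ _)) //.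
have := size_hgam i0; have : (0 < k - i)%N by lia.
move/size_heta; lia.
Qed.

Lemma hensel k : \sum_(i < k.+1) hgam i * heta (k - i) = f k.
Proof.
case: k => [|k]; first by rewrite big_ord1 subn0 hgam0 heta0 f0.
have := split_exists (size_hres (ltn0Sn k)); rewrite -hgamE // -hetaE // => E.
rewrite -(big_mkord xpredT (fun i => hgam i * heta (k.+1 - i))).
rewrite big_nat_recr //= subnn big_ltn // subn0 hgam0 heta0.
rewrite addrAC [X in X + _]addrC E /hres; exact: subrK.
Qed.

End Hensel.

Lemma linear_expand (F : nzRingType) (L : {poly F} -> {poly F}) D (p : {poly F}) :
  {morph L : p q / p + q} -> (forall c p, L (c *: p) = c *: L p) ->
  (size p <= D)%N -> L p = \sum_(i < D) p`_i *: L 'X^i.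
Proof.
move=> LD LZ sp; have L0 : L 0 = 0 by have := LZ 0 0; rewrite !scale0r.
rewrite -[in LHS](coefK p) (poly_def (size p)) /=.
have -> : \sum_(i < size p) p`_i *: 'X^i = \sum_(i < D) p`_i *: 'X^i :> {poly F}.
  rewrite (big_ord_widen D (fun i => p`_i *: 'X^i)) // big_mkcond.
  by apply: eq_bigr => i _; case: ltnP => // le; rewrite nth_default // scale0r.
by rewrite (big_morph L LD L0); apply: eq_bigr => i _; rewrite LZ.
Qed.

Section LinearBound.
Variables (R : rcfType) (D : nat).
Local Notation C := R[i].

Lemma linear_bounded (L : {poly C} -> {poly C}) :
  {morph L : p q / p + q} -> (forall c p, L (c *: p) = c *: L p) ->
  exists2 K : R, 0 <= K & forall p : {poly C}, (size p <= D)%N -> pn D (L p) <= K * pn D p.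
Proof.
move=> LD LZ; exists (\sum_(i < D) pn D (L 'X^i)).
  by apply: sumr_ge0 => i _; exact: pn_ge0.
move=> p sp.
rewrite (linear_expand LD LZ sp).
rewrite (le_trans (pn_sum _ _ _ _)) // mulr_suml; apply: ler_sum => i _.
by rewrite pnZ mulrC ler_wpM2l ?pn_ge0 // cn_coef_le.
Qed.

End LinearBound.

(** * Comparison of a factorization with its Hensel lift *)

Section Jets.
Variables (R : rcfType) (D a b N : nat).
Local Notation C := R[i].
Variables (Q Gam Eta : {poly {poly C}}) (g0 h0 U V : {poly C}).
Variables (S : C -> Prop) (G H : C -> {poly C}).
Hypothesis abD : (a + b < D)%N.
Hypothesis sg0 : size g0 = a.+1.
Hypothesis sh0 : size h0 = b.+1.
Hypothesis bez : U * g0 + V * h0 = 1.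
Hypothesis Gam0 : Gam`_0 = g0.
Hypothesis Eta0 : Eta`_0 = h0.
Hypothesis sGam : forall k, (0 < k)%N -> (size (Gam`_k)%R <= a)%N.
Hypothesis sEta : forall k, (0 < k)%N -> (size (Eta`_k)%R <= b)%N.
Hypothesis GamEta : forall k, (k < N)%N -> (Gam * Eta)`_k = Q`_k.
Hypothesis QGH : forall h, S h -> Q.[h%:P] = G h * H h.
Hypothesis sG : forall h, S h -> (size (G h - g0)%R <= a)%N.
Hypothesis sH : forall h, S h -> (size (H h - h0)%R <= b)%N.
Hypothesis Hcont : forall eps : R, 0 < eps -> exists2 del : R, 0 < del &
  forall h, S h -> cn h < del -> pn D (H h - h0) < eps.

Let size_tail (P : {poly {poly C}}) (m : nat) (h : C) :
  (forall k, (0 < k)%N -> (size (P`_k)%R <= m)%N) -> (size (P.[h%:P] - P`_0)%R <= m)%N.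
Proof.
move=> sP; rewrite horner_coef.
case E : (size P) => [|s].
  by rewrite big_ord0 nth_default ?E // subr0 size_poly0.
rewrite big_ord_recl /= expr0 mulr1 addrC addKr (leq_trans (size_sum _ _ _)) //.
apply/bigmax_leqP => i _; rewrite /bump /= -polyC_exp.
rewrite mulrC mul_polyC (leq_trans (size_scale_leq _ _)) //; exact: sP.
Qed.

(** For the errors A and B of the two factors, A H + Gam B = G H - Gam Eta is of order h^N, since
    Gam Eta agrees with Q below degree N. As H and Gam are near h0 and g0, this perturbs the
    equation of [split_unique], whose solution is a bounded linear function of p. *)
Lemma jets : exists2 K : R, 0 <= K & exists2 del : R, 0 < del &
  forall h, S h -> cn h < del ->
    pn D (G h - Gam.[h%:P]) <= K * cn h ^+ N /\
    pn D (H h - Eta.[h%:P]) <= K * cn h ^+ N.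
Proof.
have [K1 K10 HK1] : exists2 K : R, 0 <= K & forall p : {poly C}, (size p <= D)%N ->
    pn D ((V * p) %% g0) <= K * pn D p.
  apply: (@linear_bounded R D (fun p => (V * p) %% g0)) => [p q|c p].
    by rewrite mulrDr modpD.
  by rewrite -scalerAr modpZl.
have [K2 K20 HK2] : exists2 K : R, 0 <= K & forall p : {poly C}, (size p <= D)%N ->
    pn D ((U * p) %% h0) <= K * pn D p.
  apply: (@linear_bounded R D (fun p => (U * p) %% h0)) => [p q|c p].
    by rewrite mulrDr modpD.
  by rewrite -scalerAr modpZl.
pose P := Q - Gam * Eta; pose Z := drop_poly N P.
have PZ : P = Z * 'X^N.
  rewrite -[LHS](poly_take_drop N) -/Z (_ : take_poly N P = 0) ?add0r //.
  apply/polyP => k; rewrite coef_take_poly coef0; case: ifP => // kN.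
  by rewrite coefB GamEta // subrr.
have [B B0 HB] := pn_horner_bounded D Z ler01.
pose K := K1 + K2 + 1.
have K0 : 0 < K by rewrite ltr_wpDl // addr_ge0.
(* This closeness makes the perturbation at most half of |A| + |B| after solving, so that it is
   absorbed on the left. *)
have e0 : 0 < 1 / (2 * K) by rewrite divr_gt0 // mulr_gt0.
have [d1 d10 H1] := Hcont e0.
have [d2 d20 H2] := pn_horner_cont D Gam 0 e0.
exists (2 * K * B); first by rewrite !mulr_ge0 // ltW.
exists (Num.min (Num.min d1 d2) 1); first by rewrite !lt_min d10 d20 ltr01.
move=> h Sh; rewrite !lt_min => /andP[/andP[/(H1 h Sh) lt1 hd2] /ltW h1].
have := H2 h; rewrite subr0 => /(_ hd2); rewrite horner_coef0 Gam0 => lt2.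
set A := G h - Gam.[h%:P]; set B' := H h - Eta.[h%:P].
have sA : (size A <= a)%N.
  have -> : A = (G h - g0) - (Gam.[h%:P] - Gam`_0) by rewrite Gam0 /A; ring.
  by rewrite (leq_trans (size_polyD _ _)) // size_polyN geq_max sG // size_tail.
have sB : (size B' <= b)%N.
  have -> : B' = (H h - h0) - (Eta.[h%:P] - Eta`_0) by rewrite Eta0 /B'; ring.
  by rewrite (leq_trans (size_polyD _ _)) // size_polyN geq_max sH // size_tail.
pose r := A * h0 + g0 * B'.
have rE : r = h ^+ N *: Z.[h%:P] - A * (H h - h0) - (Gam.[h%:P] - g0) * B'.
  have e1 : Q.[h%:P] = Gam.[h%:P] * Eta.[h%:P] + h ^+ N *: Z.[h%:P].
    have -> : Q = Gam * Eta + P by rewrite /P addrC subrK.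
    rewrite hornerD hornerM PZ hornerM hornerXn; congr (_ + _).
    by rewrite -polyC_exp mulrC mul_polyC.
  have -> : h ^+ N *: Z.[h%:P] = G h * H h - Gam.[h%:P] * Eta.[h%:P].
    by rewrite -QGH // e1 [RHS]addrC addKr.
  rewrite /r /A /B'; ring.
have sr : (size r <= D)%N.
  rewrite (leq_trans (size_polyD _ _)) // geq_max.
  rewrite (leq_trans (size_polyMleq _ _)) ?sh0 ?addnS /=; last first.
    by rewrite (leq_trans (leq_add sA (leqnn b))) // ltnW.
  rewrite (leq_trans (size_polyMleq _ _)) // sg0 addSn /=.
  by rewrite (leq_trans (leq_add (leqnn a) sB)) // ltnW.
have [EA EB] := split_unique sg0 sh0 bez sA sB (erefl r).
have leA : pn D A <= K1 * pn D r by rewrite {1}EA; exact: HK1.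
have leB : pn D B' <= K2 * pn D r by rewrite {1}EB; exact: HK2.
have ler : pn D r <= B * cn h ^+ N + (1 / (2 * K)) * (pn D A + pn D B').
  rewrite rE (le_trans (pnB _ _ _)) // [1 / _ * _]mulrDr addrA lerD //.
    rewrite (le_trans (pnB _ _ _)) // lerD //.
      by rewrite pnZ cnX mulrC ler_wpM2r ?exprn_ge0 ?cn_ge0 // HB.
    by rewrite (le_trans (pnM _ _ _)) // mulrC ler_wpM2r ?pn_ge0 // ltW.
  by rewrite (le_trans (pnM _ _ _)) // ler_wpM2r ?pn_ge0 // ltW.
have leS : pn D A + pn D B' <= 2 * K * B * cn h ^+ N.
  have s1 : pn D A + pn D B' <= K * pn D r.
    apply: (le_trans (lerD leA leB)); rewrite -mulrDl ler_wpM2r ?pn_ge0 //.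
    by rewrite lerDl.
  have s2 : K * pn D r <= K * (B * cn h ^+ N) + (pn D A + pn D B') / 2.
    have -> : (pn D A + pn D B') / 2 = K * ((1 / (2 * K)) * (pn D A + pn D B')).
      by field; rewrite gt_eqF.
    by rewrite -mulrDr ler_wpM2l // ltW.
  have -> : 2 * K * B * cn h ^+ N = 2 * (K * (B * cn h ^+ N)) by ring.
  move: s1 s2; move: (pn D A + pn D B') (K * pn D r) (K * (B * cn h ^+ N)) => x y z.
  move=> {}h1 h2; lra.
have A0 := pn_ge0 D A; have B'0 := pn_ge0 D B'.
split; apply: le_trans leS; by rewrite ?lerDl ?lerDr.
Qed.

End Jets.

(** * Factorization along two hyperbolic directions *)

Section HomogeneousFunctions.
Variables (R : realType) (n : nat).
Local Notation vec := ('I_n -> R).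

Definition hpoly (k : nat) (g : vec -> R) :=
  exists2 p : pol R n, homog k p & forall x, g x = evR p x.

Lemma eq_hpoly k g g' : g =1 g' -> hpoly k g -> hpoly k g'.
Proof. by move=> e [p hp gp]; exists p => // x; rewrite -e. Qed.

Lemma hpoly0 k : hpoly k (fun=> 0).
Proof. by exists [::] => // x; rewrite /evR /ev big_nil. Qed.

Lemma hpolyD k g g' : hpoly k g -> hpoly k g' -> hpoly k (fun x => g x + g' x).
Proof.
move=> [p hp gp] [q hq gq]; exists (p ++ q).
  by rewrite /homog all_cat; apply/andP; split.
by move=> x; rewrite gp gq /evR /ev big_cat.
Qed.

Lemma hpolyM k k' g g' : hpoly k g -> hpoly k' g' -> hpoly (k + k') (fun x => g x * g' x).
Proof.
move=> [p hp gp] [q hq gq].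
pose mm (m m' : R * ('I_n -> nat)) := (m.1 * m'.1, fun i => (m.2 i + m'.2 i)%N).
exists [seq mm m m' | m <- p, m' <- q].
  rewrite /homog; elim: p hp {gp} => //= m p IH /andP[/eqP hm hp].
  rewrite all_cat IH // andbT all_map; apply: sub_all hq => m' /= /eqP hm'.
  by rewrite big_split /= hm hm'.
move=> x; rewrite gp gq /evR /ev big_allpairs_dep big_distrl /=; apply: eq_bigr => m _.
rewrite big_distrr /=; apply: eq_bigr => m' _; rewrite mulrACA; congr (_ * _).
by rewrite -big_split; apply: eq_bigr => i _; rewrite exprD.
Qed.

Lemma hpolyC (c : R) : hpoly 0 (fun=> c).
Proof.
exists [:: (c, fun=> 0%N)]; first by rewrite /homog /= big1.
by move=> x; rewrite /evR /ev big_seq1 big1 ?mulr1.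
Qed.

Lemma hpolyZ k c g : hpoly k g -> hpoly k (fun x => c * g x).
Proof. by move=> hg; rewrite -[k]add0n; apply: hpolyM => //; exact: hpolyC. Qed.

Lemma hpolyN k g : hpoly k g -> hpoly k (fun x => - g x).
Proof. by move=> /(hpolyZ (-1)); apply: eq_hpoly => x; rewrite mulN1r. Qed.

Lemma hpoly_coord i : hpoly 1 (fun x => x i).
Proof.
exists [:: (1, fun j => nat_of_bool (j == i))].
  by rewrite /homog /= andbT (bigD1 i) //= eqxx big1 // => j /negPf->.
move=> x; rewrite /evR /ev big_seq1 mul1r (bigD1 i) //= eqxx expr1 big1 ?mulr1 //.
by move=> j /negPf->; rewrite expr0.
Qed.

Lemma hpoly_sum k (I : Type) (r : seq I) (P : pred I) (F : I -> vec -> R) :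
  (forall i, P i -> hpoly k (F i)) -> hpoly k (fun x => \sum_(i <- r | P i) F i x).
Proof.
move=> HF; elim: r => [|i r IH].
  by apply: eq_hpoly (hpoly0 k) => x; rewrite big_nil.
case Pi: (P i).
  by apply: eq_hpoly (hpolyD (HF i Pi) IH) => x; rewrite big_cons Pi.
by apply: eq_hpoly IH => x; rewrite big_cons Pi.
Qed.

(** Bookkeeping for families in which x occurs only as u x: the power of the outer variable u counts
    the degree in x. *)
Definition graded (B : vec -> {poly {poly R}}) :=
  forall k j, hpoly k (fun x => (B x)`_k`_j).

Lemma gradedD B B' : graded B -> graded B' -> graded (fun x => B x + B' x).
Proof.
move=> hB hB' k j; apply: eq_hpoly (hpolyD (hB k j) (hB' k j)) => x.
by rewrite !coefD.
Qed.

Lemma gradedM B B' : graded B -> graded B' -> graded (fun x => B x * B' x).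
Proof.
move=> hB hB' k j.
pose F x := \sum_(i < k.+1) \sum_(l < j.+1) (B x)`_i`_l * (B' x)`_(k - i)`_(j - l).
apply: (@eq_hpoly _ F); first by move=> x; rewrite coefM coef_sum; apply: eq_bigr => i _; rewrite coefM.
apply: hpoly_sum => i _; apply: hpoly_sum => l _.
have hk : hpoly (i + (k - i)) (fun x => (B x)`_i`_l * (B' x)`_(k - i)`_(j - l)).
  exact: hpolyM.
by rewrite subnKC -1?ltnS in hk.
Qed.

Lemma graded0 : graded (fun=> 0).
Proof. by move=> k j; apply: eq_hpoly (hpoly0 k) => x; rewrite !coef0. Qed.

Lemma gradedC (p : {poly R}) : graded (fun=> p%:P).
Proof.
move=> [|k] j; last by apply: eq_hpoly (hpoly0 _) => x; rewrite coefC /= coef0.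
by apply: eq_hpoly (hpolyC p`_j) => x; rewrite coefC.
Qed.

Lemma gradedX i : graded (fun x => 'X * (x i)%:P%:P).
Proof.
move=> k j; have [k1|k1] := eqVneq k 1%N.
  case: j => [|j].
    rewrite k1; apply: eq_hpoly (hpoly_coord i) => x.
    by rewrite mulrC coefMX /= !coefC.
  by rewrite k1; apply: eq_hpoly (hpoly0 _) => x; rewrite mulrC coefMX /= !coefC.
apply: eq_hpoly (hpoly0 _) => x; rewrite mulrC coefMX coefC.
by case: k k1 => [|[|k]] //= _; rewrite coef0.
Qed.

Lemma graded_exp B k : graded B -> graded (fun x => B x ^+ k).
Proof.
move=> hB; elim: k => [|k IH]; first exact: gradedC.
by move=> i j; apply: eq_hpoly (gradedM hB IH i j) => x; rewrite exprS.
Qed.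

Lemma graded_ev f (e0 e : vec) :
  graded (fun x => ev (fun r => r%:P%:P) f
    (fun i => (e i)%:P%:P + 'X * (x i)%:P%:P + 'X%:P * (e0 i)%:P%:P)).
Proof.
elim: f => [|m f IH].
  by move=> k j; apply: eq_hpoly (graded0 k j) => x; rewrite /ev big_nil.
pose M (x : vec) : {poly {poly R}} :=
  m.1%:P%:P * \prod_i ((e i)%:P%:P + 'X * (x i)%:P%:P + 'X%:P * (e0 i)%:P%:P) ^+ m.2 i.
have hM : graded M.
  apply: gradedM; first exact: gradedC.
  rewrite /index_enum; elim: (Finite.enum _) => [|i r IHr].
    by move=> k j; apply: eq_hpoly (gradedC 1 k j) => x; rewrite big_nil.
  have h1 : graded (fun x : vec => ((e i)%:P%:P + 'X * (x i)%:P%:P + 'X%:P * (e0 i)%:P%:P) ^+ m.2 i).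
    apply: graded_exp; apply: gradedD.
      by apply: gradedD; [exact: gradedC | exact: gradedX].
    by move=> k j; apply: eq_hpoly (gradedC ('X * (e0 i)%:P) k j) => x; rewrite polyCM.
  by move=> k j; apply: eq_hpoly (gradedM h1 IHr k j) => x; rewrite big_cons.
by move=> k j; apply: eq_hpoly (gradedD hM IH k j) => x; rewrite /ev big_cons.
Qed.

End HomogeneousFunctions.

Lemma coprimep_prod_XsubC (F : fieldType) (s t : seq F) :
  (forall z, z \in s -> z \notin t) ->
  coprimep (\prod_(z <- s) ('X - z%:P)) (\prod_(z <- t) ('X - z%:P)).
Proof.
elim: s => [|z s IH] H; first by rewrite big_nil coprime1p.
rewrite big_cons coprimepMl coprimep_sym coprimep_XsubC root_prod_XsubC H ?mem_head //= IH //.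
by move=> w ws; apply: H; rewrite in_cons ws orbT.
Qed.

Lemma poly_eq_on_seq (F : fieldType) (p q : {poly F}) (g : nat -> F) :
  injective g -> (forall m, p.[g m] = q.[g m]) -> p = q.
Proof.
move=> ig E; apply/eqP; rewrite -subr_eq0; apply/eqP.
apply: (@roots_geq_poly_eq0 _ _ [seq g m | m <- iota 0 (size (p - q))]).
- by apply/allP => _ /mapP[m _ ->]; rewrite rootE hornerD hornerN E subrr.
- by rewrite map_inj_uniq ?iota_uniq.
- by rewrite size_map size_iota.
Qed.

Section FamilyCoefficients.
Variables (R : realType).
Local Notation C := R[i].

Lemma natC_inj : injective (fun m : nat => m%:R : C).
Proof. by move=> m m' /eqP; rewrite eqr_nat => /eqP. Qed.

Lemma coef_horner_const (Q : {poly {poly C}}) j (lam : C) :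
  (forall c : C, Q.[c%:P]`_j = lam) -> forall k, (0 < k)%N -> Q`_k`_j = 0.
Proof.
move=> H k k0; pose q := map_poly (fun p : {poly C} => p`_j) Q.
have qE (c : C) : q.[c] = Q.[c%:P]`_j.
  rewrite /q (@horner_coef_wide _ (size Q)); last first.
    by rewrite map_polyE (leq_trans (size_Poly _)) // size_map.
  rewrite horner_coef coef_sum; apply: eq_bigr => i _.
  by rewrite coef_map_id0 ?coef0 // -polyC_exp coefMC.
have -> : Q`_k`_j = q`_k by rewrite coef_map_id0 // coef0.
have -> : q = lam%:P.
  by apply: (poly_eq_on_seq natC_inj) => m; rewrite qE H hornerC.
by rewrite coefC; case: k k0.
Qed.

(** The coefficient of degree d is constant in the parameter, so positive powers of the parameter
    carry smaller degree. This is the size condition of Hensel lifting. *)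
Lemma size_family_coef (Q : {poly {poly C}}) d (lam : C) :
  (forall c : C, (size Q.[c%:P] <= d.+1)%N) -> (forall c : C, Q.[c%:P]`_d = lam) ->
  forall k, (0 < k)%N -> (size (Q`_k)%R <= d)%N.
Proof.
move=> sQ lQ k k0; apply/leq_sizeP => j; rewrite leq_eqVlt => /predU1P[<-|dj].
  exact: coef_horner_const lQ k k0.
apply: (@coef_horner_const Q j 0) => // c; apply: nth_default.
exact: leq_trans (sQ c) dj.
Qed.

End FamilyCoefficients.

(** * Separating roots by the line spanned by u *)

Section Selection.
Variable R : realType.
Local Notation C := R[i].
Implicit Types u z : C.

(* The sign of Im (z / u), up to the positive factor |u|^2. *)
Definition selv u z : R := Im z * Re u - Re z * Im u.
Definition sel u z : bool := selv u z < 0.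

Lemma selv0 u z : u != 0 -> selv u z = 0 -> exists r : R, z = r%:C * u.
Proof.
move=> u0 E; pose nu := Re u ^+ 2 + Im u ^+ 2.
have nu0 : nu != 0.
  apply: contra u0 => /eqP nu0; rewrite -cn_eq0 -sqrf_eq0 sqr_cn.
  exact/eqP.
exists ((Re z * Re u + Im z * Im u) / nu).
have {}E : Im z * Re u = Re z * Im u by apply/eqP; rewrite -subr_eq0; apply/eqP.
have e1 : (Re z * Re u + Im z * Im u) * Re u = Re z * nu.
  by rewrite mulrDl [Im z * _ * _]mulrAC E /nu; ring.
have e2 : (Re z * Re u + Im z * Im u) * Im u = Im z * nu.
  by rewrite mulrDl [Re z * _ * _]mulrAC -E /nu; ring.
apply: complex_ext; rewrite ?ReM ?ImM /= mul0r ?subr0 ?addr0 mulrAC ?e1 ?e2 mulfK //.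
Qed.

Lemma selv_cont u z (eps : R) : 0 < eps -> exists2 e : R, 0 < e &
  forall u' z', cn (u' - u) < e -> cn (z' - z) < e -> `|selv u' z' - selv u z| < eps.
Proof.
move=> eps0; pose M := 2 * (cn u + cn z + 1).
have cu := cn_ge0 u; have cz := cn_ge0 z.
have M0 : 0 < M by rewrite /M; lra.
exists (Num.min 1 (eps / M)); first by rewrite lt_min ltr01 divr_gt0.
move=> u' z'; rewrite !lt_min => /andP[u1 u2] /andP[z1 z2].
have -> : selv u' z' - selv u z =
   (Im (z' - z) * Re u' - Re (z' - z) * Im u') + (Im z * Re (u' - u) - Re z * Im (u' - u)).
  by rewrite /selv !ReD !ImD !ReN !ImN; ring.
have pb (s t s' t' A B : R) : `|s| <= A -> `|t| <= B -> `|s'| <= A -> `|t'| <= B ->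
    `|s * t - s' * t'| <= 2 * (A * B).
  move=> h1 h2 h3 h4; rewrite (le_trans (ler_normB _ _)) // !normrM mulr2n mulrDl mul1r.
  by apply: lerD; apply: ler_pM.
have uM : cn u' <= cn u + 1.
  by rewrite -(subrK u u') (le_trans (cnD _ _)) // addrC lerD2l ltW.
apply: (le_lt_trans (ler_normD _ _)).
have b1 := pb _ _ _ _ _ _ (Im_le_cn (z' - z)) (Re_le_cn u') (Re_le_cn (z' - z)) (Im_le_cn u').
have b2 := pb _ _ _ _ _ _ (Im_le_cn z) (Re_le_cn (u' - u)) (Re_le_cn z) (Im_le_cn (u' - u)).
apply: (le_lt_trans (lerD b1 b2)).
apply: (@le_lt_trans _ _ (2 * (cn (z' - z) * (cn u + 1)) + 2 * (cn z * cn (u' - u)))).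
  by rewrite lerD2r ler_wpM2l ?ler0n // ler_wpM2l ?cn_ge0.
move: u2 z2; rewrite !ltr_pdivlMr // /M.
move: (cn (z' - z)) (cn (u' - u)) (cn u) (cn z) cu cz (cn_ge0 (z' - z)) (cn_ge0 (u' - u)).
clear => s t p q p0 q0 s0 t0 h1 h2.
have [le|lt] := leP s t.
  apply: le_lt_trans h1; have : s * (p + 1) <= t * (p + 1) by rewrite ler_wpM2r // addr_ge0.
  have -> : t * (2 * (p + q + 1)) = 2 * (t * (p + 1)) + 2 * (q * t) by ring.
  lra.
apply: le_lt_trans h2; have : q * t <= q * s by rewrite ler_wpM2l // ltW.
have -> : s * (2 * (p + q + 1)) = 2 * (s * (p + 1)) + 2 * (q * s) by ring.
lra.
Qed.

Lemma stable_sel u z : selv u z != 0 -> stable_at sel u z.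
Proof.
move=> s0; have n0 : 0 < `|selv u z| by rewrite normr_gt0.
have [e e0 H] := selv_cont u z n0; exists e => // u' z' h1 h2.
have := H u' z' h1 h2; rewrite /sel; move: (selv u' z') (selv u z) s0 => s t t0.
rewrite ltr_norml => /andP[].
have [I0|I0|I0] := ltgtP t 0; rewrite ?(ltr0_norm I0) ?(gtr0_norm I0).
- by move=> *; lra.
- by move=> *; apply/negbTE; rewrite -leNgt; lra.
- by rewrite I0 eqxx in t0.
Qed.

Lemma stable_Re_eq0 (c z : C) : Re z != 0 -> stable_at (fun _ z : C => Re z == 0) c z.
Proof.
move=> Iz; exists `|Re z|; first by rewrite normr_gt0.
move=> _ z' _ zz'; rewrite (negPf Iz); apply/negP => /eqP z'0.
have := le_lt_trans (Re_le_cn _) zz'.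
by rewrite ReD ReN z'0 add0r normrN ltxx.
Qed.

Lemma stable_comb (op : bool -> bool -> bool) (P P' : C -> C -> bool) c z :
  stable_at P c z -> stable_at P' c z -> stable_at (fun c z => op (P c z) (P' c z)) c z.
Proof.
move=> [e1 h1 H1] [e2 h2 H2]; exists (Num.min e1 e2); first by rewrite lt_min h1.
by move=> c' z'; rewrite !lt_min => /andP[? ?] /andP[? ?]; rewrite H1 // H2.
Qed.

End Selection.

Section RootBound.
Variable R : rcfType.
Local Notation C := R[i].

(** Cauchy's root bound; it feeds the growth estimate [fil_growth]. *)
Lemma monic_root_bound D d (p : {poly C}) z : (d < D)%N -> (size p <= d.+1)%N ->
  p`_d = 1 -> root p z -> cn z <= 1 + pn D p.
Proof.
move=> dD sp pd /eqP pz; rewrite leNgt; apply/negP => lt.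
have z1 : 1 < cn z by apply: le_lt_trans lt; rewrite lerDl pn_ge0.
have z0 : 0 < cn z by exact: lt_trans z1.
case: d dD sp pd => [|d] dD sp pd.
  by move: pz; rewrite (size1_polyC sp) hornerC pd => /eqP; rewrite oner_eq0.
move: pz; rewrite (horner_coef_wide _ sp) big_ord_recr /= pd mul1r.
move/eqP; rewrite addrC addr_eq0 => /eqP E.
have : cn z ^+ d.+1 <= pn D p * cn z ^+ d.
  rewrite -cnX E cnN (le_trans (cn_sum _ _ _)) //.
  rewrite (@le_trans _ _ (\sum_(i < d.+1) cn p`_i * cn z ^+ d)) //.
    apply: ler_sum => i _; rewrite cnM cnX ler_wpM2l ?cn_ge0 //.
    by rewrite ler_weXn2l // ?ltW // -ltnS.
  rewrite -mulr_suml ler_wpM2r ?exprn_ge0 ?(ltW z0) //.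
  rewrite /pn (big_ord_widen D (fun i => cn p`_i) (ltnW dD)) big_mkcond /=.
  by apply: ler_sum => i _; case: ifP => // _; exact: cn_ge0.
rewrite exprS ler_pM2r ?exprn_gt0 // => le.
by have := lt_le_trans lt le; rewrite gtrDr ltNge ler01.
Qed.

End RootBound.

Lemma horner_poly_sum (F : comNzRingType) N (E : nat -> {poly F}) (h : F) :
  (\poly_(k < N) E k).[h%:P].[0] = \sum_(k < N) (E k).[0] * h ^+ k.
Proof.
have -> : (\poly_(k < N) E k).[h%:P] = \sum_(k < N) E k * h%:P ^+ k.
  rewrite (horner_coef_wide _ (size_poly N E)); apply: eq_bigr => k _.
  by rewrite coef_poly ltn_ord.
by rewrite horner_sum; apply: eq_bigr => k _; rewrite hornerM -polyC_exp hornerC.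
Qed.

Lemma size_monic_sub (F : nzRingType) (p q : {poly F}) m : p \is monic -> q \is monic ->
  size p = m.+1 -> size q = m.+1 -> (size (p - q)%R <= m)%N.
Proof.
move=> mp mq sp sq; apply/leq_sizeP => j; rewrite leq_eqVlt => /predU1P[<-|mj].
  have lp : p`_m = 1 by move/monicP: mp; rewrite lead_coefE sp.
  have lq : q`_m = 1 by move/monicP: mq; rewrite lead_coefE sq.
  by rewrite coefB lp lq subrr.
by rewrite coefB !nth_default ?subrr // ?sp ?sq.
Qed.

(** * The two groups of roots over the upper half plane *)

Section Splitting.
Variables (R : realType) (n d : nat) (f : pol R n) (e0 e : 'I_n -> R).
Local Notation C := R[i].
Hypothesis hf : homog d f.
Hypothesis he0 : hyp f e0.
Hypothesis he : hyp f e.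
Hypothesis f1 : evR f e0 = 1.

Section FixedVector.
Variable x : 'I_n -> R.

Definition sfam := fam f (vC e) (vC x) (vC e0).
Definition fb (u : C) := fib sfam u.
(** The boolean names the group: [true] means Im (z / u) < 0, which for small u in the upper half
    plane amounts to a positive real part ([near0_sel]). *)
Definition fil (c : bool) (u : C) := filter (fun z => sel u z == c) (fb u).

Let lam0 : (1 : C) != 0 := oner_neq0 _.

Let e0C : evC f (vC e0) = 1. Proof. by rewrite evC_real f1. Qed.

Lemma size_sfam (c : C) : (size sfam.[c%:P] <= d.+1)%N. Proof. exact: fam_size hf. Qed.

Lemma lead_sfam (c : C) : sfam.[c%:P]`_d = 1.
Proof. by rewrite (fam_lead _ _ _ _ hf). Qed.

Lemma sfamE (c : C) : sfam.[c%:P] = rprod (fb c).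
Proof. by rewrite (famE lam0 size_sfam lead_sfam) scale1r. Qed.

Lemma size_fb u : size (fb u) = d.
Proof. exact: size_fib lam0 size_sfam lead_sfam u. Qed.

Lemma mem_fb (u z : C) :
  (z \in fb u) = (evC f (line (line (vC e) (vC x) u) (vC e0) z) == 0).
Proof. by rewrite (mem_fibf _ _ _ _ hf) // e0C. Qed.

Lemma fb_real (r : R) z : z \in fb r%:C -> Im z = 0.
Proof.
rewrite mem_fb => /eqP E; case: he0 => _ /(_ (line e x r)); apply; rewrite -E.
by apply: eq_evC => i; rewrite /line -/(line (vC e) (vC x) r%:C i) line_real.
Qed.

(** A root z = r u gives f(e + u (x + r e0)) = 0, so u^-1 is a root along e from the real point x +
    r e0, hence real. *)
Lemma fb_upper u z : upper u -> z \in fb u -> selv u z != 0.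
Proof.
move=> uH; rewrite mem_fb => /eqP E; apply/eqP => /(selv0 (upper_neq0 uH))[r zE].
have u0 := upper_neq0 uH.
have : Im u^-1 = 0.
  case: he => _ /(_ (line x e0 r)); apply.
  have : u ^+ d * evC f (line (vC (line x e0 r)) (vC e) u^-1) = 0.
    rewrite -(evC_scale _ _ hf) -E zE; apply: eq_evC => i.
    by rewrite /line /vC rmorphD rmorphM; field.
  by move/eqP; rewrite mulf_eq0 expf_eq0 (negPf u0) andbF => /eqP.
move/Im_eq0_real => ur; move: uH; rewrite /upper -[u]invrK ur -fmorphV /=.
by rewrite ltxx.
Qed.

Lemma fb0_real z : z \in fb 0 -> Im z = 0.
Proof. exact: (@fb_real 0). Qed.

Lemma fb0_neq0 z : z \in fb 0 -> Re z != 0.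
Proof.
move=> zin; apply/eqP => R0.
have z0 : z = 0.
  by apply: complex_ext => //; exact: fb0_real.
move: zin; rewrite z0 mem_fb => /eqP.
rewrite (@eq_evC _ _ _ _ (vC e)); last by move=> i; rewrite /line !mul0r !addr0.
by rewrite evC_real => /eqP; rewrite realC_eq0; case: he => /negPf->.
Qed.

Lemma near0_Re : exists2 rho : R, 0 < rho &
  forall u, cn u < rho -> forall z, z \in fb u -> Re z != 0.
Proof.
have st z : z \in fib sfam 0 -> stable_at (fun _ z : C => Re z == 0) 0 z.
  by move=> /fb0_neq0; exact: stable_Re_eq0.
have [del del0 H] := fib_filter_close lam0 size_sfam lead_sfam ltr01 st.
exists del => // u ud z zin.
have := H u; rewrite subr0 => /(_ ud)[s ps al].
have E0 : [seq z <- fib sfam 0 | Re z == 0] = [::].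
  by apply/eqP; rewrite -size_eq0 size_filter -leqn0 leqNgt -has_count; apply/hasPn => w /fb0_neq0.
move: al; rewrite E0 => /all2_size /size0nil s0.
move: ps; rewrite s0 => /perm_size /esym /eqP; rewrite size_eq0 => /eqP F0.
apply/negP => R0; have : z \in [seq z <- fib sfam u | Re z == 0] by rewrite mem_filter R0.
by rewrite F0.
Qed.

(** On the imaginary axis the two tests agree. Along the horizontal segment from u to that axis
    neither changes on a root, so the number of disagreements stays 0. *)
Lemma near0_sel : exists2 rho : R, 0 < rho &
  forall u, upper u -> cn u < rho -> forall z, z \in fb u -> sel u z = (0 < Re z).
Proof.
have [rho rho0 H] := near0_Re; exists rho => // u uH ur z zin.
pose v : C := 0 +i* Im u.
have pth (t : R) : 0 <= t <= 1 -> upper (u + t%:C * (v - u)) /\ cn (u + t%:C * (v - u)) < rho.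
  case/andP=> t0 t1.
  have E : u + t%:C * (v - u) = ((1 - t) * Re u) +i* Im u.
    by apply: complex_ext; rewrite ?(ReD, ImD, ReM, ImM, ReN, ImN) /=; ring.
  rewrite E; split; first exact: uH.
  apply: le_lt_trans ur; rewrite !cnE /= ler_wsqrtr // lerD2r exprMn ler_piMl ?sqr_ge0 //.
  by rewrite exprn_ile1; lra.
pose P (c z : C) := sel c z != (0 < Re z).
have cnt : count (P u) (fb u) = count (P v) (fb v).
  apply: (count_fib_const lam0 size_sfam lead_sfam) => t t01 w win.
  have [h1 h2] := pth t t01.
  apply: (@stable_comb _ (fun b b' => b != b')).
    by apply: stable_sel; exact: fb_upper h1 win.
  by apply: stable_Re; exact: H h2 _ win.
have vH : upper v by exact: uH.
have c0 : count (P v) (fb v) = 0%N.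
  apply/eqP; rewrite -leqn0 leqNgt -has_count; apply/hasPn => w _.
  rewrite /P negbK /sel /selv /= mulr0 sub0r oppr_lt0.
  by rewrite pmulr_lgt0.
have : ~~ has (P u) (fb u) by rewrite has_count cnt c0.
by move/hasPn => /(_ z zin); rewrite /P negbK => /eqP.
Qed.

(** Group sizes are constant on the upper half plane and are read off at the boundary point 0, where
    the roots depend on e and e0 only. *)
Lemma count_sel u : upper u -> count (sel u) (fb u) = count (fun z : C => 0 < Re z) (fb 0).
Proof.
move=> uH; have [rho1 rho10 H1] := near0_Re; have [rho2 rho20 H2] := near0_sel.
pose rho := Num.min rho1 rho2.
have rho0 : 0 < rho by rewrite lt_min rho10.
pose v : C := 0 +i* (rho / 2).
have r2 : 0 < rho / 2 by rewrite divr_gt0.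
have vn : cn v = rho / 2.
  by rewrite cnE /= expr0n add0r sqrtr_sqr ger0_norm // ltW.
have vr : cn v < rho by rewrite vn ltr_pdivrMr // ltr_pMr // ltr1n.
have [vr1 vr2] : cn v < rho1 /\ cn v < rho2 by move: vr; rewrite lt_min => /andP[].
have vH : upper v by [].
have E1 : count (sel u) (fb u) = count (sel v) (fb v).
  apply: (count_fib_const lam0 size_sfam lead_sfam) => t /andP[t0 t1] w win.
  apply: stable_sel; apply: fb_upper win.
  rewrite /upper ImD ImM /= mul0r addr0 ImD ImN.
  have -> : Im u + t * (Im v - Im u) = (1 - t) * Im u + t * Im v by ring.
  have [t00|tn0] := eqVneq t 0.
    by rewrite t00 subr0 mul1r mul0r addr0.
  apply: ltr_wpDl; first by rewrite mulr_ge0 ?subr_ge0 // ltW.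
  by apply: mulr_gt0; [rewrite lt_def tn0 | exact: r2].
have E2 : count (sel v) (fb v) = count (fun z : C => 0 < Re z) (fb v).
  by apply: eq_in_count => z zin; exact: H2.
apply: (etrans E1); apply: (etrans E2).
apply/esym/(count_fib_const lam0 size_sfam lead_sfam (P := fun _ z : C => 0 < Re z)).
move=> t /andP[t0 t1] w win; apply: stable_Re; apply: (H1 _ _ _ win).
rewrite add0r subr0 cnM cn_real ger0_norm // (le_lt_trans _ vr1) // ler_piMl //.
exact: cn_ge0.
Qed.

Lemma size_fil_true u : upper u -> size (fil true u) = count (fun z : C => 0 < Re z) (fb 0).
Proof.
by move=> uH; rewrite /fil size_filter -(count_sel uH); apply: eq_count => z; rewrite eqb_id.
Qed.

Lemma size_fil_false u : upper u ->
  size (fil false u) = count (fun z : C => ~~ (0 < Re z)) (fb 0).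
Proof.
move=> uH; have := count_predC (fun z : C => 0 < Re z) (fb 0).
have := count_predC (sel u) (fb u); rewrite !size_fb (count_sel uH).
have -> : size (fil false u) = count (predC (sel u)) (fb u).
  by rewrite /fil size_filter; apply: eq_count => z /=; rewrite eqbF_neg.
by move=> <- /addnI /esym.
Qed.

Lemma sfam_split u : sfam.[u%:P] = rprod (fil true u) * rprod (fil false u).
Proof.
rewrite sfamE /rprod -big_cat /=; apply: perm_big; rewrite perm_sym.
have -> : fil true u = filter (sel u) (fb u) by apply: eq_filter => z; rewrite eqb_id.
have -> : fil false u = filter (predC (sel u)) (fb u).
  by apply: eq_filter => z /=; rewrite eqbF_neg.
by rewrite perm_filterC.
Qed.

Lemma fil_cont D c u0 (eps : R) : upper u0 -> 0 < eps -> exists2 del : R, 0 < del &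
  forall u, cn (u - u0) < del -> pn D (rprod (fil c u) - rprod (fil c u0)) < eps.
Proof.
move=> u0H eps0; have [dl dl0 H] := rprod_close D (fil c u0) eps0.
have st z : z \in fib sfam u0 -> stable_at (fun u z => sel u z == c) u0 z.
  move=> zin; apply: (stable_comb (fun b b' => b == b') (P' := fun _ _ => c)); last by exists 1.
  by apply: stable_sel; exact: fb_upper zin.
have [del del0 H'] := fib_filter_close lam0 size_sfam lead_sfam dl0 st.
exists del => // u /H'[s ps al].
by rewrite -(perm_rprod ps); apply: H.
Qed.

Lemma fil_cont0 D c (eps : R) : 0 < eps -> exists2 del : R, 0 < del &
  forall u, upper u -> cn u < del ->
    pn D (rprod (fil c u) - rprod [seq z <- fb 0 | (0 < Re z) == c]) < eps.
Proof.
move=> eps0; have [dl dl0 H] := rprod_close D [seq z <- fb 0 | (0 < Re z) == c] eps0.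
have st z : z \in fib sfam 0 -> stable_at (fun _ z : C => (0 < Re z) == c) 0 z.
  move=> zin; apply: (stable_comb (fun b b' => b == b') (P := fun _ z : C => 0 < Re z)
    (P' := fun _ _ => c)); last by exists 1.
  by apply: stable_Re; exact: fb0_neq0.
have [del del0 H'] := fib_filter_close lam0 size_sfam lead_sfam dl0 st.
have [rho rho0 Hr] := near0_sel.
exists (Num.min del rho); first by rewrite lt_min del0.
move=> u uH; rewrite lt_min => /andP[ud ur].
have := H' u; rewrite subr0 => /(_ ud)[s ps al].
have -> : fil c u = [seq z <- fib sfam u | (0 < Re z) == c].
  by apply: eq_in_filter => z zin; rewrite (Hr u uH ur).
by rewrite -(perm_rprod ps); apply: H.
Qed.

Lemma fil_coprime u : coprimep (rprod (fil true u)) (rprod (fil false u)).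
Proof.
apply: coprimep_prod_XsubC => z; rewrite !mem_filter => /andP[/eqP-> _].
by [].
Qed.

Lemma monic_rprod (s : seq C) : rprod s \is monic.
Proof. exact: monic_prod_XsubC. Qed.

(** The groups at u0 are coprime, so the family recentred at u0 has a Hensel lift, and [jets] with N
    = 3 compares it with the true groups. Evaluation at 0 gives the product of the roots of a group
    up to sign. *)
Lemma fil_exp3 c u0 : upper u0 -> exp3 (fun u => (rprod (fil c u)).[0]) u0.
Proof.
move=> u0H; pose a := size (fil true u0); pose b := size (fil false u0).
have abd : (a + b)%N = d.
  rewrite /a /b /fil !size_filter -(size_fb u0) -(count_predC (sel u0)).
  by congr addn; apply: eq_count => z /=; rewrite ?eqb_id ?eqbF_neg.
pose g0 := rprod (fil true u0); pose h0 := rprod (fil false u0).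
have [[U V] /= bez] := Bezout_eq1_coprimepP _ _ (fil_coprime u0).
pose Q := sfam \Po ('X + u0%:P%:P).
have QE (h : C) : Q.[h%:P] = sfam.[(u0 + h)%:P].
  by rewrite horner_comp hornerD hornerX hornerC polyCD addrC.
have sQ h : (size Q.[h%:P] <= d.+1)%N by rewrite QE size_sfam.
have lQ h : Q.[h%:P]`_d = 1 by rewrite QE lead_sfam.
have Q0 : Q`_0 = g0 * h0.
  by rewrite -horner_coef0 -[0]polyC0 QE addr0 sfam_split.
have sQk k : (0 < k)%N -> (size (Q`_k)%R <= a + b)%N.
  by rewrite abd; exact: size_family_coef sQ lQ k.
have sg0 : size g0 = a.+1 by rewrite size_rprod.
have sh0 : size h0 = b.+1 by rewrite size_rprod.
have mg0 := monic_rprod (fil true u0); have mh0 := monic_rprod (fil false u0).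
pose gam := hgam g0 h0 U V (fun k => Q`_k); pose eta := heta g0 h0 U V (fun k => Q`_k).
pose Gam := \poly_(k < 3) gam k; pose Eta := \poly_(k < 3) eta k.
have [] := @jets R d.+2 a b 3 Q Gam Eta g0 h0 U V (fun h => upper (u0 + h))
  (fun h => rprod (fil true (u0 + h))) (fun h => rprod (fil false (u0 + h))) _
  sg0 sh0 bez _ _ _ _ _ _ _ _ _ => //.
- by rewrite abd.
- by rewrite coef_poly.
- by rewrite coef_poly.
- move=> k k0; rewrite coef_poly; case: ifP => _; last by rewrite size_poly0.
  exact: (size_hgam U V _ mg0 mh0 sg0 sh0 k0).
- move=> k k0; rewrite coef_poly; case: ifP => _; last by rewrite size_poly0.
  exact: (size_heta U V _ mg0 mh0 sg0 sh0 k0).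
- move=> k k3; rewrite -(hensel mg0 mh0 sg0 sh0 bez Q0 sQk k) coefM; apply: eq_bigr => i _.
  by rewrite !coef_poly (leq_ltn_trans (leq_ord i) k3) (leq_ltn_trans (leq_subr _ _) k3).
- by move=> h _; rewrite QE sfam_split.
- move=> h uh; apply: size_monic_sub; rewrite ?monic_rprod ?size_rprod //.
  by rewrite /a !size_fil_true.
- move=> h uh; apply: size_monic_sub; rewrite ?monic_rprod ?size_rprod //.
  by rewrite /b !size_fil_false.
- move=> eps eps0; have [del del0 H] := fil_cont d.+2 false u0H eps0.
  by exists del => // h _ hd; apply: H; rewrite addrC addKr.
move=> K K0 [del del0 H].
have uph h : cn h < Im u0 -> upper (u0 + h).
  move=> hlt; rewrite /upper ImD; have := le_lt_trans (Im_le_cn h) hlt.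
  by rewrite ltr_norml => /andP[h1 _]; rewrite addrC -ltrBlDr sub0r.
pose E k := if c then gam k else eta k.
exists (E 0%N).[0], (E 1%N).[0], (E 2%N).[0], K, (Num.min del (Im u0)); split.
  by rewrite lt_min del0.
move=> h; rewrite lt_min => /andP[hd /uph hu].
have [HG HH] := H h hu hd.
have S3 (E' : nat -> {poly C}) : (E' 0%N).[0] + (E' 1%N).[0] * h + (E' 2%N).[0] * h ^+ 2 =
    (\poly_(k < 3) E' k).[h%:P].[0].
  by rewrite horner_poly_sum !big_ord_recr big_ord0 /= add0r expr0 mulr1 expr1.
rewrite S3 /E; case: c E S3 => E S3.
  by rewrite -hornerN -hornerD horner_coef0 (le_trans _ HG) // cn_coef_le.
by rewrite -hornerN -hornerD horner_coef0 (le_trans _ HH) // cn_coef_le.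
Qed.

(** When u is near r, the selected roots are near some of the real roots at r. Which ones may depend
    on u, but there are finitely many choices, whence the common bound. *)
Lemma fil_boundary c (r : R) : exists B : R, forall eps : R, 0 < eps ->
  exists2 del : R, 0 < del & forall u, upper u -> cn (u - r%:C) < del ->
  exists rho : R, cn ((rprod (fil c u)).[0] - rho%:C) < eps /\ `|rho| <= B.
Proof.
have [B B0 HB] := pn_rprod_mask_bounded 1 (fb r%:C).
exists B => eps eps0.
have [dl dl0 H] := rprod_mask_close 1 (fb r%:C) eps0.
have [del del0 H'] := fib_close lam0 size_sfam lead_sfam r%:C dl0.
exists del => // u uH /H'[s ps al].
(* The mask records the selection at u and transports it to the matching roots at r. *)
pose m := map (fun z => sel u z == c) s.
have E : rprod (fil c u) = rprod (mask m s).
  apply: perm_rprod; rewrite -filter_mask perm_sym; exact: perm_filter.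
pose q := rprod (mask m (fb r%:C)).
have qr : Im q.[0] = 0.
  have : all (fun z : C => Im z == 0) (mask m (fb r%:C)).
    by apply/allP => z /mem_mask /fb_real ->.
  rewrite /q horner_rprod; elim: (mask _ _) => [|z t IH]; first by rewrite big_nil.
  move=> /= /andP[/eqP z0 /IH t0]; rewrite big_cons ImM t0 mulr0 add0r sub0r ImN z0.
  by rewrite oppr0 mul0r.
exists (Re q.[0]); rewrite -(Im_eq0_real qr); split.
  rewrite E -hornerN -hornerD horner_coef0; apply: le_lt_trans (H s m al).
  exact: cn_coef_le.
apply: (le_trans (Re_le_cn _)); rewrite horner_coef0; apply: le_trans (HB m).
exact: cn_coef_le.
Qed.

(** For a root z at u the quotient z / u is a root of f(x + u^-1 e + s e0), and for |u| >= 1 these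
    monic polynomials are uniformly bounded. *)
Lemma fil_growth c a : (forall u, upper u -> size (fil c u) = a) ->
  exists B : R, forall u, upper u -> 1 <= cn u -> cn (rprod (fil c u)).[0] <= B * cn u ^+ a.
Proof.
move=> sa; pose Q' := fam f (vC x) (vC e) (vC e0).
have [K K0 HK] := pn_horner_bounded d.+2 Q' (ler01 : 0 <= 1 :> R).
exists ((1 + K) ^+ a) => u uH u1.
have u0 := upper_neq0 uH.
have bz z : z \in fb u -> cn z <= (1 + K) * cn u.
  rewrite mem_fb => /eqP E.
  have E' : evC f (line (line (vC x) (vC e) u^-1) (vC e0) (z / u)) = 0.
    have : u ^+ d * evC f (line (line (vC x) (vC e) u^-1) (vC e0) (z / u)) = 0.
      by rewrite -(evC_scale _ _ hf) -E; apply: eq_evC => i; rewrite /line; field.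
    by move/eqP; rewrite mulf_eq0 expf_eq0 (negPf u0) andbF => /eqP.
  have rt : root Q'.[(u^-1)%:P] (z / u) by rewrite rootE fam_eval E'.
  have := monic_root_bound (ltnW (ltnSn d.+1)) (fam_size _ _ _ _ hf) _ rt.
  rewrite (fam_lead _ _ _ _ hf) => /(_ e0C).
  rewrite cnM cnV ler_pdivrMr ?cn_gt0 // => le1; apply: (le_trans le1).
  rewrite ler_wpM2r ?cn_ge0 // lerD2l; apply: HK.
  by rewrite cnV invf_le1 // cn_gt0.
rewrite -(sa u uH) -exprMn horner_rprod cn_prod /fil.
have : all (fun z => cn z <= (1 + K) * cn u) [seq z <- fb u | sel u z == c].
  by apply/allP => z; rewrite mem_filter => /andP[_ /bz].
elim: [seq _ <- _ | _] => [|z t IH] /=; first by rewrite big_nil expr0.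
case/andP=> h1 /IH h2; rewrite big_cons exprS sub0r cnN ler_pM ?cn_ge0 //.
by apply: prodr_ge0 => *; exact: cn_ge0.
Qed.

End FixedVector.
End Splitting.

(** * The real factors of f *)

Section Factorization.
Variables (R : realType) (n d : nat) (f : pol R n) (e0 e : 'I_n -> R).
Local Notation C := R[i].
Local Notation toC := (real_complex R).
Hypothesis hf : homog d f.
Hypothesis he0 : hyp f e0.
Hypothesis he : hyp f e.
Hypothesis f1 : evR f e0 = 1.

Let al : seq C := fb f e0 e (fun=> 0) 0.
Let alR : seq R := map (@complex.Re R) al.

Let fb0E x : fb f e0 e x 0 = al.
Proof.
rewrite /fb /al /fib; congr rts; rewrite /sfam !fam_horner; apply: eq_ev => i.
by rewrite /line /= /line !mul0r !addr0.
Qed.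

Let al_real : map toC alR = al.
Proof.
rewrite /alR -map_comp -[RHS]map_id; apply/eq_in_map => z zin /=.
apply/esym/Im_eq0_real; exact: (fb0_real hf he0 f1 zin).
Qed.

(** The factors of f(e + s e0) with its positive and its negative roots: the starting point of the
    Hensel lift, free of x. *)
Let gR (c : bool) : {poly R} := \prod_(r <- [seq r <- alR | (0 < r) == c]) ('X - r%:P).
Let a := count (fun r => 0 < r) alR.
Let b := count (fun r => ~~ (0 < r)) alR.

Let map_gR c x : map_poly toC (gR c) = rprod [seq z <- fb f e0 e x 0 | (0 < Re z) == c].
Proof.
rewrite fb0E -al_real filter_map /rprod big_map /gR rmorph_prod.
by apply: eq_bigr => r _; rewrite /= map_polyXsubC.
Qed.

Let sgT : size (gR true) = a.+1.
Proof.
rewrite /gR size_prod_XsubC size_filter; congr S.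
by apply: eq_count => r; rewrite eqb_id.
Qed.

Let sgF : size (gR false) = b.+1.
Proof.
rewrite /gR size_prod_XsubC size_filter; congr S.
by apply: eq_count => r; rewrite eqbF_neg.
Qed.

Let abd : (a + b)%N = d.
Proof. by rewrite /a /b count_predC size_map (size_fb e hf f1). Qed.

Let mg c : gR c \is monic. Proof. exact: monic_prod_XsubC. Qed.

Let bezR : exists UV : {poly R} * {poly R}, UV.1 * gR true + UV.2 * gR false = 1.
Proof.
apply/Bezout_eq1_coprimepP/coprimep_prod_XsubC => z.
by rewrite !mem_filter => /andP[/eqP-> _].
Qed.

Let QR (x : 'I_n -> R) : {poly {poly R}} := ev (fun r => r%:P%:P) f
    (fun i => (e i)%:P%:P + 'X * (x i)%:P%:P + 'X%:P * (e0 i)%:P%:P).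

Let map_QR x k : (sfam f e0 e x)`_k = map_poly toC (QR x)`_k.
Proof.
have -> : sfam f e0 e x = map_poly (map_poly toC) (QR x).
  rewrite /QR (ev_morph (map_poly (map_poly toC))) /sfam /fam /ev.
  apply: eq_bigr => m _; congr (_ * _); first by rewrite /= !map_polyC /= !map_polyC.
  apply: eq_bigr => i _; congr (_ ^+ _).
  by rewrite /= !rmorphD !rmorphM /= !map_polyC /= !map_polyC /= !map_polyX.
by rewrite coef_map.
Qed.

Let QR0 x : (QR x)`_0 = gR true * gR false.
Proof.
apply: (map_inj_poly (@complexI R) (rmorph0 toC)).
rewrite -map_QR -horner_coef0 -[0]polyC0 (sfamE e hf f1) rmorphM /= !(map_gR _ x) /rprod.
rewrite -big_cat /=; apply: perm_big; rewrite perm_sym.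
have -> : [seq z <- fb f e0 e x 0 | (0 < Re z) == true] = filter (fun z => 0 < Re z) (fb f e0 e x 0).
  by apply: eq_filter => z; rewrite eqb_id.
have -> : [seq z <- fb f e0 e x 0 | (0 < Re z) == false] =
    filter (predC (fun z => 0 < Re z)) (fb f e0 e x 0).
  by apply: eq_filter => z /=; rewrite eqbF_neg.
by rewrite perm_filterC.
Qed.

Let sQR x k : (0 < k)%N -> (size ((QR x)`_k)%R <= a + b)%N.
Proof.
move=> k0; rewrite -(size_map_poly toC) -map_QR abd.
exact: (size_family_coef (size_sfam e0 e hf x) (lead_sfam e hf f1 x)).
Qed.

Section Bezout.
Variables (U V : {poly R}).
Hypothesis bez : U * gR true + V * gR false = 1.

Let gam x k := hgam (gR true) (gR false) U V (fun k => (QR x)`_k) k.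
Let eta x k := heta (gR true) (gR false) U V (fun k => (QR x)`_k) k.

(** Liouville for each group. The jet at 0 is the Hensel lift carried out over the reals, hence
    real. *)
Let fil_value x u : upper u ->
  (rprod (fil f e0 e x true u)).[0] = jetsum (fun k => (gam x k).[0]) a.+1 u /\
  (rprod (fil f e0 e x false u)).[0] = jetsum (fun k => (eta x k).[0]) b.+1 u.
Proof.
move=> uH.
have jet N : exists2 K : R, 0 <= K & exists2 del : R, 0 < del &
    forall u, upper u -> cn u < del ->
    pn d.+2 (rprod (fil f e0 e x true u) -
      (\poly_(k < N.+1) map_poly toC (gam x k)).[u%:P]) <= K * cn u ^+ N.+1 /\
    pn d.+2 (rprod (fil f e0 e x false u) -
      (\poly_(k < N.+1) map_poly toC (eta x k)).[u%:P]) <= K * cn u ^+ N.+1.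
  apply: (@jets R d.+2 a b N.+1 (sfam f e0 e x) _ _ (map_poly toC (gR true))
    (map_poly toC (gR false)) (map_poly toC U) (map_poly toC V) (@upper R)).
  - by rewrite abd.
  - by rewrite size_map_poly sgT.
  - by rewrite size_map_poly sgF.
  - by rewrite -!rmorphM -rmorphD bez rmorph1.
  - by rewrite coef_poly.
  - by rewrite coef_poly.
  - move=> k k0; rewrite coef_poly; case: ifP => _; last by rewrite size_poly0.
    rewrite size_map_poly; exact: (size_hgam U V _ (mg true) (mg false) sgT sgF k0).
  - move=> k k0; rewrite coef_poly; case: ifP => _; last by rewrite size_poly0.
    rewrite size_map_poly; exact: (size_heta U V _ (mg true) (mg false) sgT sgF k0).
  - move=> k kN; rewrite map_QR.
    rewrite -(hensel (mg true) (mg false) sgT sgF bez (QR0 x) (sQR x) k).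
    rewrite coefM rmorph_sum; apply: eq_bigr => i _ /=.
    rewrite !coef_poly (leq_ltn_trans (leq_ord i) kN) (leq_ltn_trans (leq_subr _ _) kN).
    by rewrite rmorphM.
  - by move=> h _; rewrite (sfam_split e hf f1).
  - move=> h hH; apply: size_monic_sub; rewrite ?monic_rprod ?monic_map ?mg ?size_map_poly ?sgT //.
    rewrite size_rprod (size_fil_true hf he0 he f1) // fb0E; congr S.
    by rewrite /a /alR count_map.
  - move=> h hH; apply: size_monic_sub; rewrite ?monic_rprod ?monic_map ?mg ?size_map_poly ?sgF //.
    rewrite size_rprod (size_fil_false hf he0 he f1) // fb0E; congr S.
    by rewrite /b /alR count_map.
  - move=> eps eps0; have [del del0 H] := fil_cont0 hf he0 he f1 x d.+2 false eps0.
    by exists del => // h hH hd; rewrite (map_gR false x); exact: H.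
have jv (E : nat -> {poly R}) N v : (\poly_(k < N) map_poly toC (E k)).[v%:P].[0] =
    jetsum (fun k => (E k).[0]) N v.
  rewrite horner_poly_sum /jetsum; apply: eq_bigr => k _; congr (_ * _).
  by rewrite !horner_coef0 coef_map.
split.
- apply: (@liouville R (fun u => (rprod (fil f e0 e x true u)).[0])) => //.
  + by move=> v vH; exact: (fil_exp3 hf he0 he f1).
  + by move=> r; exact: (fil_boundary e hf he0 f1).
  + move=> N; have [K K0 [del del0 H]] := jet N; exists K, del; split=> // v vH vd.
    have [H1 _] := H v vH vd; rewrite -jv -hornerN -hornerD horner_coef0.
    by apply: le_trans H1; exact: cn_coef_le.
  + apply: (fil_growth hf f1) => v vH; rewrite (size_fil_true hf he0 he f1) // fb0E.
    by rewrite /a /alR count_map.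
- apply: (@liouville R (fun u => (rprod (fil f e0 e x false u)).[0])) => //.
  + by move=> v vH; exact: (fil_exp3 hf he0 he f1).
  + by move=> r; exact: (fil_boundary e hf he0 f1).
  + move=> N; have [K K0 [del del0 H]] := jet N; exists K, del; split=> // v vH vd.
    have [_ H1] := H v vH vd; rewrite -jv -hornerN -hornerD horner_coef0.
    by apply: le_trans H1; exact: cn_coef_le.
  + apply: (fil_growth hf f1) => v vH; rewrite (size_fil_false hf he0 he f1) // fb0E.
    by rewrite /b /alR count_map.
Qed.

(** At s = 0 the groups multiply to f(e + u x), and they are polynomials in u of degrees at most a
    and b; the coefficients at u^d are compared. *)
Let value x : evR f x = (gam x a)`_0 * (eta x b)`_0.
Proof.
pose L := ev (polyC \o id) f (line (polyC \o e) (polyC \o x) 'X).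
have [sL tL] := has_top_ev id e x hf.
pose pA := \poly_(k < a.+1) (gam x k).[0]; pose pB := \poly_(k < b.+1) (eta x k).[0].
have LE : L = pA * pB.
  apply: (map_inj_poly (@complexI R) (rmorph0 toC)).
  (* Infinitely many points of the upper half plane, where [fil_value] applies. *)
  pose g (m : nat) : C := 0 +i* m.+1%:R.
  have ig : injective g by move=> m m' [] /eqP; rewrite eqr_nat => /eqP [].
  apply: (poly_eq_on_seq ig) => m; set u := g m.
  have uH : upper u by rewrite /upper /= ltr0n.
  have pE (E : nat -> R) N : (map_poly toC (\poly_(k < N) E k)).[u] = jetsum E N u.
    rewrite (@horner_coef_wide _ N); last by rewrite size_map_poly size_poly.
    by apply: eq_bigr => k _; rewrite coef_map coef_poly ltn_ord.
  have [v1 v2] := fil_value x uH.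
  rewrite rmorphM hornerM /= !pE -v1 -v2 -hornerM -(sfam_split e hf f1) fam_eval.
  rewrite /L (ev_morph (map_poly toC)) -[_.[_]]/(horner_eval u _) ev_morph /evC /ev.
  apply: eq_bigr => k _; rewrite /= map_polyC horner_evalE hornerC; congr (_ * _).
  apply: eq_bigr => i _; congr (_ ^+ _).
  rewrite /= horner_evalE /line /= rmorphD rmorphM /= !map_polyC map_polyX.
  by rewrite !(hornerD, hornerM, hornerX, hornerC) mul0r addr0 mulrC.
have tA : has_top a pA (gam x a)`_0.
  by split; rewrite ?size_poly // coef_poly ltnSn horner_coef0.
have tB : has_top b pB (eta x b)`_0.
  by split; rewrite ?size_poly // coef_poly ltnSn horner_coef0.
have [_] := has_topM tA tB; rewrite -LE abd => <-.
by rewrite /evR -tL.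
Qed.

(** A Hensel step is linear in the residual with coefficients free of x, and the residual is a form
    of degree k by induction. *)
Let gam_hpoly k : (forall j, hpoly k (fun x => (gam x k)`_j)) /\
                  (forall j, hpoly k (fun x => (eta x k)`_j)).
Proof.
elim/ltn_ind: k => k IH; case: k IH => [|k] IH.
  by split=> j; [exact: (hpolyC n (gR true)`_j) | exact: (hpolyC n (gR false)`_j)].
have hr j : hpoly k.+1 (fun x =>
    (hres (gR true) (gR false) U V (fun k => (QR x)`_k) k.+1)`_j).
  have h1 := graded_ev f e0 e k.+1 j.
  have h2 : hpoly k.+1 (fun x => \sum_(1 <= i < k.+1 | (1 <= i < k.+1)%N)
       \sum_(l < j.+1) (gam x i)`_l * (eta x (k.+1 - i))`_(j - l)).
    apply: hpoly_sum => i /andP[i1 ik]; apply: hpoly_sum => l _.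
    have hi : hpoly (i + (k.+1 - i)) (fun x => (gam x i)`_l * (eta x (k.+1 - i))`_(j - l)).
      apply: hpolyM; first by case: (IH i ik).
      have lt : (k.+1 - i < k.+1)%N by rewrite ltn_subrL i1.
      by case: (IH _ lt).
    by rewrite subnKC in hi; last exact: ltnW.
  apply: eq_hpoly (hpolyD h1 (hpolyN h2)) => x.
  rewrite /hres coefB [in RHS]big_nat_cond; congr (_ - _); rewrite coef_sum.
  by apply: eq_big => i; rewrite ?andbT // => _; rewrite coefM.
have lin (W g : {poly R}) j :
    hpoly k.+1 (fun x => ((W * hres (gR true) (gR false) U V (fun k => (QR x)`_k) k.+1) %% g)`_j).
  pose L (p : {poly R}) := (W * p) %% g.
  have LD : {morph L : p q / p + q} by move=> p q; rewrite /L mulrDr modpD.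
  have LZ c p : L (c *: p) = c *: L p by rewrite /L -scalerAr modpZl.
  have h3 : hpoly k.+1 (fun x => \sum_(i < d) (L 'X^i)`_j *
      (hres (gR true) (gR false) U V (fun k => (QR x)`_k) k.+1)`_i).
    by apply: hpoly_sum => i _; apply: hpolyZ.
  apply: eq_hpoly h3 => x; rewrite -/(L _) (linear_expand LD LZ (D := d)).
    by rewrite coef_sum; apply: eq_bigr => i _; rewrite coefZ mulrC.
  by rewrite -abd; exact: (size_hres U V (mg true) (mg false) sgT sgF (sQR x)).
split=> j.
  apply: eq_hpoly (lin V (gR true) j) => x.
  by rewrite /gam (hgamE U V _ (mg true) (mg false) sgT sgF).
apply: eq_hpoly (lin U (gR false) j) => x.
by rewrite /eta (hetaE U V _ (mg true) (mg false) sgT sgF).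
Qed.

Lemma factor_bezout : exists g h : pol R n, [/\ homog a g, homog b h &
  forall x, evR f x = evR g x * evR h x].
Proof.
have [hg _] := gam_hpoly a; have [_ hh] := gam_hpoly b.
have [g hg' gE] := hg 0%N; have [h hh' hE] := hh 0%N.
by exists g, h; split=> // x; rewrite value gE hE.
Qed.

End Bezout.

(** The roots r and s make both groups non-empty, hence both factors of positive degree. *)
Lemma factor_monic (r s : R) : 0 < r -> s < 0 ->
  evR f (line e e0 r) = 0 -> evR f (line e e0 s) = 0 ->
  exists a' b' : nat, [/\ (0 < a')%N, (0 < b')%N, (a' + b')%N = d &
    exists g h : pol R n, [/\ homog a' g, homog b' h &
      forall x, evR f x = evR g x * evR h x]].
Proof.
move=> r0 s0 fr fs.
have mem_alR t : evR f (line e e0 t) = 0 -> t \in alR.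
  move=> ft; apply/mapP; exists t%:C => //; rewrite /al (mem_fb e hf f1); apply/eqP.
  have ftC : evC f (line (vC e) (vC e0) t%:C) = 0 by rewrite evC_line_real ft rmorph0.
  rewrite -[RHS]ftC; apply: eq_evC => i.
  by rewrite /line /vC rmorph0 mulr0 addr0.
exists a, b; split=> //.
- by rewrite /a -has_count; apply/hasP; exists r; first exact: mem_alR.
- by rewrite /b -has_count; apply/hasP; exists s; [exact: mem_alR | rewrite -leNgt ltW].
have [[U V] /= bez] := bezR; exact: factor_bezout bez.
Qed.

End Factorization.

(** * Regions of a central hyperplane arrangement *)

Section Bound.

(** The number of regions of m central hyperplanes in general position in dimension r; the value 1
    at m = 0 starts the recursion [region_boundS]. *)
Definition region_bound (r m : nat) : nat :=
  (if m is m'.+1 then 2 * \sum_(k < r) 'C(m', k) else 1)%N.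

(** Pascal's rule; the summands are the bounds for deletion and restriction. *)
Lemma region_boundS r m :
  region_bound r.+1 m.+1 = (region_bound r.+1 m + region_bound r m)%N.
Proof.
case: m => [|m] /=.
  by rewrite big_ord_recl bin0 big1 // => i _; rewrite bin0n.
rewrite -mulnDr; congr (2 * _)%N.
rewrite big_ord_recl bin0 [X in _ = (X + _)%N]big_ord_recl bin0 -addnA; congr (1 + _)%N.
by rewrite -big_split /=; apply: eq_bigr => i _; rewrite /bump /= add1n binS.
Qed.

Lemma region_bound_mono r m m' : (0 < m <= m')%N -> (region_bound r m <= region_bound r m')%N.
Proof.
case: m m' => [|m] [|m'] //=; rewrite ltnS => le; rewrite leq_pmul2l //.
by apply: leq_sum => k _; exact: leq_bin2l.
Qed.

Lemma region_bound_lt r m m' : (1 < r)%N -> (0 < m < m')%N ->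
  (region_bound r m < region_bound r m')%N.
Proof.
case: r m m' => [|[|r]] [|m] [|m'] //= _; rewrite ltnS => le; rewrite ltn_pmul2l //.
rewrite !big_ord_recl !bin0 /bump /= !bin1 ltn_add2l -addSn leq_add //.
by apply: leq_sum => k _; apply: leq_bin2l; exact: ltnW.
Qed.

End Bound.

Section Arrangement.
Variable R : realFieldType.

Definition realizes r m (M : 'M[R]_(r, m)) (s : {ffun 'I_m -> bool}) (x : 'rV[R]_r) :=
  forall i, if s i then 0 < (x *m M) 0 i else (x *m M) 0 i < 0.

(** The columns of [M] are the linear forms, and a region is encoded by its sign vector. *)
Definition regions r m (M : 'M[R]_(r, m)) : {set {ffun 'I_m -> bool}} :=
  [set s | `[< exists x, realizes M s x >]].

Definition indep k r m (M : 'M[R]_(r, m)) :=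
  forall s : 'I_k -> 'I_m, injective s ->
    forall lam : 'cV[R]_k, colsub s M *m lam = 0 -> lam = 0.

Definition gen_pos r m (M : 'M[R]_(r, m)) := indep (minn r m) M.

Definition sext m (b : bool) (t : {ffun 'I_m -> bool}) : {ffun 'I_m.+1 -> bool} :=
  [ffun i => if unlift ord0 i is Some j then t j else b].

Lemma sext0 m b (t : {ffun 'I_m -> bool}) : sext b t ord0 = b.
Proof. by rewrite ffunE unlift_none. Qed.

Lemma sextS m b (t : {ffun 'I_m -> bool}) j : sext b t (lift ord0 j) = t j.
Proof. by rewrite ffunE liftK. Qed.

Lemma sext_inj m b : injective (@sext m b).
Proof. by move=> t t' /ffunP E; apply/ffunP => j; have := E (lift ord0 j); rewrite !sextS. Qed.

Lemma card_split m (S : {set {ffun 'I_m.+1 -> bool}}) :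
  #|S| = (#|[set t | sext true t \in S]| + #|[set t | sext false t \in S]|)%N.
Proof.
have E b : [set s in S | s ord0 == b] = [set sext b t | t in [set t | sext b t \in S]].
  apply/setP => s; apply/idP/imsetP => [|[t]]; rewrite inE.
    case/andP=> sS /eqP sb; exists [ffun j => s (lift ord0 j)].
      rewrite inE; suff -> : sext b [ffun j => s (lift ord0 j)] = s by [].
      apply/ffunP => i; rewrite ffunE; case: unliftP => [j ->|->]; by rewrite ?ffunE.
    apply/ffunP => i; rewrite ffunE; case: unliftP => [j ->|->]; by rewrite ?ffunE.
  by move=> tS ->; rewrite inE tS sext0 eqxx.
rewrite -(card_imset _ (@sext_inj m true)) -(card_imset _ (@sext_inj m false)) -!E.
rewrite -(cardsID [set s : {ffun 'I_m.+1 -> bool} | s ord0 == true] S); congr addn; apply: eq_card => s.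
  by rewrite !inE.
by rewrite !inE; case: (s ord0); rewrite ?andbT ?andbF.
Qed.

Section Step.
Variables (r m : nat) (M : 'M[R]_(r.+1, m.+1)).
Local Notation c := (col ord0 M).
Local Notation M' := (col' ord0 M).
Hypothesis c0 : c != 0.

Lemma col0E (x : 'rV_r.+1) : (x *m M) 0 ord0 = (x *m c) 0 0.
Proof. by rewrite !mxE; apply: eq_bigr => i _; rewrite mxE. Qed.

Lemma col'E (x : 'rV_r.+1) j : (x *m M) 0 (lift ord0 j) = (x *m M') 0 j.
Proof. by rewrite !mxE; apply: eq_bigr => i _; rewrite mxE. Qed.

Lemma realizes_sext b t x : realizes M (sext b t) x <->
  (if b then 0 < (x *m c) 0 0 else (x *m c) 0 0 < 0) /\ realizes M' t x.
Proof.
split=> [H|[H1 H2] i].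
  split; first by have := H ord0; rewrite sext0 col0E.
  by move=> j; have := H (lift ord0 j); rewrite sextS col'E.
case: (unliftP ord0 i) => [j ->|->]; first by rewrite sextS col'E; exact: H2.
by rewrite sext0 col0E.
Qed.

Lemma col_dual : exists y : 'rV_r.+1, (y *m c) 0 0 = 1.
Proof.
have [i ci] : exists i, c i 0 != 0.
  apply/existsP; apply: contraNT c0; rewrite negb_exists => /forallP H.
  by apply/eqP/matrixP => i j; rewrite [j]ord1 [RHS]mxE; apply/eqP; have := H i; rewrite negbK.
exists ((c i 0)^-1 *: delta_mx 0 i); by rewrite -scalemxAl -rowE [LHS]mxE [row _ _ _ _]mxE mulVf.
Qed.

Lemma comb_mulmx k (N : 'M[R]_(r.+1, k)) (a b : R) (x y : 'rV_r.+1) j :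
  ((a *: x + b *: y) *m N) 0 j = a * (x *m N) 0 j + b * (y *m N) 0 j.
Proof. by rewrite mulmxDl -!scalemxAl [LHS]mxE [in X in X + _]mxE [in X in _ + X]mxE. Qed.

Lemma addZ_mulmx k (N : 'M[R]_(r.+1, k)) (b : R) (x y : 'rV_r.+1) j :
  ((x + b *: y) *m N) 0 j = (x *m N) 0 j + b * (y *m N) 0 j.
Proof. by rewrite -{1}[x]scale1r comb_mulmx mul1r. Qed.

Lemma perturb t x (y : 'rV_r.+1) : realizes M' t x ->
  exists2 eps : R, 0 < eps & forall b : bool, realizes M' t (x + (if b then eps else - eps) *: y).
Proof.
(* A step times [q j] must stay below 1 to preserve the sign of form j; the inverse of 1 plus the
   sum does this for all j. *)
move=> H; pose q j := `|(y *m M') 0 j| / `|(x *m M') 0 j|.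
have q0 j : 0 <= q j by rewrite divr_ge0.
have s0 : 0 < 1 + \sum_j q j by rewrite ltr_wpDr // sumr_ge0.
have ltj j : `|(y *m M') 0 j| / (1 + \sum_j q j) < `|(x *m M') 0 j|.
  have xj : (x *m M') 0 j != 0 by have := H j; case: (t j) => h; rewrite ?(gt_eqF h) ?(lt_eqF h).
  have nx : 0 < `|(x *m M') 0 j| by rewrite normr_gt0.
  rewrite ltr_pdivrMr // mulrC -ltr_pdivrMr // -/(q j) (bigD1 j) //= addrCA.
  by rewrite ltrDl ltr_wpDr // sumr_ge0.
pose w := (1 + \sum_j q j)^-1.
have w0 : 0 < w by rewrite invr_gt0.
exists w => // b j; rewrite addZ_mulmx.
have := ltj j; have := H j; rewrite -/w; move: ((x *m M') 0 j) ((y *m M') 0 j) => X Y.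
have -> : (if b then w else - w) * Y = if b then w * Y else - (w * Y).
  by case: b => //; rewrite mulNr.
have -> : `|Y| * w = `|w * Y| by rewrite normrM (gtr0_norm w0) mulrC.
move: (w * Y) => Z.
case: (t j) => hX; rewrite ?(gtr0_norm hX) ?(ltr0_norm hX) ltr_norml => /andP[h1 h2];
  case: b; lra.
Qed.

(** A region of the deletion is open, so it contains points off the hyperplane of c and extends with
    at least one sign. *)
Lemma union_regions :
  [set t | sext true t \in regions M] :|: [set t | sext false t \in regions M] = regions M'.
Proof.
apply/setP => t; rewrite !inE; apply/orP/asboolP.
  by case=> /asboolP[x /realizes_sext[_ H]]; exists x.
case=> x H; have [y yc] := col_dual; have [eps eps0 Hp] := perturb y H.
have [neg|pos|zero] := ltgtP ((x *m c) 0 0) 0.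
- by right; apply/asboolP; exists x; apply/realizes_sext; split.
- by left; apply/asboolP; exists x; apply/realizes_sext; split.
- left; apply/asboolP; exists (x + eps *: y); apply/realizes_sext; split; last exact: (Hp true).
  by rewrite addZ_mulmx zero yc mulr1 add0r.
Qed.

Variable K : 'M[R]_(r, r.+1).
Hypothesis Kc : K *m c = 0.
Hypothesis Kspan : forall z : 'rV_r.+1, z *m c = 0 -> exists w, z = w *m K.

(** A region of the deletion meets both sides of the hyperplane of c exactly when the hyperplane
    cuts it; the cut is a region of the restriction, in the coordinates given by the rows of [K]. *)
Lemma inter_regions :
  [set t | sext true t \in regions M] :&: [set t | sext false t \in regions M]
    = regions (K *m M').
Proof.
apply/setP => t; rewrite !inE; apply/andP/asboolP.
  case=> /asboolP[x /realizes_sext[xc Hx]] /asboolP[y /realizes_sext[yc Hy]].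
  (* The point where the segment from x to y crosses the hyperplane, up to a positive factor. *)
  pose z := (- (y *m c) 0 0) *: x + (x *m c) 0 0 *: y.
  have zc : z *m c = 0.
    by apply/matrixP => i j; rewrite (ord1 i) (ord1 j) /z comb_mulmx [RHS]mxE; ring.
  have [w zw] := Kspan zc; exists w => j; rewrite mulmxA -zw /z comb_mulmx.
  have ypos : 0 < - (y *m c) 0 0 by rewrite oppr_gt0.
  have := Hx j; have := Hy j; case: (t j) => h1 h2; first by rewrite addr_gt0 ?mulr_gt0.
  by rewrite -oppr_gt0 opprD -!mulrN addr_gt0 ?mulr_gt0 ?oppr_gt0.
case=> w Hw; have Hx : realizes M' t (w *m K).
  by move=> j; have := Hw j; rewrite mulmxA.
have [y yc] := col_dual; have [eps eps0 Hp] := perturb y Hx.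
have xc : (w *m K *m c) 0 0 = 0 by rewrite -mulmxA Kc mulmx0 mxE.
split; apply/asboolP.
  exists (w *m K + eps *: y); apply/realizes_sext; split; last exact: (Hp true).
  by rewrite addZ_mulmx xc yc mulr1 add0r.
exists (w *m K + (- eps) *: y); apply/realizes_sext; split; last exact: (Hp false).
by rewrite addZ_mulmx xc yc mulr1 add0r oppr_lt0.
Qed.

Lemma card_regions : #|regions M| = (#|regions M'| + #|regions (K *m M')|)%N.
Proof. by rewrite card_split -cardsUI union_regions inter_regions. Qed.

(** A hyperplane determines its form up to a scalar. In [gen_pos_step] this lifts a dependence among
    restrictions to one that involves c. *)
Lemma annihilator (v : 'cV[R]_r.+1) : K *m v = 0 -> exists mu, v = mu *: c.
Proof.
move=> Kv; have [y yc] := col_dual; exists ((y *m v) 0 0).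
apply/matrixP => i j; rewrite [j]ord1 [RHS]mxE.
pose z : 'rV_r.+1 := delta_mx 0 i + (- c i 0) *: y.
have zE k (N : 'M_(r.+1, k)) l : (z *m N) 0 l = N i l + (- c i 0) * (y *m N) 0 l.
  by rewrite addZ_mulmx -rowE [row _ _ _ _]mxE.
have zc : z *m c = 0.
  by apply/matrixP => i' j'; rewrite [i']ord1 [j']ord1 zE yc mulr1 subrr [RHS]mxE.
have [w zw] := Kspan zc.
have : (z *m v) 0 0 = 0 by rewrite zw -mulmxA Kv mulmx0 mxE.
by rewrite zE mulNr => /eqP; rewrite subr_eq0 mulrC => /eqP.
Qed.

Definition scons k (s : 'I_k -> 'I_m) (j : 'I_k.+1) : 'I_m.+1 :=
  if unlift ord0 j is Some j' then lift ord0 (s j') else ord0.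

Definition vcons k (mu : R) (lam : 'cV[R]_k) : 'cV[R]_k.+1 :=
  \col_j (if unlift ord0 j is Some j' then lam j' 0 else mu).

Lemma scons_inj k (s : 'I_k -> 'I_m) : injective s -> injective (scons s).
Proof.
move=> inj j j'; rewrite /scons.
case: (unliftP ord0 j) => [i ->|->]; case: (unliftP ord0 j') => [i' ->|->] //.
by move/lift_inj/inj->.
Qed.

Lemma colsub_sum k p q (s : 'I_k -> 'I_q) (N : 'M[R]_(p, q)) (lam : 'cV_k) :
  colsub s N *m lam = \sum_j lam j 0 *: col (s j) N.
Proof.
apply/matrixP => i j; rewrite [j]ord1 mxE summxE; apply: eq_bigr => l _.
by rewrite !mxE mulrC.
Qed.

Lemma col_lift j : col (lift ord0 j) M = col j M'.
Proof. by apply/matrixP => i l; rewrite !mxE. Qed.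

Lemma colsub_cons k (s : 'I_k -> 'I_m) mu (lam : 'cV_k) :
  colsub (scons s) M *m vcons mu lam = mu *: c + colsub s M' *m lam.
Proof.
rewrite !colsub_sum big_ord_recl /scons /vcons mxE unlift_none; congr (_ + _).
by apply: eq_bigr => j _; rewrite mxE liftK col_lift.
Qed.

Lemma vcons_eq0 k mu (lam : 'cV_k) : vcons mu lam = 0 -> mu = 0 /\ lam = 0.
Proof.
move=> /matrixP E; split; first by have := E ord0 0; rewrite !mxE unlift_none.
by apply/matrixP => i j; rewrite [j]ord1; have := E (lift ord0 i) 0; rewrite !mxE liftK.
Qed.

(** Independent families containing c correspond to independent families of restrictions, the others
    to the deletion. If m > r the deletion already concerns r + 1 forms at a time; if m <= r it
    concerns all m forms, and c completes them to a family for [M]. *)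
Lemma gen_pos_step : gen_pos M <-> gen_pos M' /\ gen_pos (K *m M').
Proof.
rewrite /gen_pos minnSS; split=> [H|[H1 H2] s inj lam E].
  split=> s inj lam E.
    have [lemr|ltrm] := leqP m r.
      have e1 : minn r.+1 m = minn r m by rewrite !(minn_idPr _) // ltnW.
      move: s inj lam E; rewrite e1 => s inj lam E.
      have := H _ (scons_inj inj) (vcons 0 lam).
      by rewrite colsub_cons scale0r add0r E => /(_ erefl) /vcons_eq0[].
    have e1 : minn r.+1 m = (minn r m).+1.
      by rewrite (minn_idPl _) // (minn_idPl _) // ltnW.
    move: s inj lam E; rewrite e1 => s inj lam E.
    apply: (H (lift ord0 \o s)); first by move=> i j /= /lift_inj/inj.
    rewrite -[RHS]E !colsub_sum; apply: eq_bigr => j _.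
    by rewrite /= col_lift.
  have /annihilator[mu Ev] : K *m (colsub s M' *m lam) = 0.
    rewrite -E mulmxA; congr (_ *m _); apply/matrixP => i j; rewrite !mxE.
    by apply: eq_bigr => l _; rewrite !mxE.
  have := H _ (scons_inj inj) (vcons (- mu) lam).
  by rewrite colsub_cons Ev -scalerDl addNr scale0r => /(_ erefl) /vcons_eq0[].
have [/existsP[j0 /eqP sj0]|] := boolP [exists j, s j == ord0].
  have nz j : unlift ord0 (s (lift j0 j)) != None.
    case: unliftP => // E0; have : s (lift j0 j) = s j0 by rewrite E0 sj0.
    by move/inj/eqP; rewrite eq_sym (negPf (neq_lift _ _)).
  have s'P j : {i | s (lift j0 j) = lift ord0 i}.
    by have := nz j; case: (unliftP ord0 (s (lift j0 j))) => // i E0 _; exists i.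
  pose s' j := sval (s'P j); have s'E j : s (lift j0 j) = lift ord0 (s' j) := svalP (s'P j).
  have inj' : injective s'.
    by move=> i j E0; apply: (@lift_inj _ j0); apply: inj; rewrite !s'E E0.
  pose lam' : 'cV_(minn r m) := \col_j lam (lift j0 j) 0.
  have ES : lam j0 0 *: c + colsub s' M' *m lam' = 0.
    rewrite -E !colsub_sum (bigD1_ord j0) //= sj0; congr (_ + _).
    by apply: eq_bigr => j _; rewrite mxE s'E col_lift.
  have l'0 : lam' = 0.
    apply: (H2 s' inj').
    have : K *m (lam j0 0 *: c + colsub s' M' *m lam') = 0 by rewrite ES mulmx0.
    rewrite mulmxDr -scalemxAr Kc scaler0 add0r mulmxA => <-; congr (_ *m _).
    by apply/matrixP => i j; rewrite !mxE; apply: eq_bigr => l _; rewrite !mxE.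
  have lj0 : lam j0 0 = 0.
    move: ES; rewrite l'0 mulmx0 addr0 => /eqP; rewrite scaler_eq0 (negPf c0) orbF.
    by move/eqP.
  apply/matrixP => i j; rewrite [j]ord1 [RHS]mxE.
  case: (unliftP j0 i) => [i' ->|->] //.
  by have /matrixP/(_ i' 0) := l'0; rewrite !mxE.
rewrite negb_exists => /forallP nz.
have s'P j : {i | s j = lift ord0 i}.
  have := nz j; case: (unliftP ord0 (s j)) => [i E0 _|->]; first by exists i.
  by rewrite eqxx.
pose s' j := sval (s'P j); have s'E j : s j = lift ord0 (s' j) := svalP (s'P j).
have inj' : injective s' by move=> i j E0; apply: inj; rewrite !s'E E0.
(* More than [minn r m] distinct columns avoid c, so r < m. *)
have ltm : (minn r m < m)%N.
  by have := leq_card _ inj'; rewrite !card_ord.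
have e1 : minn r.+1 m = (minn r m).+1.
  have lt : (r < m)%N by move: ltm; rewrite gtn_min ltnn orbF.
  by rewrite (minn_idPl _) // (minn_idPl _) // ltnW.
move: H1; rewrite e1 => H1; apply: (H1 s' inj').
rewrite -[RHS]E !colsub_sum; apply: eq_bigr => j _; by rewrite s'E col_lift.
Qed.

End Step.

Lemma kernel_basis r (c : 'cV[R]_r.+1) : c != 0 -> exists K : 'M[R]_(r, r.+1),
  K *m c = 0 /\ forall z : 'rV_r.+1, z *m c = 0 -> exists w, z = w *m K.
Proof.
move=> c0; have rk : \rank (kermx c) = r.
  rewrite mxrank_ker -mxrank_tr; have -> : \rank c^T = 1%N.
    by rewrite rank_rV trmx_eq0 c0.
  by rewrite subn1.
have : exists K : 'M[R]_(\rank (kermx c), r.+1),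
  K *m c = 0 /\ forall z : 'rV_r.+1, z *m c = 0 -> exists w, z = w *m K.
  exists (row_base (kermx c)); split.
    by apply: sub_kermxP; rewrite eq_row_base.
  move=> z /sub_kermxP; rewrite -(eq_row_base (kermx c)) => /submxP[w ->].
  by exists w.
by rewrite rk.
Qed.

Lemma region_bound_gt0 r m : (0 < region_bound r.+1 m)%N.
Proof. by case: m => //= m; rewrite muln_gt0 big_ord_recl bin0. Qed.

(** A zero column leaves no region and destroys general position. Otherwise the bounds for deletion
    and restriction add up, and their sum is attained only if both are. *)
Theorem regions_bound m r (M : 'M[R]_(r, m)) :
  (#|regions M| <= region_bound r m)%N /\
  (#|regions M| = region_bound r m <-> gen_pos M).
Proof.
elim: m r M => [|m IH] r M.
  have -> : regions M = finset.setT.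
    by apply/setP => s; rewrite !inE; apply/asboolP; exists 0 => -[].
  rewrite cardsT card_ffun card_bool card_ord expn0; split=> //; split=> // _.
  rewrite /gen_pos minn0 => s _ lam _; by apply/matrixP => -[].
case: r M => [|r] M.
  have -> : regions M = finset.set0.
    apply/setP => s; rewrite !inE; apply/asboolP => -[x] /(_ ord0).
    by rewrite mxE big_ord0 ltxx; case: ifP.
  rewrite cards0 /= big_ord0 muln0; split=> //; split=> // _.
  rewrite /gen_pos min0n => s _ lam _; by apply/matrixP => -[].
have [c0|c0] := eqVneq (col ord0 M) 0.
  have -> : regions M = finset.set0.
    apply/setP => s; rewrite !inE; apply/asboolP => -[x] /(_ ord0).
    by rewrite col0E c0 mulmx0 mxE ltxx; case: ifP.
  rewrite cards0; split=> //; split=> [/esym /eqP|].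
    by rewrite -leqn0 leqNgt region_bound_gt0.
  rewrite /gen_pos minnSS => H; exfalso.
  pose s (j : 'I_(minn r m).+1) : 'I_m.+1 := inord j.
  have inj : injective s.
    move=> i j /(congr1 val); rewrite /= !inordK => [/val_inj //||].
      by rewrite (leq_trans (ltn_ord j)) // ltnS geq_minr.
    by rewrite (leq_trans (ltn_ord i)) // ltnS geq_minr.
  have := H s inj (delta_mx ord0 0); rewrite -colE => /(_ _) /matrixP/(_ ord0 0).
  rewrite !mxE !eqxx => E; suff /E/eqP : col ord0 (colsub s M) = 0 by rewrite oner_eq0.
  rewrite -c0; apply/matrixP => i j; rewrite !mxE; congr (M _ _).
  by apply: val_inj; rewrite /= inordK.
have [K [Kc Kspan]] := kernel_basis c0.
rewrite (card_regions c0 Kc Kspan) region_boundS (gen_pos_step c0 Kc Kspan).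
have [le1 iff1] := IH _ (col' ord0 M); have [le2 iff2] := IH _ (K *m col' ord0 M).
split; first exact: leq_add.
rewrite -iff1 -iff2; split=> [E|[-> ->]//].
have [_] := leqif_add (leqif_eq le1) (leqif_eq le2).
by rewrite E eqxx => /esym/andP[/eqP-> /eqP->].
Qed.

End Arrangement.

(** * Counting hyperbolicity cones *)

Section Atoms.
Variables (R : realType) (n : nat).
Local Notation C := R[i].
Local Notation toC := (real_complex R).
Local Notation vec := ('I_n -> R).
Implicit Types (f g h p : pol R n) (x y e : vec).

Definition lpol f x y : {poly R} := ev (polyC \o id) f (line (polyC \o x) (polyC \o y) 'X).

Lemma lpolE f x y t : (lpol f x y).[t] = evR f (line x y t).
Proof.
rewrite /lpol -[_.[_]]/(horner_eval t _) ev_morph /evR /ev.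
apply: eq_bigr => m _; rewrite /= horner_evalE hornerC; congr (_ * _).
apply: eq_bigr => i _; congr (_ ^+ _).
by rewrite /= horner_evalE /line /= !(hornerD, hornerM, hornerX, hornerC).
Qed.

Lemma lpolCE f x y (t : C) : (map_poly toC (lpol f x y)).[t] = evC f (line (vC x) (vC y) t).
Proof.
rewrite /lpol (ev_morph (map_poly toC)) -[_.[_]]/(horner_eval t _) ev_morph /evC /ev.
apply: eq_bigr => m _; rewrite /= map_polyC horner_evalE hornerC; congr (_ * _).
apply: eq_bigr => i _; congr (_ ^+ _).
rewrite /= horner_evalE /line /= rmorphD rmorphM /= !map_polyC map_polyX.
by rewrite !(hornerD, hornerM, hornerX, hornerC).
Qed.

Lemma natR_inj : injective (fun m : nat => m%:R : R).
Proof. by move=> m m' /eqP; rewrite eqr_nat => /eqP. Qed.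

(** For z = x + i y both sides restrict to polynomials in t on the line x + t y; these agree at
    infinitely many real t, hence at t = i. *)
Lemma evC_prod f (c : R) (ps : seq (pol R n)) :
  (forall x, evR f x = c * \prod_(p <- ps) evR p x) ->
  forall z, evC f z = c%:C * \prod_(p <- ps) evC p z.
Proof.
move=> E z; pose x : vec := fun i => Re (z i); pose y : vec := fun i => Im (z i).
have zE : z =1 line (vC x) (vC y) 'i.
  by move=> i; apply: complex_ext; rewrite /line ?(ReD, ImD, ReM, ImM) /=; ring.
have LE : lpol f x y = c%:P * \prod_(p <- ps) lpol p x y.
  apply: (poly_eq_on_seq natR_inj) => m.
  rewrite lpolE E hornerM hornerC horner_prod; congr (_ * _).
  by apply: eq_bigr => p _; rewrite lpolE.
rewrite (eq_evC _ zE) -lpolCE LE rmorphM rmorph_prod /= hornerM map_polyC hornerC.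
rewrite horner_prod; congr (_ * _); apply: eq_bigr => p _.
by rewrite lpolCE; apply/esym/eq_evC.
Qed.

Definition scale_pol (c : R) f : pol R n := [seq (c * m.1, m.2) | m <- f].

Lemma evR_scale_pol c f x : evR (scale_pol c f) x = c * evR f x.
Proof.
rewrite /evR /ev big_map mulr_sumr; apply: eq_bigr => m _ /=.
by rewrite mulrA.
Qed.

Lemma homog_scale_pol c d f : homog d f -> homog d (scale_pol c f).
Proof. by rewrite /homog all_map. Qed.

Lemma evC_scale_pol c f z : evC (scale_pol c f) z = c%:C * evC f z.
Proof.
rewrite (@evC_prod (scale_pol c f) c [:: f]) ?big_seq1 // => x.
by rewrite big_seq1 evR_scale_pol.
Qed.

Lemma hyp_scale_pol c f e : c != 0 -> hyp f e -> hyp (scale_pol c f) e.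
Proof.
move=> c0 [fe he]; split; first by rewrite evR_scale_pol mulf_neq0.
move=> x t; rewrite evC_scale_pol => /eqP; rewrite mulf_eq0 realC_eq0 (negPf c0) /=.
by move/eqP/he.
Qed.

Lemma factor d f e0 e (r s : R) : homog d f -> hyp f e0 -> hyp f e ->
  0 < r -> s < 0 -> evR f (line e e0 r) = 0 -> evR f (line e e0 s) = 0 ->
  exists a b : nat, [/\ (0 < a)%N, (0 < b)%N, (a + b)%N = d &
    exists g h : pol R n, [/\ homog a g, homog b h &
      forall x, evR f x = evR g x * evR h x]].
Proof.
move=> hf he0 he r0 s0 fr fs; have c0 : evR f e0 != 0 by case: he0.
set c := evR f e0 in c0; have ci0 : c^-1 != 0 by rewrite invr_eq0.
have f1 : evR (scale_pol c^-1 f) e0 = 1 by rewrite evR_scale_pol mulVf.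
have [||a [b [a0 b0 abd [g [h [hg hh E]]]]]] := factor_monic (homog_scale_pol c^-1 hf)
  (hyp_scale_pol ci0 he0) (hyp_scale_pol ci0 he) f1 r0 s0.
- by rewrite evR_scale_pol fr mulr0.
- by rewrite evR_scale_pol fs mulr0.
exists a, b; split=> //; exists (scale_pol c g), h; split=> //.
  exact: homog_scale_pol.
by move=> x; rewrite evR_scale_pol -mulrA -E evR_scale_pol mulrA divff // mul1r.
Qed.

Lemma hyp_factor f (c : R) (ps : seq (pol R n)) (p0 : pol R n) e k :
  (forall x, evR f x = c * \prod_(p <- ps) evR p x) -> hyp f e ->
  (k < size ps)%N -> hyp (nth p0 ps k) e.
Proof.
move=> E [fe he] kp.
have perm : forall (A : comNzRingType) (F : pol R n -> A),
    \prod_(p <- ps) F p = F (nth p0 ps k) *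
      (\prod_(p <- take k ps) F p * \prod_(p <- drop k.+1 ps) F p).
  move=> A F; rewrite -{1}(cat_take_drop k ps) big_cat (drop_nth p0) //= big_cons.
  by rewrite mulrCA.
split.
  by apply: contra fe => /eqP p0e; rewrite E perm p0e mul0r mulr0.
move=> x t Et; apply: (he x); rewrite (evC_prod E) perm Et mul0r mulr0 //.
Qed.

(* By [factor], every irreducible form hyperbolic along e0 is atomic. *)
Definition atomic f e0 := forall e, hyp f e ->
  (forall x, cone f e x <-> cone f e0 x) \/
  (forall x, cone f e x <-> cone f (fun i => - e0 i) x).

Definition is_atom e0 (p : nat * pol R n) :=
  [/\ (0 < p.1)%N, homog p.1 p.2, hyp p.2 e0 & atomic p.2 e0].

(** Outside the first cone there is a root >= 0, outside the second a root <= 0, and f(e) <> 0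
    excludes the root 0. *)
Lemma cone_trichotomy d f e0 e : homog d f -> hyp f e0 -> hyp f e ->
  [\/ cone f e0 e, cone f (fun i => - e0 i) e |
      exists r s : R, [/\ 0 < r, s < 0, evR f (line e e0 r) = 0 & evR f (line e e0 s) = 0]].
Proof.
move=> hf he0 [fe he].
have nz t : evR f (line e e0 t) = 0 -> t != 0.
  by move=> E; apply/eqP => t0; move: E; rewrite t0 (eq_evR _ (line0 _ _)) => /eqP; rewrite (negPf fe).
have [c1|/existsNP[r /not_implyP[Er /negP r0]]] := pselect (cone f e0 e); first by constructor 1.
have [c2|/existsNP[s /not_implyP[Es /negP s0]]] := pselect (cone f (fun i => - e0 i) e).
  by constructor 2.
constructor 3; exists r, (- s).
have Es' : evR f (line e e0 (- s)) = 0.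
  by rewrite -Es; apply: eq_evR => i; rewrite /line mulNr mulrN.
split=> //; first by rewrite lt_def nz //= leNgt.
by rewrite oppr_lt0 lt_def -[s]opprK oppr_eq0 nz //= opprK leNgt.
Qed.

(** Strong induction on the degree: a form that is not atomic has a hyperbolic direction outside
    both cones, and [factor] splits it into smaller forms, again hyperbolic along e0. *)
Lemma atoms_exist d f e0 : (0 < d)%N -> homog d f -> hyp f e0 ->
  exists fs : seq (nat * pol R n), [/\ forall k, (k < size fs)%N -> is_atom e0 (nth (0%N, [::]) fs k),
    (\sum_(p <- fs) p.1)%N = d & forall x, evR f x = \prod_(p <- fs) evR p.2 x].
Proof.
elim/ltn_ind: d f => d IH f d0 hf he0.
have [at_f|nat_f] := pselect (atomic f e0).
  exists [:: (d, f)]; split; rewrite ?big_seq1 //; last by move=> x; rewrite big_seq1.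
  by case.
have [e /not_implyP[he /not_orP[n1 n2]]] : exists e, ~ (hyp f e ->
  (forall x, cone f e x <-> cone f e0 x) \/
  (forall x, cone f e x <-> cone f (fun i => - e0 i) x)) by apply/existsNP.
case: (cone_trichotomy hf he0 he) => [c1|c2|[r [s [r0 s0 Er Es]]]].
- by case: n1 => x; have := cone_eq hf he0 c1 x; case.
- by case: n2 => x; have := cone_eq hf (hyp_opp hf he0) c2 x; case.
have [a [b [a0 b0 abd [g [h [hg hh E]]]]]] := factor hf he0 he r0 s0 Er Es.
have E' x : evR f x = 1 * \prod_(p <- [:: g; h]) evR p x.
  by rewrite big_cons big_seq1 mul1r E.
have hge : hyp g e0 := @hyp_factor f 1 [:: g; h] [::] e0 0 E' he0 isT.
have hhe : hyp h e0 := @hyp_factor f 1 [:: g; h] [::] e0 1 E' he0 isT.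
have ltad : (a < d)%N by rewrite -abd -{1}[a]addn0 ltn_add2l.
have ltbd : (b < d)%N by rewrite -abd -{1}[b]add0n ltn_add2r.
have [fs1 [A1 S1 P1]] := IH a ltad g a0 hg hge.
have [fs2 [A2 S2 P2]] := IH b ltbd h b0 hh hhe.
exists (fs1 ++ fs2); split.
- move=> k; rewrite size_cat nth_cat; case: (ltnP k (size fs1)) => [lt _|ge lt]; first exact: A1.
  by apply: A2; rewrite ltn_subLR.
- by rewrite big_cat /= S1 S2.
- by move=> x; rewrite big_cat /= -P1 -P2.
Qed.

Lemma hpoly1_linear (g : vec -> R) : hpoly 1 g ->
  exists l : vec, forall x, g x = \sum_i l i * x i.
Proof.
move=> [p hp gp]; suff [l H] : exists l : vec, forall x, evR p x = \sum_i l i * x i.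
  by exists l => x; rewrite gp.
elim: p hp {g gp} => [|m p IH] /=.
  by exists (fun=> 0) => x; rewrite /evR /ev big_nil big1 // => i _; rewrite mul0r.
case/andP=> /eqP m1 /IH[l H].
have [i0 mi0] : exists i0, (0 < m.2 i0)%N.
  apply/existsP; apply: contraT; rewrite negb_exists => /forallP H0.
  by move: m1; rewrite big1 // => i _; apply/eqP; have := H0 i; rewrite -leqNgt leqn0.
move: m1; rewrite (bigD1 i0) //=; set S := (\sum_(i | _) _)%N => m1.
have mi1 : m.2 i0 = 1%N by apply/eqP; rewrite eqn_leq mi0 andbT -m1 leq_addr.
have S0 : S = 0%N by move: m1; rewrite mi1 add1n => -[].
have mo i : i != i0 -> m.2 i = 0%N.
  by move=> ne; apply/eqP; rewrite -leqn0 -S0 /S (bigD1 i) //= leq_addr.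
exists (fun i => l i + (if i == i0 then m.1 else 0)) => x.
rewrite /evR /ev big_cons -/(ev id p x) -/(evR p x) H.
under [RHS]eq_bigr do rewrite mulrDl.
rewrite big_split /= addrC; congr (_ + _).
have -> : \sum_i (if i == i0 then m.1 else 0) * x i = m.1 * x i0.
  rewrite (bigD1 i0) //= eqxx big1 ?addr0 // => i ne.
  by rewrite (negPf ne) mul0r.
have -> : \prod_i x i ^+ m.2 i = x i0.
  by rewrite (bigD1 i0) //= mi1 expr1 big1 ?mulr1 // => i /mo->; rewrite expr0.
by [].
Qed.

Lemma lpol_coef1_hpoly f e0 : hpoly 1 (fun x => (lpol f e0 x)`_1).
Proof.
have h1 := graded_ev f (fun=> 0) e0 1 0; apply: eq_hpoly h1 => x.
set B := ev _ _ _; have -> : B = map_poly polyC (lpol f e0 x).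
  rewrite /lpol (ev_morph (map_poly polyC)) /B /ev; apply: eq_bigr => m _.
  congr (_ * _); first by rewrite /= map_polyC.
  apply: eq_bigr => i _; congr (_ ^+ _).
  by rewrite /= /line /= rmorphD rmorphM /= !map_polyC map_polyX rmorph0 mulr0 addr0.
by rewrite coef_map coefC.
Qed.

Lemma prod_neg_coef (s : seq R) : all (fun r => r < 0) s -> s != [::] ->
  0 < (\prod_(r <- s) ('X - r%:P))`_0 /\ 0 < (\prod_(r <- s) ('X - r%:P))`_1.
Proof.
elim: s => // r s IH /= /andP[r0 /IH {}IH] _; rewrite big_cons.
set P := \prod_(r <- s) _ in IH *.
have c0 : (('X - r%:P) * P)`_0 = - r * P`_0.
  by rewrite mulrBl coefB coefXM coefCM sub0r mulNr.
have c1 : (('X - r%:P) * P)`_1 = P`_0 - r * P`_1.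
  by rewrite mulrBl coefB coefXM coefCM.
rewrite c0 c1; have [s0|sn0] := eqVneq s [::].
  by rewrite /P s0 big_nil !coef1 mulr1 mulr0 subr0 oppr_gt0.
have [p0 p1] := IH sn0; split; first by rewrite mulr_gt0 // oppr_gt0.
by rewrite addr_gt0 // -mulNr mulr_gt0 // oppr_gt0.
Qed.

(** As a polynomial in t, f(e0 + t x) / f(e0) has constant coefficient 1 and d negative roots, so
    its linear coefficient is minus the sum of the inverse roots. *)
Lemma lpol_coef1_pos d f e0 x : (0 < d)%N -> homog d f -> hyp f e0 -> cone f e0 x ->
  0 < (lpol f e0 x)`_1 / evR f e0.
Proof.
move=> d0 hf he0 cx; set P := lpol f e0 x.
have fx0 := cone_neq0 cx; have fe0 : evR f e0 != 0 by case: he0.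
have [szP ldP] := has_top_ev id e0 x hf; rewrite -/(lpol f e0 x) -/P in szP ldP.
have sP : size P = d.+1.
  apply/eqP; rewrite eqn_leq szP /= ltnNge; apply/negP => le.
  by move: ldP; rewrite nth_default // => /esym/eqP; rewrite -/(evR f x) (negPf fx0).
pose PC := map_poly toC P.
have PC0 : PC != 0 by rewrite map_poly_eq0 -size_poly_gt0 sP.
have rneg z : z \in rts PC -> exists2 r : R, z = r%:C & r < 0.
  rewrite mem_rts // rootE lpolCE => /eqP E.
  have z0 : z != 0.
    apply/eqP => z0; move: E; rewrite z0 (eq_evC _ (line0 _ _)) evC_real => /eqP.
    by rewrite realC_eq0 (negPf fe0).
  have [r Er r0] := cone_root hf he0 cx (evC_swap hf z0 E).
  exists r^-1; last by rewrite invr_lt0.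
  by rewrite fmorphV /= -Er invrK.
pose s := map (@complex.Re R) (rts PC).
have sE : map toC s = rts PC.
  rewrite /s -map_comp -[RHS]map_id; apply/eq_in_map => z /rneg[r -> _] //.
have sneg : all (fun r => r < 0) s.
  by apply/allP => _ /mapP[z /rneg[r -> r0] ->].
have PE : P = lead_coef P *: \prod_(r <- s) ('X - r%:P).
  apply: (map_inj_poly (@complexI R) (rmorph0 toC)); rewrite -/PC {1}(rtsE PC).
  rewrite lead_coef_map map_polyZ; congr (_ *: _).
  by rewrite -sE /rprod big_map rmorph_prod; apply: eq_bigr => r _; rewrite /= map_polyXsubC.
have sn0 : s != [::].
  apply/eqP => s0; have := congr1 (fun p : {poly R} => size p) PE.
  rewrite s0 big_nil sP; apply/eqP; rewrite neq_ltn; apply/orP; right.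
  by rewrite ltnS (leq_trans (size_scale_leq _ _)) // size_poly1.
have [q0 q1] := prod_neg_coef sneg sn0.
have P0 : P`_0 = evR f e0.
  by rewrite -horner_coef0 lpolE; apply: eq_evR; exact: line0.
rewrite -P0 {1}PE [in X in _ / X]PE !coefZ -mulf_div divff ?mul1r ?divr_gt0 //.
by rewrite lead_coef_eq0 -size_poly_gt0 sP.
Qed.

(** The form is the linear coefficient of f(e0 + t x) / f(e0); in degree one it is f itself divided
    by f(e0). *)
Lemma atom_form e0 (p : nat * pol R n) : is_atom e0 p ->
  exists l : vec, [/\ forall e, cone p.2 e0 e -> 0 < \sum_i l i * e i,
    forall e, cone p.2 (fun i => - e0 i) e -> \sum_i l i * e i < 0 &
    p.1 = 1%N -> forall x, evR p.2 x = evR p.2 e0 * \sum_i l i * x i].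
Proof.
case: p => d f [/= d0 hf he0 _]; have fe0 : evR f e0 != 0 by case: he0.
have [l Hl] := hpoly1_linear (lpol_coef1_hpoly f e0).
exists (fun i => (evR f e0)^-1 * l i).
have E x : \sum_i (evR f e0)^-1 * l i * x i = (lpol f e0 x)`_1 / evR f e0.
  by rewrite Hl mulrC mulr_sumr; apply: eq_bigr => i _; rewrite mulrA.
have pos x : cone f e0 x -> 0 < \sum_i (evR f e0)^-1 * l i * x i.
  by rewrite E; exact: (lpol_coef1_pos d0 hf he0).
split=> //.
  move=> e ce.
  have : cone f e0 (fun i => - e i).
    apply/(cone_opp _ _ hf); apply: (_ : cone f _ (fun i => - - e i)).
    have -> : (fun i => - - e i) = e by apply: funext => i; rewrite opprK.
    exact: ce.
  move/pos; rewrite -[_ < 0]oppr_gt0 -sumrN.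
  by congr (0 < _); apply: eq_bigr => i _; rewrite mulrN.
move=> d1 x; rewrite E mulrCA divff // mulr1; rewrite d1 in hf.
by have [_ E1] := has_top_ev id e0 x hf; exact: (esym E1).
Qed.

Lemma cone_prod f (ps : seq (pol R n)) p0 e :
  (forall x, evR f x = \prod_(p <- ps) evR p x) ->
  forall x, cone f e x <-> forall k, (k < size ps)%N -> cone (nth p0 ps k) e x.
Proof.
move=> E x; split=> [cf k kp t Et|H t].
  apply: cf; rewrite E (big_nth p0) big_mkord (bigD1 (Ordinal kp)) //= Et mul0r //.
rewrite E (big_nth p0) big_mkord => /eqP/prodf_eq0[k _ /eqP Ek].
exact: (H k (ltn_ord k)).
Qed.

Definition rowv (x : vec) : 'rV[R]_n := \row_i x i.
Definition signs m (M : 'M[R]_(n, m)) (x : vec) : {ffun 'I_m -> bool} :=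
  [ffun j => 0 < (rowv x *m M) 0 j].

Lemma signs_realized m (M : 'M[R]_(n, m)) x :
  (forall j, (rowv x *m M) 0 j != 0) -> signs M x \in regions M.
Proof.
move=> nz; rewrite inE; apply/asboolP; exists (rowv x) => j; rewrite ffunE.
by case: ltgtP (nz j) => // ->; rewrite eqxx.
Qed.

(** One column per atom. Its sign at e tells which of the two cones of the atom contains e, and the
    cone of f is the intersection of the cones of the atoms. If there are d atoms, each has degree 1
    and is a multiple of its form. *)
Lemma classifier d f e0 : (0 < d)%N -> homog d f -> hyp f e0 ->
  exists m (M : 'M[R]_(n, m)), [/\ (0 < m <= d)%N,
    forall e, hyp f e -> signs M e \in regions M,
    forall e e', hyp f e -> hyp f e' -> signs M e = signs M e' ->
      forall x, cone f e x <-> cone f e' x &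
    m = d -> exists2 c, c != 0 & forall x, evR f x = c * \prod_j (rowv x *m M) 0 j].
Proof.
move=> d0 hf he0; have [fs [A S P]] := atoms_exist d0 hf he0.
pose m := size fs; pose dflt : nat * pol R n := (0%N, [::]).
have m_le : (m <= d)%N.
  rewrite -S /m -sum1_size (big_nth dflt) [X in (_ <= X)%N](big_nth dflt) !big_mkord.
  by apply: leq_sum => k _; have [] := A k (ltn_ord k).
have m_gt0 : (0 < m)%N.
  by rewrite /m lt0n size_eq0; apply/eqP => fs0; move: d0; rewrite -S fs0 big_nil.
have ex_form (k : 'I_m) : exists l : vec,
    [/\ forall e, cone (nth dflt fs k).2 e0 e -> 0 < \sum_i l i * e i,
    forall e, cone (nth dflt fs k).2 (fun i => - e0 i) e -> \sum_i l i * e i < 0 &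
    (nth dflt fs k).1 = 1%N -> forall x, evR (nth dflt fs k).2 x =
       evR (nth dflt fs k).2 e0 * \sum_i l i * x i].
  exact: atom_form (A k (ltn_ord k)).
have [l Hl] := choice ex_form.
pose M : 'M[R]_(n, m) := \matrix_(i, j) l j i.
have ME x j : (rowv x *m M) 0 j = \sum_i l j i * x i.
  by rewrite mxE; apply: eq_bigr => i _; rewrite !mxE mulrC.
have P' x : evR f x = 1 * \prod_(p <- [seq q.2 | q <- fs]) evR p x.
  by rewrite mul1r big_map P.
have hypk (k : 'I_m) e : hyp f e -> hyp (nth dflt fs k).2 e.
  move=> he; have := @hyp_factor f 1 _ [::] e k P' he; rewrite size_map ltn_ord.
  by rewrite (nth_map dflt) // => /(_ isT).
have split_sign (k : 'I_m) e : hyp f e ->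
    ((forall x, cone (nth dflt fs k).2 e x <-> cone (nth dflt fs k).2 e0 x) /\
     0 < (rowv e *m M) 0 k) \/
    ((forall x, cone (nth dflt fs k).2 e x <-> cone (nth dflt fs k).2 (fun i => - e0 i) x) /\
     (rowv e *m M) 0 k < 0).
  move=> he; have [_ hk _ atk] := A k (ltn_ord k); have [L1 L2 _] := Hl k.
  have hke := hypk k e he; have cee := cone_self hk hke; rewrite ME.
  by case: (atk e hke) => Hc; [left | right]; split=> //;
    [apply: L1 | apply: L2]; apply/Hc.
exists m, M; split.
- by rewrite m_gt0.
- move=> e he; apply: signs_realized => k.
  by case: (split_sign k e he) => -[_ h]; rewrite ?(gt_eqF h) ?(lt_eqF h).
- move=> e e' he he' /ffunP sE x.
  have P2 y : evR f y = \prod_(p <- [seq q.2 | q <- fs]) evR p y by rewrite big_map P.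
  rewrite !(cone_prod [::] _ P2) size_map; split=> H k km; have := H k km;
    have := sE (Ordinal km); rewrite !ffunE !(nth_map dflt) //;
    case: (split_sign (Ordinal km) e he) => -[H1 s1];
    case: (split_sign (Ordinal km) e' he') => -[H2 s2];
    rewrite /= in H1 H2; rewrite ?s1 ?s2 ?(lt_gtF s1) ?(lt_gtF s2) // => _;
    by move=> /H1 /H2 || by move=> /H2 /H1.
- move=> md; have d1 (k : 'I_m) : (nth dflt fs k).1 = 1%N.
    have : (\sum_(k < m) 1 = \sum_(k < m) (nth dflt fs k).1)%N.
      rewrite sum1_card card_ord; apply: (etrans md).
      by rewrite -[LHS]S (big_nth dflt) big_mkord.
    move=> Esum; have le1 (j : 'I_m) : (1 <= (nth dflt fs j).1)%N by have [] := A j (ltn_ord j).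
    apply/eqP; rewrite eqn_leq le1 andbT leqNgt; apply/negP => lt.
    move: Esum; rewrite (bigD1 k) //= [X in _ = X](bigD1 k) //= => Esum.
    have le2 : (\sum_(j < m | j != k) 1 <= \sum_(j < m | j != k) (nth dflt fs j).1)%N.
      by apply: leq_sum => j _; exact: le1.
    by have := leq_add lt le2; rewrite -Esum addSn ltnn.
  exists (evR f e0); first by case: he0.
  move=> x; rewrite !P !(big_nth dflt) !big_mkord -big_split /=; apply: eq_bigr => k _.
  by have [_ _ ->] := Hl k; rewrite // ME.
Qed.

End Atoms.

(** * Products of linear forms *)

Section Products.
Variables (R : realType) (n : nat).
Local Notation C := R[i].
Local Notation vec := ('I_n -> R).

Definition lin_pol (l : vec) : pol R n :=
  [seq (l i, fun k => nat_of_bool (k == i)) | i <- index_enum 'I_n].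

Lemma ev_lin_pol (A : comNzRingType) (j : R -> A) l v :
  ev j (lin_pol l) v = \sum_i j (l i) * v i.
Proof.
rewrite /ev /lin_pol big_map; apply: eq_bigr => i _ /=; congr (_ * _).
rewrite (bigD1 i) //= eqxx expr1 big1 ?mulr1 // => k /negPf->.
by rewrite expr0.
Qed.

Section LinearProduct.
Variables (d : nat) (f : pol R n) (c : R) (M : 'M[R]_(n, d)).
Hypothesis c0 : c != 0.
Hypothesis fE : forall x, evR f x = c * \prod_j (rowv x *m M) 0 j.

Local Notation L x j := ((rowv x *m M) 0 j).

Let LE x j : L x j = evR (lin_pol (fun i => M i j)) x.
Proof. by rewrite /evR ev_lin_pol mxE; apply: eq_bigr => i _; rewrite !mxE mulrC. Qed.

Lemma linear_line x e t j : L (line x e t) j = L x j + t * L e j.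
Proof.
rewrite !mxE mulr_sumr -big_split /=; apply: eq_bigr => i _.
by rewrite !mxE /line; ring.
Qed.

(** A root t annihilates some factor L_j(x) + t L_j(e), which has real coefficients. *)
Lemma linear_product_hyp e : (forall j, L e j != 0) -> hyp f e.
Proof.
move=> nz; split; first by rewrite fE mulf_neq0 //; apply/prodf_neq0 => j _.
move=> x t.
have E y : evR f y = c * \prod_(p <- [seq lin_pol (fun i => M i j) | j <- index_enum 'I_d]) evR p y.
  by rewrite fE big_map; congr (_ * _); apply: eq_bigr => j _; rewrite LE.
rewrite (evC_prod E) big_map => /eqP; rewrite mulf_eq0 realC_eq0 (negPf c0) /=.
case/prodf_eq0 => j _; rewrite /evC ev_lin_pol.
have -> : \sum_i (M i j)%:C * line (vC x) (vC e) t i = (L x j)%:C + t * (L e j)%:C.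
  rewrite !mxE !rmorph_sum mulr_sumr -big_split /=; apply: eq_bigr => i _.
  by rewrite !mxE !rmorphM /line /vC; ring.
move=> /eqP /(congr1 (@complex.Im R)); rewrite ImD ImM /= mulr0 !add0r => /eqP.
by rewrite mulf_eq0 (negPf (nz j)) orbF => /eqP.
Qed.

(** Each - L_j(e) / L_j(e') is a root along e', and it is negative only if the signs at j agree. *)
Lemma linear_product_sep e e' : (forall j, L e j != 0) -> (forall j, L e' j != 0) ->
  signs M e != signs M e' -> ~ cone f e' e.
Proof.
move=> nz nz' /eqP ne ce; apply: ne; apply/ffunP => j; rewrite !ffunE.
have : - L e j / L e' j < 0.
  apply: ce; rewrite fE (bigD1 j) //= linear_line mulrAC -mulrA divff // mulr1 subrr.
  by rewrite mul0r mulr0.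
rewrite mulNr oppr_lt0 => pos.
have [p|q|E] := ltgtP (L e' j) 0.
- by move: pos; rewrite nmulr_lgt0 ?invr_lt0 // => h; rewrite (lt_gtF h).
- by move: pos; rewrite pmulr_lgt0 ?invr_gt0.
- by have := nz' j; rewrite E eqxx.
Qed.

End LinearProduct.
End Products.

(** For d <= n the sum runs over all binomial coefficients of d - 1 and equals 2^(d-1). *)
Lemma cone_boundE n d : (0 < d)%N -> cone_bound n d = region_bound n d.
Proof.
case: d => // d _; rewrite /cone_bound /region_bound /=; case: leqP => // led.
rewrite expnS; congr (2 * _)%N.
rewrite -[2%N]/(1 + 1)%N expnDn (big_ord_widen n (fun k => 'C(d, k) * (1 ^ (d - k) * 1 ^ k))%N) //.
rewrite big_mkcond; apply: eq_bigr => k _; rewrite !exp1n !muln1; case: ifP => // /negbT.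
by rewrite -leqNgt => /bin_small ->.
Qed.

Lemma normr_le_sum (R : numDomainType) n (a : 'I_n -> R) i :
  `|a i| <= 1 + \sum_j `|a j|.
Proof. by rewrite (bigD1 i) //= addrCA lerDl addr_ge0 // sumr_ge0. Qed.

Import Rstruct.

(** * Translation of the notions of the statement *)

Section Bridge.
Variable n : nat.
Implicit Types (f : mpoly n) (x y e : Defs.vec n).
Local Notation RC := (Rdefinitions.R[i]).

Lemma fold_sum (T : Type) (F : T -> Rdefinitions.R) s :
  fold_right Rplus (IZR 0) (map F s) = \sum_(i <- s) F i.
Proof. by elim: s => [|i s IH]; rewrite ?big_nil //= big_cons IH. Qed.

Lemma fold_prod (T : Type) (F : T -> Rdefinitions.R) s :
  fold_right Rmult (IZR 1) (map F s) = \prod_(i <- s) F i.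
Proof. by elim: s => [|i s IH]; rewrite ?big_nil //= big_cons IH. Qed.

Lemma sumRE (T : finType) (F : T -> Rdefinitions.R) : sumR F = \sum_i F i.
Proof. by rewrite /sumR fold_sum big_enum. Qed.

Lemma prodRE (T : finType) (F : T -> Rdefinitions.R) : prodR F = \prod_i F i.
Proof. by rewrite /prodR fold_prod big_enum. Qed.

Lemma pevalE f x : peval f x = evR f x.
Proof.
rewrite /peval fold_sum /evR /ev; apply: eq_bigr => m _; rewrite prodRE; congr (_ * _).
by apply: eq_bigr => i _; rewrite RpowE.
Qed.

Definition toRC (z : Defs.C) : RC := z.1 +i* z.2.

Lemma toRC_inj : injective toRC.
Proof. by move=> [a b] [a' b'] [-> ->]. Qed.

Lemma toRC_add z w : toRC (Cadd z w) = toRC z + toRC w.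
Proof. by case: z; case: w. Qed.

Lemma toRC_mul z w : toRC (Cmul z w) = toRC z * toRC w.
Proof. by case: z => a b; case: w => a' b'. Qed.

Lemma toRC_pow z k : toRC (Cpow z k) = toRC z ^+ k.
Proof. by elim: k => [|k IH] //; rewrite exprS -IH -toRC_mul. Qed.

Lemma pevalCE f (z : 'I_n -> Defs.C) : toRC (pevalC f z) = evC f (fun i => toRC (z i)).
Proof.
rewrite /pevalC /evC /ev; elim: f => [|m f IH]; first by rewrite big_nil.
rewrite /= toRC_add IH big_cons toRC_mul; congr (_ * _ + _).
rewrite -big_enum /=; elim: (enum 'I_n) => [|i s IHs]; first by rewrite big_nil.
by rewrite big_cons /= toRC_mul toRC_pow IHs.
Qed.

Lemma hyperbolicE f e : hyperbolic f e <-> hyp f e.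
Proof.
have E x (t : Defs.C) : toRC (pevalC f (fun i => Cadd (Cof (x i)) (Cmul t (Cof (e i))))) =
    evC f (line (vC x) (vC e) (toRC t)).
  by rewrite pevalCE; apply: eq_evC => i; rewrite toRC_add toRC_mul.
split=> [[e0 H]|[e0 H]]; split.
- by rewrite -pevalE; apply/eqP.
- move=> x t Et; apply: (H x (Re t, Im t)); apply: toRC_inj; rewrite E -[RHS]Et.
  by congr (evC f (line _ _ _)); case: (t).
- by rewrite pevalE; apply/eqP.
- move=> x t Et; apply: (H x (toRC t)); rewrite -E Et //.
Qed.

Lemma hconeE f e x : hcone f e x <-> cone f e x.
Proof.
split=> H t Et; first by apply/RltP/H; rewrite pevalE.
by apply/RltP/H; rewrite -pevalE.
Qed.

Lemma imag_projE d f y : homog d f -> ~ imag_proj f y <-> hyp f y.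
Proof.
move=> hf; rewrite (hypP y hf).
have E x : toRC (pevalC f (fun i => (x i, y i))) = evC f (line (vC x) (vC y) 'i).
  rewrite pevalCE; apply: eq_evC => i; rewrite /line /vC /toRC.
  by apply: complex_ext; rewrite ?(ReD, ImD, ReM, ImM) /=; ring.
split=> [H x|H [x Ex]]; last by have := H x; rewrite -E Ex eqxx.
by apply/eqP => E0; apply: H; exists x; apply: toRC_inj; rewrite E E0.
Qed.

Lemma homogeneousE f d : homogeneous f d -> homog d f.
Proof.
case=> H _; elim: f H => //= m f IH H; rewrite IH; last by move=> m' mf; apply: H; right.
by rewrite H ?eqxx //; left.
Qed.

(** Convexity: on the segment from a point of U to a point of V, membership in U is locally constant
    unless the open sets meet inside the cone. *)
Lemma cone_connected d f e : homog d f -> hyp f e -> Defs.connected_set (cone f e).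
Proof.
move=> hf he U V oU oV cov [x [Ax Ux]] [y [Ay Vy]].
have [//|nex] := pselect (exists x, cone f e x /\ U x /\ V x).
pose sg (t : Rdefinitions.R) : Defs.vec n := fun i => (1 - t) * x i + t * y i.
have Asg t : 0 <= t <= 1 -> cone f e (sg t) by exact: (cone_segment hf he Ax Ay).
pose S : Rdefinitions.R := 1 + \sum_i `|y i - x i|.
have S0 : 0 < S by rewrite ltr_wpDr // sumr_ge0.
have normS i : `|y i - x i| <= S by exact: (normr_le_sum (fun i => y i - x i)).
have near (W : Defs.vec n -> Prop) t : Defs.open_set W -> W (sg t) ->
    exists2 eps : Rdefinitions.R, 0 < eps & forall t', `|t' - t| < eps -> W (sg t').
  move=> oW /oW[eps [/RltP eps0 H]]; exists (eps / S); first by rewrite divr_gt0.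
  move=> t' lt; apply: H => i; apply/RltP.
  have -> : Rabs (Rminus (sg t' i) (sg t i)) = `|(t' - t) * (y i - x i)|.
    rewrite RminusE; change (`|sg t' i - sg t i| = `|(t' - t) * (y i - x i)|).
    by congr `| _ |; rewrite /sg; ring.
  rewrite normrM; apply: (@le_lt_trans _ _ (`|t' - t| * S)); last by rewrite -ltr_pdivlMr.
  apply: ler_wpM2l => //; exact: normS.
have /(@locally_const_seg _ _ (fun t => `[< U (sg t) >])) : forall t, 0 <= t <= 1 ->
    exists2 e : Rdefinitions.R, 0 < e & forall t', 0 <= t' <= 1 -> `|t' - t| < e ->
      `[< U (sg t') >] = `[< U (sg t) >].
  move=> t t01; have [Ut|nUt] := pselect (U (sg t)).
    have [eps eps0 H] := near U t oU Ut; exists eps => // t' _ /H Ut'.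
    by rewrite !asboolT.
  have Vt : V (sg t) by case: (cov (sg t) (Asg t t01)).
  have [eps eps0 H] := near V t oV Vt; exists eps => // t' t'01 /H Vt'.
  rewrite !asboolF // => Ut'; apply: nex; exists (sg t'); split; first exact: Asg.
  by split.
have sg0 : sg 0 = x by apply: funext => i; rewrite /sg subr0 mul1r mul0r addr0.
have sg1 : sg 1 = y by apply: funext => i; rewrite /sg subrr mul0r mul1r add0r.
rewrite sg0 sg1 asboolT // => /esym/asboolP Uy.
by case: nex; exists y.
Qed.

Lemma In_map (T : eqType) (U : Type) (F : T -> U) s l : s \in l -> In (F s) (map F l).
Proof.
elim: l => //= t l IH; rewrite in_cons => /predU1P[->|/IH]; [by left | by right].
Qed.

Lemma In_mapP (T : eqType) (U : Type) (F : T -> U) u l :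
  In u (map F l) -> exists2 s, s \in l & u = F s.
Proof.
elim: l => //= t l IH [<-|/IH[s sl ->]]; first by exists t; rewrite ?mem_head.
by exists s; rewrite // in_cons sl orbT.
Qed.

Lemma In_nth (T : Type) (x0 : T) l k : (k < length l)%N -> In (nth x0 l k) l.
Proof. by elim: l k => //= t l IH [|k] /= lt; [left | right; apply: IH]. Qed.

Lemma length_seq_map (T U : Type) (F : T -> U) l : length (map F l) = size l.
Proof. by elim: l => //= t l ->. Qed.

End Bridge.

(** * The bound and its extremal forms *)

Section Main.
Variables (n d : nat) (f : mpoly n).
Hypothesis d0 : (0 < d)%N.
Hypothesis hf : homog d f.

Lemma family_bound : family_at_most (is_hcone f) (cone_bound n d).
Proof.
have [[e0 he0]|none] := pselect (exists e0, hyp f e0); last first.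
  by exists [::]; split=> // K [e [/hyperbolicE he _]]; case: none; exists e.
have [m [M [/andP[m0 md] real sep _]]] := classifier d0 hf he0.
(* All hyperbolic directions with sign vector s have the same cone, so the union over them is that
   cone and no representative has to be chosen. *)
pose F (s : {ffun 'I_m -> bool}) : Defs.vec n -> Prop :=
  fun x => exists e, [/\ hyp f e, signs M e = s & cone f e x].
exists (map F (enum (regions M))); split.
  rewrite length_seq_map -cardE cone_boundE //.
  have [le _] := regions_bound M; apply: (leq_trans le).
  by apply: region_bound_mono; rewrite m0.
move=> K [e [/hyperbolicE he HK]]; exists (F (signs M e)); split.
  by apply: In_map; rewrite mem_enum; exact: real.
move=> x; rewrite HK hconeE; split; first by move=> cx; exists e.
by case=> e' [he' E cx]; apply/(sep e' e).
Qed.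

(** Among N + 1 hyperbolic directions two share a sign vector; they lie in one cone, which is
    connected and consists of hyperbolic directions. *)
Lemma components_bound :
  components_at_most (fun y => ~ imag_proj f y) (cone_bound n d).
Proof.
move=> pts sz Hp; set N := cone_bound n d in sz *.
pose p (k : 'I_N.+1) : Defs.vec n := nth (fun=> IZR 0) pts k.
have hp k : hyp f (p k).
  by apply/(imag_projE _ hf)/Hp/In_nth; rewrite sz.
have [m [M [/andP[m0 md] real sep _]]] := classifier d0 hf (hp ord0).
have [inj|/injectivePn[i [j ij E]]] := boolP (injectiveb (fun k => signs M (p k))).
  have : (N.+1 <= #|regions M|)%N.
    rewrite -[N.+1]card_ord -(card_codom (injectiveP _ inj)).
    apply: subset_leq_card; apply/fintype.subsetP => _ /codomP[k ->]; exact: real.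
  rewrite leqNgt ltnS; have [le _] := regions_bound M.
  by rewrite (leq_trans le) // /N cone_boundE // region_bound_mono // m0.
wlog ltij : i j ij E / (i < j)%N.
  move=> W; have [lt|gt|eq] := ltngtP i j; first exact: (W i j).
    by apply: (W j i) => //; rewrite eq_sym.
  by move: ij; rewrite (val_inj eq) eqxx.
exists i, j; split; first by rewrite ltij ltn_ord.
exists (cone f (p i)); split; first exact: (cone_connected hf (hp i)).
split; first by move=> x cx; apply/(imag_projE _ hf); exact: (cone_hyp hf (hp i)).
split; first exact: (cone_self hf).
by apply/(sep _ _ (hp i) (hp j) E); exact: (cone_self hf).
Qed.

Lemma eq_form_pol (l : 'I_d -> Defs.vec n) c (M := \matrix_(i, k) l k i) :
  (forall x, peval f x = Rmult c (prodR (fun k => linform (l k) x))) <->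
  (forall x, evR f x = c * \prod_j (rowv x *m M) 0 j).
Proof.
have E x : prodR (fun k => linform (l k) x) = \prod_j (rowv x *m M) 0 j.
  rewrite prodRE; apply: eq_bigr => j _; rewrite /linform sumRE mxE.
  by apply: eq_bigr => i _; rewrite !mxE mulrC.
by split=> H x; have := H x; rewrite pevalE E.
Qed.

Lemma forms_independentE (l : 'I_d -> Defs.vec n) :
  forms_independent l <-> gen_pos (\matrix_(i, k) l k i).
Proof.
split=> [H s inj lam E|H s inj lam E j].
  apply/matrixP => j k; rewrite (ord1 k) mxE; apply: (H s inj (fun j => lam j 0)) => i.
  rewrite sumRE; have := congr1 (fun N : 'cV__ => N i 0) E; rewrite !mxE => Ei; rewrite -[RHS]Ei.
  by apply: eq_bigr => k' _; rewrite !mxE mulrC.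
have : colsub s (\matrix_(i, k) l k i) *m (\col_j lam j) = 0.
  apply/matrixP => i k; rewrite [RHS]mxE -[RHS](E i) sumRE mxE.
  by apply: eq_bigr => k' _; rewrite !mxE mulrC.
by move/(H s inj)/(congr1 (fun N : 'cV__ => N j 0)); rewrite !mxE.
Qed.

(** General position gives as many regions as the bound allows; a point of each is a hyperbolic
    direction, and different sign vectors give different cones. *)
Lemma max_cones_of_product c (l : 'I_d -> Defs.vec n) : c <> IZR 0 ->
  forms_independent l ->
  (forall x, peval f x = Rmult c (prodR (fun k => linform (l k) x))) ->
  family_at_least (is_hcone f) (cone_bound n d).
Proof.
move=> /eqP c0 /forms_independentE gp /eq_form_pol; set M := \matrix_(i, k) l k i in gp * => fE.
have card : #|regions M| = cone_bound n d.
  by rewrite cone_boundE //; apply/(regions_bound M).2.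
(* For a sign vector that is not realized the witness 0 is a dummy that makes the choice function
   total. *)
have ex s : exists x : Defs.vec n, s \in regions M ->
    (forall j, (rowv x *m M) 0 j != 0) /\ signs M x = s.
  have [|no] := boolP (s \in regions M); last by exists (fun=> 0).
  rewrite inE => /asboolP[x Hx]; exists (fun i => x 0 i) => _.
  have xE : rowv (fun i => x 0 i) = x by apply/rowP => i; rewrite mxE.
  rewrite xE; split=> [j|].
    by move: (Hx j); case: (s j) => h; [exact: lt0r_neq0 | exact: ltr0_neq0].
  apply/ffunP => j; rewrite ffunE xE; move: (Hx j); case: (s j) => // h.
  by rewrite ltNge (ltW h).
have [xs Hxs] := choice ex.
exists (map (fun s => hcone f (xs s)) (enum (regions M))); split; [|split].
- by rewrite length_seq_map -cardE.
- move=> K HK; have [s sM ->] := In_mapP HK; rewrite mem_enum in sM.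
  exists (xs s); split=> //; apply/hyperbolicE.
  exact: (linear_product_hyp c0 fE (Hxs s sM).1).
move=> i j /andP[ij jN] same.
pose s0 : {ffun 'I_d -> bool} := [ffun=> true].
have nthE k : (k < cone_bound n d)%N ->
    nth (fun=> False) (map (fun s => hcone f (xs s)) (enum (regions M))) k =
    hcone f (xs (seq.nth s0 (enum (regions M)) k)).
  move=> kN; rewrite (nth_map s0) // -cardE card //.
move: same; rewrite !nthE ?(ltn_trans ij jN) //.
set si := seq.nth s0 _ i; set sj := seq.nth s0 _ j => same.
have inM k : (k < cone_bound n d)%N -> seq.nth s0 (enum (regions M)) k \in regions M.
  by move=> kN; rewrite -mem_enum mem_nth // -cardE card.
have [nzi ei] := Hxs si (inM i (ltn_trans ij jN)).
have [nzj ej] := Hxs sj (inM j jN).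
apply: (linear_product_sep fE nzi nzj).
  rewrite ei ej nth_uniq ?enum_uniq -?cardE ?card ?(ltn_trans ij jN) //.
  by rewrite (ltn_eqF ij).
apply/hconeE/same/hconeE; apply: (cone_self hf).
exact: (linear_product_hyp c0 fE).
Qed.

(** The cones inject into the regions of m <= d forms. For n >= 2, reaching the bound for d forces m
    = d, and then general position. *)
Lemma product_of_max_cones : (exists x, peval f x <> IZR 0) ->
  family_at_least (is_hcone f) (cone_bound n d) ->
  exists c (l : 'I_d -> Defs.vec n), c <> IZR 0 /\ forms_independent l /\
    forall x, peval f x = Rmult c (prodR (fun k => linform (l k) x)).
Proof.
move=> [x0 fx0] [Ks [lenK [HK sepK]]].
have f0 : evR f x0 != 0 by rewrite -pevalE; apply/eqP.
(* In zero variables a form of positive degree has no monomials and vanishes. *)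
have n0 : (0 < n)%N.
  rewrite lt0n; apply: contra f0 => /eqP n0; rewrite /evR /ev; move: hf; rewrite /homog.
  case: f => [|m f'] /=; first by rewrite big_nil.
  rewrite big1 => [/andP[/eqP E]|i]; first by move: d0; rewrite -E.
  by move: (leq_ltn_trans (leq0n i) (ltn_ord i)); rewrite [X in (_ < X)%N]n0.
set N := cone_bound n d in lenK sepK.
have N0 : (0 < N)%N by rewrite /N cone_boundE // -(prednK n0) region_bound_gt0.
have ex (k : 'I_N) : exists e, hyp f e /\ forall x, nth (fun=> False) Ks k x <-> cone f e x.
  have [|e [/hyperbolicE he H]] := HK (nth (fun=> False) Ks k).
    by apply: In_nth; rewrite lenK.
  by exists e; split=> // x; rewrite H hconeE.
have [es Hes] := choice ex.
(* For n = 1 the bound is 2 for every d, so counting does not determine m; but then every form is a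
   multiple of the d-th power of the variable. *)
have [n1|n2] := leqP n 1.
  pose i0 : 'I_n := Ordinal n0.
  have i0E i : i = i0 by apply: val_inj; move: (leq_trans (ltn_ord i) n1); rewrite ltnS leqn0 => /eqP.
  exists (evR f (fun=> 1)), (fun=> fun=> 1); split; [|split].
  - have xE : evR f x0 = x0 i0 ^+ d * evR f (fun=> 1).
      by rewrite -(evR_scale _ _ hf); apply: eq_evR => i; rewrite mulr1 (i0E i).
    by move=> E; move: f0; rewrite xE E mulr0 eqxx.
  - move=> s inj lam E j.
    have jE j' : j' = j.
      have lt1 (k : 'I_(minn n d)) : (k < 1)%N.
        by apply: leq_trans (ltn_ord k) _; rewrite geq_min n1.
      apply: val_inj; move: (lt1 j) (lt1 j'); rewrite /= !ltnS !leqn0 => /eqP -> /eqP //.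
    have := E i0; rewrite sumRE (bigD1 j) //= big1 => [|j' /negP[]]; last by rewrite (jE j').
    by rewrite addr0 RmultE mulr1.
  - move=> x; rewrite pevalE prodRE.
    have -> : \prod_(k < d) linform (fun=> 1) x = x i0 ^+ d.
      rewrite -[in RHS](card_ord d) -prodr_const; apply: eq_bigr => k _.
      rewrite /linform sumRE (bigD1 i0) //= big1 => [|i /negP[]]; last by rewrite (i0E i).
      by rewrite addr0 RmultE mul1r.
    rewrite RmultE mulrC -(evR_scale _ _ hf); apply: eq_evR => i.
    by rewrite mulr1 (i0E i).
have [m [M [/andP[m0 md] real sep prodE]]] := classifier d0 hf (Hes (Ordinal N0)).1.
have inj : injective (fun k => signs M (es k)).
  suff W (i j : 'I_N) : (i < j)%N -> signs M (es i) <> signs M (es j).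
    move=> i j E; apply: val_inj; case: (ltngtP i j) => // lt; first by have := W _ _ lt.
    by have := W _ _ lt; rewrite E.
  move=> lt E; apply: (sepK i j); first by rewrite lt ltn_ord.
  move=> x; rewrite (Hes i).2 (Hes j).2.
  exact: (sep _ _ (Hes i).1 (Hes j).1 E).
have NM : (N <= #|regions M|)%N.
  rewrite -[N]card_ord -(card_codom inj).
  by apply: subset_leq_card; apply/fintype.subsetP => _ /codomP[k ->]; exact: real (Hes k).1.
have [le eqv] := regions_bound M.
have mE : m = d.
  apply/eqP; rewrite eqn_leq md leqNgt; apply/negP => lt.
  have : (region_bound n m < region_bound n d)%N by apply: region_bound_lt; rewrite ?m0.
  by rewrite -(cone_boundE n d0) ltnNge (leq_trans NM le).
subst m; have [c c0 fE] := prodE erefl.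
have ME : \matrix_(i, k) M i k = M by apply/matrixP => i k; rewrite mxE.
exists c, (fun k i => M i k); split; [exact/eqP | split].
  apply/forms_independentE; rewrite ME; apply/eqv/eqP; rewrite eqn_leq le.
  by rewrite -(cone_boundE n d0).
by apply/eq_form_pol; rewrite ME.
Qed.

End Main.

Local Close Scope complex_scope.
Local Close Scope ring_scope.
Local Open Scope R_scope.

Theorem theorem1p2 (n d : nat) (f : mpoly n) :
  (1 <= d)%N -> homogeneous f d ->
  family_at_most (is_hcone f) (cone_bound n d) /\
  components_at_most (fun y => ~ imag_proj f y) (cone_bound n d) /\
  (family_at_least (is_hcone f) (cone_bound n d) <->
   exists (c : R) (l : 'I_d -> vec n),
     c <> 0 /\ forms_independent l /\
     forall x : vec n, peval f x = c * prodR (fun k => linform (l k) x)).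
Proof.
move=> d0 homf; have hf := homogeneousE homf.
split; first exact: family_bound.
split; first exact: components_bound.
split; first by apply: product_of_max_cones => //; case: homf.
by case=> c [l [c0 [indl fE]]]; exact: (max_cones_of_product d0 hf c0 indl fE).
Qed.
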